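(* Let $I$ be a non-empty finite set and, in the setting described in the context, let $$S(I)=\bigcap_{r\in R}\bigcap_{k\in I}\bigcap_{s\in\mathbb{N}}\bigcap_{n=1}^\infty E^{(r)}_{n,k,s}(I),\qquad E^{(r)}_{n,k,s}(I)=\{f\in A(\Omega):\operatorname{Re}(f\circ\phi_r)\restriction_{\mathbb{T}^I}\in D_{n,k,s}(I)\}.$$ Then $S(I)$ is a dense $G_\delta$ subset of $A(\Omega)$.
   Context: For each $i\in I$, $\Omega_i\subset\mathbb{C}$ is a bounded domain whose boundary consists of $k_i$ disjoint Jordan curves; $V_{i,j}$, $j\in\{0,\dots,k_i-1\}$, are the connected components of $\hat{\mathbb{C}}\setminus\overline{\Omega_i}$, $\Omega_{i,j}=\hat{\mathbb{C}}\setminus\overline{V_{i,j}}$, and $\phi_{i,j}:\overline{D}\to\overline{\Omega_{i,j}}$ are fixed Riemann mappings (homeomorphisms of the closed unit disc onto the closure in $\hat{\mathbb{C}}$, conformal from $D$ onto $\Omega_{i,j}$). $\Omega=\prod_{i\in I}\Omega_i$, $\overline{\Omega}=\prod_{i\in I}\overline{\Omega_i}$ with the product topology. $A(\Omega)$ is the space of functions $f:\overline{\Omega}\to\mathbb{C}$ that are continuous on $\overline{\Omega}$ and separately holomorphic on $\Omega$ (holomorphic in each variable $z_{i_0}\in\Omega_{i_0}$ when the others are fixed), with the supremum norm. $R=\prod_{i\in I}\{0,\dots,k_i-1\}$, and for $r=(r_i)\in R$, $\phi_r:\overline{D}^I\to\prod_{i\in I}\overline{\Omega_{i,r_i}}$,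 $(z_i)\mapsto(\phi_{i,r_i}(z_i))$. Functions on $\mathbb{T}^I$ are identified with functions on $\mathbb{R}^I$ that are $2\pi$-periodic in each coordinate via $\theta\mapsto(e^{i\theta_j})_{j\in I}$. For $n,s\in\mathbb{N}$, $k\in I$, $D_{n,k,s}(I)$ is the set of real continuous $u$ on $\mathbb{T}^I$ such that for every $\theta\in\mathbb{R}^I$ and every $v\in\mathbb{R}^I$ with $\frac1s\le|v_k|\le s$ and $|v_j|\le s$ for all $j\in I$, there exists $y$ in the segment $\{\theta+tv:-\frac1n<t<\frac1n\}$ with $|u(\theta)-u(y)|>n\|y-\theta\|_\infty$. *)

(* Defs.v *)
From Stdlib Require Import Reals List ClassicalEpsilon.
From Coquelicot Require Import Coquelicot.

Open Scope R_scope.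

Definition mopen {X : Type} (d : X -> X -> R) (U : X -> Prop) : Prop :=
  forall x, U x -> exists e, 0 < e /\ forall y, d x y < e -> U y.

Definition mclosure {X : Type} (d : X -> X -> R) (A : X -> Prop) (x : X) : Prop :=
  forall e, 0 < e -> exists y, A y /\ d x y < e.

Definition mconnected {X : Type} (d : X -> X -> R) (A : X -> Prop) : Prop :=
  ~ exists U V : X -> Prop, mopen d U /\ mopen d V /\
      (forall x, A x -> U x \/ V x) /\
      (exists x, A x /\ U x) /\ (exists x, A x /\ V x) /\
      (forall x, A x -> U x -> V x -> False).

Definition is_component {X : Type} (d : X -> X -> R) (A W : X -> Prop) : Prop :=
  (exists x, W x) /\ (forall x, W x -> A x) /\ mconnected d W /\
  (forall W' : X -> Prop, mconnected d W' -> (forall x, W' x -> A x) ->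
     (exists x, W' x /\ W x) -> forall x, W' x -> W x).

Definition dC (z w : C) : R := Cmod (Cminus z w).

Definition closC (A : C -> Prop) (z : C) : Prop := mclosure dC A z.

Definition boundaryC (A : C -> Prop) (z : C) : Prop := closC A z /\ ~ A z.

Definition boundedC (A : C -> Prop) : Prop := exists M, forall z, A z -> Cmod z <= M.

Definition bounded_domain (A : C -> Prop) : Prop :=
  (exists z, A z) /\ mopen dC A /\ mconnected dC A /\ boundedC A.

Definition JordanCurve (J : C -> Prop) : Prop :=
  exists g : R -> C,
    (forall t e, 0 < e -> exists del, 0 < del /\
        forall t', Rabs (t' - t) < del -> dC (g t') (g t) < e) /\
    (forall t, g (t + 1) = g t) /\
    (forall s t, 0 <= s < 1 -> 0 <= t < 1 -> g s = g t -> s = t) /\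
    (forall z, J z <-> exists t, g t = z).

Definition boundary_k_jordan (A : C -> Prop) (k : nat) : Prop :=
  exists G : nat -> C -> Prop,
    (forall j, (j < k)%nat -> JordanCurve (G j)) /\
    (forall j j' z, (j < k)%nat -> (j' < k)%nat -> j <> j' -> G j z -> G j' z -> False) /\
    (forall z, boundaryC A z <-> exists j, (j < k)%nat /\ G j z).

(* ---------- the Riemann sphere: option C, None = infinity, chordal metric ---------- *)
Definition Chat := option C.

Definition dChat (x y : Chat) : R :=
  match x, y with
  | Some z, Some w => 2 * Cmod (Cminus z w) / (sqrt (1 + Cmod z ^ 2) * sqrt (1 + Cmod w ^ 2))
  | Some z, None | None, Some z => 2 / sqrt (1 + Cmod z ^ 2)
  | None, None => 0
  end.

Definition closChat (A : Chat -> Prop) (x : Chat) : Prop := mclosure dChat A x.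

(* complement in the Riemann sphere of the closure of A (A bounded subset of C) *)
Definition compl_closure (A : C -> Prop) (x : Chat) : Prop :=
  match x with Some z => ~ closC A z | None => True end.

Definition OmegaHat (V : Chat -> Prop) (x : Chat) : Prop := ~ closChat V x.

(* finite part of a point of the sphere (only used at finite points) *)
Definition fin (x : Chat) : C := match x with Some z => z | None => RtoC 0 end.

(* holomorphy of a Chat-valued map at z, via the charts w and 1/w *)
Definition holo_Chat_at (g : C -> Chat) (z : C) : Prop :=
  match g z with
  | Some _ => ex_derive (fun u => fin (g u)) z
  | None => ex_derive (fun u => match g u with Some v => Cinv v | None => RtoC 0 end) z
  end.

Definition closed_disc (z : C) : Prop := Cmod z <= 1.
Definition open_disc (z : C) : Prop := Cmod z < 1.

Definition riemann_map (O : Chat -> Prop) (phi : C -> Chat) : Prop :=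
  (forall z, closed_disc z -> closChat O (phi z)) /\
  (forall x, closChat O x -> exists z, closed_disc z /\ phi z = x) /\
  (forall z z', closed_disc z -> closed_disc z' -> phi z = phi z' -> z = z') /\
  (forall z e, closed_disc z -> 0 < e -> exists del, 0 < del /\
     forall z', closed_disc z' -> dC z' z < del -> dChat (phi z') (phi z) < e) /\
  (forall z e, closed_disc z -> 0 < e -> exists del, 0 < del /\
     forall z', closed_disc z' -> dChat (phi z') (phi z) < del -> dC z' z < e) /\
  (forall z, open_disc z -> O (phi z)) /\
  (forall x, O x -> exists z, open_disc z /\ phi z = x) /\
  (forall z, open_disc z -> holo_Chat_at phi z).

Definition setting {I : Type} (Om : I -> C -> Prop) (k : I -> nat)
    (V : I -> nat -> Chat -> Prop) (phi : I -> nat -> C -> Chat) : Prop :=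
  (forall i, bounded_domain (Om i)) /\
  (forall i, boundary_k_jordan (Om i) (k i)) /\
  (forall i j, (j < k i)%nat -> is_component dChat (compl_closure (Om i)) (V i j)) /\
  (forall i j j' x, (j < k i)%nat -> (j' < k i)%nat -> j <> j' -> V i j x -> V i j' x -> False) /\
  (forall i W, is_component dChat (compl_closure (Om i)) W ->
     exists j, (j < k i)%nat /\ forall x, W x <-> V i j x) /\
  (forall i j, (j < k i)%nat -> riemann_map (OmegaHat (V i j)) (phi i j)).

Definition upd {I : Type} {T : Type} (z : I -> T) (i0 : I) (w : T) : I -> T :=
  fun i => if excluded_middle_informative (i = i0) then w else z i.

Definition in_Omega {I : Type} (Om : I -> C -> Prop) (z : I -> C) : Prop :=
  forall i, Om i (z i).

Definition in_Omega_bar {I : Type} (Om : I -> C -> Prop) (z : I -> C) : Prop :=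
  forall i, closC (Om i) (z i).

(* f in A(Omega): continuous on the closure (product topology, I finite),
   separately holomorphic on Omega *)
Definition in_A {I : Type} (Om : I -> C -> Prop) (f : (I -> C) -> C) : Prop :=
  (forall z, in_Omega_bar Om z -> forall e, 0 < e -> exists del, 0 < del /\
     forall w, in_Omega_bar Om w -> (forall i, dC (w i) (z i) < del) ->
       dC (f w) (f z) < e) /\
  (forall z, in_Omega Om z -> forall i0 w, Om i0 w ->
     ex_derive (fun u => f (upd z i0 u)) w).

Definition sup_ball {I : Type} (Om : I -> C -> Prop) (f g : (I -> C) -> C) (e : R) : Prop :=
  exists d, d < e /\ forall z, in_Omega_bar Om z -> dC (f z) (g z) <= d.

Definition rel_open {I : Type} (Om : I -> C -> Prop) (U : ((I -> C) -> C) -> Prop) : Prop :=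
  forall f, in_A Om f -> U f -> exists e, 0 < e /\
    forall g, in_A Om g -> sup_ball Om f g e -> U g.

Definition dense_Gdelta_in_A {I : Type} (Om : I -> C -> Prop) (S : ((I -> C) -> C) -> Prop) : Prop :=
  (forall f, S f -> in_A Om f) /\
  (exists U : nat -> ((I -> C) -> C) -> Prop,
     (forall m, rel_open Om (U m)) /\
     (forall f, in_A Om f -> (S f <-> forall m, U m f))) /\
  (forall f, in_A Om f -> forall e, 0 < e -> exists g, S g /\ sup_ball Om f g e).

Definition eit (t : R) : C := (cos t, sin t).

Definition is_supnorm {I : Type} (v : I -> R) (M : R) : Prop :=
  (exists j, M = Rabs (v j)) /\ (forall j, Rabs (v j) <= M).

(* continuous functions on T^I, as 2pi-periodic continuous functions on R^I *)
Definition torus_continuous {I : Type} (u : (I -> R) -> R) : Prop :=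
  (forall th j, u (upd th j (th j + 2 * PI)) = u th) /\
  (forall th e, 0 < e -> exists del, 0 < del /\
     forall th', (forall j, Rabs (th' j - th j) < del) -> Rabs (u th' - u th) < e).

Definition in_D {I : Type} (n : nat) (k : I) (s : nat) (u : (I -> R) -> R) : Prop :=
  torus_continuous u /\
  forall (th v : I -> R),
    / INR s <= Rabs (v k) <= INR s ->
    (forall j, Rabs (v j) <= INR s) ->
    exists t, - / INR n < t < / INR n /\
      let y := fun j => th j + t * v j in
      exists M, is_supnorm (fun j => y j - th j) M /\
        Rabs (u th - u y) > INR n * M.

Definition re_comp {I : Type} (phi : I -> nat -> C -> Chat) (r : I -> nat)
    (f : (I -> C) -> C) : (I -> R) -> R :=
  fun th => Re (f (fun j => fin (phi j (r j) (eit (th j))))).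

Definition S_set {I : Type} (Om : I -> C -> Prop) (k : I -> nat)
    (phi : I -> nat -> C -> Chat) (f : (I -> C) -> C) : Prop :=
  in_A Om f /\
  forall (r : I -> nat), (forall i, (r i < k i)%nat) ->
  forall (kk : I) (s n : nat), (1 <= s)%nat -> (1 <= n)%nat ->
    in_D n kk s (re_comp phi r f).

(* Main.v *)
Require Import Defs.
From Stdlib Require Import Reals List Lra Lia Psatz ClassicalEpsilon FunctionalExtensionality Wf_nat.
From Coquelicot Require Import Coquelicot.

(** By Baire's theorem in the complete space A(Omega) it suffices that each condition
    "Re (f o phi_r) in D_{n,k,s}" defines an open dense set.  Openness is compactness of the torus
    times the set of admissible directions.  For density one adds [e * psi(z_k)^N] to [f], where
    [psi] is the inverse of the Riemann map of the chosen boundary component: on the torus this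
    adds [e cos (N theta_k)], which for large [N] oscillates by a multiple of [e] at a scale where
    the uniformly continuous function Re (f o phi_r) is almost constant.

    The boundary circle is sent by phi into the closure of the domain because the components of
    the complement of that closure are open.  That [psi] is holomorphic,
    and that A(Omega) is complete, rests on the Cauchy formula, obtained from Goursat's theorem on
    rectangles in logarithmic coordinates.  It holds for functions which are merely continuous at
    the centre, hence isolated singularities of continuous functions are removable; as the critical
    points of the Riemann map are isolated, its continuous inverse is holomorphic everywhere. *)

(** * Complex differentiability and integrals *)

(** The inequality defining D_{n,k,s} is strict, so a witness [t] found at one pair (theta, v) also
    serves all nearby pairs, with a positive margin; compactness makes the margin uniform, and a
    perturbation of [f] below half of it is harmless. The bounds on v have two uses: they make the
    set of directions compact, and [1/s <= |v_k|] ensures that moving along v really advances the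
    phase of cos (N theta_k).

    The size of the perturbation is bounded independently of N because psi takes values in the
    closed unit disc; N can therefore be chosen last, after the modulus of continuity of Re (f o
    phi_r).

    The sets D_{n,k,s} shrink as n and s grow, and there are finitely many r and k, so the diagonal
    n = s together with a finite intersection turns the whole family into one sequence of open dense
    sets.

    Infinity may be a value of phi inside the disc. This does not affect the derivative of psi,
    which is taken only on the bounded set [Om]: around each value of psi there, phi stays finite
    and the ordinary chart applies. *)

Definition ccont (F : C -> C) (z : C) : Prop :=
  forall e, 0 < e -> exists d, 0 < d /\
    forall u, Cmod (u - z) < d -> Cmod (F u - F z) < e.

(** The bound is multiplied out and non-strict, so [u = z] needs no exception. *)
Definition cdiff (F : C -> C) (z l : C) : Prop :=
  forall e, 0 < e -> exists d, 0 < d /\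
    forall u, Cmod (u - z) < d -> Cmod (F u - F z - l * (u - z)) <= e * Cmod (u - z).

Lemma is_derive_cdiff (F : C -> C) (z l : C) :
  @is_derive C_AbsRing C_NormedModule F z l <-> cdiff F z l.
Proof.
  split.
  - intros [_ H] e He.
    destruct (H z (fun P HP => HP) (mkposreal e He)) as [d Hd].
    exists d. split; [apply cond_pos|].
    intros u Hu. rewrite (Cmult_comm l). exact (Hd u Hu).
  - intros H. split; [apply is_linear_scal_l|].
    intros x Hx. 
    (* [is_derive] quantifies over all limits [x] of the neighbourhood filter of [z]; uniqueness of
       limits leaves only [z]. *)
    assert (x = z) as ->.
    { symmetry. apply (is_filter_lim_locally_unique (K:=C_AbsRing) (V:=AbsRing_NormedModule C_AbsRing) z x Hx). }
    intros e. destruct (H e (cond_pos e)) as [d [Hd H']].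
    exists (mkposreal d Hd). intros u Hu. generalize (H' u Hu).
    rewrite (Cmult_comm l). exact (fun h => h).
Qed.

Lemma ex_derive_cdiff (F : C -> C) (z : C) :
  @ex_derive C_AbsRing C_NormedModule F z <-> exists l, cdiff F z l.
Proof.
  split; intros [l Hl]; exists l; apply is_derive_cdiff; exact Hl.
Qed.

Lemma Cmod_minus_sym (a b : C) : Cmod (a - b) = Cmod (b - a).
Proof. rewrite <- Cmod_opp. f_equal. ring. Qed.

Lemma Cmod_minus_self (a : C) : Cmod (a - a) = 0.
Proof. replace (a - a)%C with (RtoC 0) by ring. apply Cmod_0. Qed.

Lemma Cmod_minus_triangle (a b c : C) : Cmod (a - c) <= Cmod (a - b) + Cmod (b - c).
Proof. replace (a - c)%C with ((a - b) + (b - c))%C by ring. apply Cmod_triangle. Qed.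

Lemma Cmod_triangle_minus (a b : C) : Cmod (a - b) <= Cmod a + Cmod b.
Proof. rewrite <- (Cmod_opp b). apply Cmod_triangle. Qed.

Lemma Cmod_le_add_minus (a b : C) : Cmod a <= Cmod b + Cmod (a - b).
Proof. replace a with (b + (a - b))%C at 1 by ring. apply Cmod_triangle. Qed.

Lemma Cmod_minus_eq0 (a b : C) : Cmod (a - b) = 0 -> a = b.
Proof. intros H. apply Ceq_minus, Cmod_eq_0, H. Qed.

Lemma Cmod_arch_eq (a b : C) : (forall e, 0 < e -> Cmod (a - b) <= e) -> a = b.
Proof.
  intros H. apply Cmod_minus_eq0. destruct (Cmod_ge_0 (a - b)) as [h|h]; [|easy].
  specialize (H (Cmod (a - b) / 2)). lra.
Qed.

Lemma ccont_const (c z : C) : ccont (fun _ => c) z.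
Proof. intros e He. exists 1. split; [lra|]. intros. rewrite Cmod_minus_self. lra. Qed.

Lemma ccont_id (z : C) : ccont (fun u => u) z.
Proof. intros e He. exists e. auto. Qed.

Lemma ccont_plus (F G : C -> C) z : ccont F z -> ccont G z -> ccont (fun u => F u + G u)%C z.
Proof.
  intros HF HG e He.
  destruct (HF (e/2)) as [d [Hd H1]]; [lra|]. destruct (HG (e/2)) as [d' [Hd' H2]]; [lra|].
  exists (Rmin d d'). split; [now apply Rmin_glb_lt|]. intros u Hu.
  assert (h := Rmin_l d d'). assert (h' := Rmin_r d d').
  specialize (H1 u ltac:(lra)). specialize (H2 u ltac:(lra)).
  replace (F u + G u - (F z + G z))%C with ((F u - F z) + (G u - G z))%C by ring.
  eapply Rle_lt_trans; [apply Cmod_triangle|]. lra.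
Qed.

Lemma ccont_bounded (F : C -> C) z : ccont F z -> exists d, 0 < d /\
  forall u, Cmod (u - z) < d -> Cmod (F u) <= Cmod (F z) + 1.
Proof.
  intros H. destruct (H 1) as [d [Hd H']]; [lra|]. exists d. split; [easy|].
  intros u Hu. specialize (H' u Hu). generalize (Cmod_le_add_minus (F u) (F z)). lra.
Qed.

Lemma ccont_mult (F G : C -> C) z : ccont F z -> ccont G z -> ccont (fun u => F u * G u)%C z.
Proof.
  intros HF HG e He.
  destruct (ccont_bounded G z HG) as [d0 [Hd0 H0]].
  set (A := Cmod (F z) + 1). set (B := Cmod (G z) + 1).
  assert (HA : 0 < A) by (unfold A; generalize (Cmod_ge_0 (F z)); lra).
  assert (HB : 0 < B) by (unfold B; generalize (Cmod_ge_0 (G z)); lra).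
  destruct (HF (e/2/B)) as [d [Hd H1]]; [apply Rdiv_lt_0_compat; lra|].
  destruct (HG (e/2/A)) as [d' [Hd' H2]]; [apply Rdiv_lt_0_compat; lra|].
  exists (Rmin d0 (Rmin d d')). split; [repeat apply Rmin_glb_lt; easy|]. intros u Hu.
  assert (h := Rmin_l d d'). assert (h' := Rmin_r d d').
  assert (h0 := Rmin_l d0 (Rmin d d')). assert (h0' := Rmin_r d0 (Rmin d d')).
  specialize (H0 u ltac:(lra)). specialize (H1 u ltac:(lra)). specialize (H2 u ltac:(lra)).
  replace (F u * G u - F z * G z)%C with ((F u - F z) * G u + F z * (G u - G z))%C by ring.
  eapply Rle_lt_trans; [apply Cmod_triangle|]. rewrite !Cmod_mult.
  fold B in H0.
  assert (Cmod (F u - F z) * Cmod (G u) <= e/2/B * B).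
  { apply Rmult_le_compat; try apply Cmod_ge_0; lra. }
  assert (Cmod (F z) * Cmod (G u - G z) <= Cmod (F z) * (e/2/A)).
  { apply Rmult_le_compat_l; [apply Cmod_ge_0|lra]. }
  assert (Cmod (F z) * (e/2/A) < A * (e/2/A)).
  { apply Rmult_lt_compat_r; [apply Rdiv_lt_0_compat; lra|unfold A; lra]. }
  replace (e/2/B*B) with (e/2) in * by (field; lra).
  replace (A*(e/2/A)) with (e/2) in * by (field; lra). lra.
Qed.

Lemma ccont_opp (F : C -> C) z : ccont F z -> ccont (fun u => - F u)%C z.
Proof.
  intros H e He. destruct (H e He) as [d [Hd H']]. exists d. split; [easy|].
  intros u Hu. replace (- F u - - F z)%C with (- (F u - F z))%C by ring.
  rewrite Cmod_opp. auto.
Qed.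

Lemma ccont_minus (F G : C -> C) z : ccont F z -> ccont G z -> ccont (fun u => F u - G u)%C z.
Proof. intros HF HG. exact (ccont_plus F (fun u => - G u)%C z HF (ccont_opp G z HG)). Qed.

Lemma ccont_neq0 (F : C -> C) z : ccont F z -> F z <> 0 -> exists d, 0 < d /\
  forall u, Cmod (u - z) < d -> Cmod (F z) / 2 <= Cmod (F u).
Proof.
  intros H Hz. apply Cmod_gt_0 in Hz.
  destruct (H (Cmod (F z) / 2)) as [d [Hd H']]; [lra|]. exists d. split; [easy|].
  intros u Hu. specialize (H' u Hu). generalize (Cmod_le_add_minus (F z) (F u)).
  rewrite Cmod_minus_sym. lra.
Qed.

Lemma ccont_inv (F : C -> C) z : ccont F z -> F z <> 0 -> ccont (fun u => / F u)%C z.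
Proof.
  intros H Hz e He. destruct (ccont_neq0 F z H Hz) as [d0 [Hd0 H0]].
  assert (Hm := Hz). apply Cmod_gt_0 in Hm. set (m := Cmod (F z)) in *.
  destruct (H (e * (m * m / 2))) as [d [Hd H1]]; [apply Rmult_lt_0_compat; [easy|]; assert (0 < m * m) by (now apply Rmult_lt_0_compat); lra|].
  exists (Rmin d0 d). split; [now apply Rmin_glb_lt|]. intros u Hu.
  assert (h := Rmin_l d0 d). assert (h' := Rmin_r d0 d).
  specialize (H0 u ltac:(lra)). specialize (H1 u ltac:(lra)).
  assert (HFu : F u <> 0) by (apply Cmod_gt_0; lra).
  replace (/ F u - / F z)%C with ((F z - F u) / (F u * F z))%C by (field; auto).
  rewrite Cmod_div by (now apply Cmult_neq_0). rewrite Cmod_mult, Cmod_minus_sym. fold m.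
  assert (0 < Cmod (F u) * m) by (apply Rmult_lt_0_compat; lra).
  apply (Rmult_lt_reg_r (Cmod (F u) * m)); [easy|].
  unfold Rdiv. rewrite Rmult_assoc, Rinv_l, Rmult_1_r by lra.
  eapply Rlt_le_trans; [apply H1|]. apply Rmult_le_compat_l; [lra|]. nra.
Qed.

Lemma ccont_comp (F G : C -> C) z : ccont F (G z) -> ccont G z -> ccont (fun u => F (G u)) z.
Proof.
  intros HF HG e He. destruct (HF e He) as [d [Hd H]]. destruct (HG d Hd) as [d' [Hd' H']].
  exists d'. split; auto.
Qed.

Lemma ccont_pow (F : C -> C) (n : nat) z : ccont F z -> ccont (fun u => F u ^ n)%C z.
Proof.
  intros H. induction n as [|n IH]; [exact (ccont_const 1 z)|].
  exact (ccont_mult F (fun u => F u ^ n)%C z H IH).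
Qed.

Lemma ccont_ext_loc (F G : C -> C) z :
  (exists d, 0 < d /\ forall u, Cmod (u - z) < d -> F u = G u) -> ccont F z -> ccont G z.
Proof.
  intros [d0 [Hd0 E]] H e He. destruct (H e He) as [d [Hd H']].
  exists (Rmin d0 d). split; [now apply Rmin_glb_lt|]. intros u Hu.
  assert (h := Rmin_l d0 d). assert (h' := Rmin_r d0 d).
  rewrite <- (E u), <- (E z); [apply H'; lra|rewrite Cmod_minus_self; lra|lra].
Qed.

(* Caratheodory's form of differentiability, which turns the rules for derivatives into
   rules for continuity. *)
Lemma cdiff_slope (F : C -> C) z l :
  cdiff F z l <-> exists Q, ccont Q z /\ Q z = l /\ forall u, F u = (F z + Q u * (u - z))%C.
Proof.
  split.
  - intros H.
    exists (fun u => if Ceq_dec u z then l else (F u - F z) / (u - z))%C.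
    split; [|split].
    + intros e He. destruct (H (e/2)) as [d [Hd H']]; [lra|]. exists d. split; [easy|].
      intros u Hu. destruct (Ceq_dec z z) as [_|n]; [|easy].
      destruct (Ceq_dec u z) as [->|n]; [rewrite Cmod_minus_self; easy|].
      assert (Hn : (u - z)%C <> 0) by now apply Cminus_eq_contra.
      assert (Hp := Hn). apply Cmod_gt_0 in Hp.
      replace ((F u - F z) / (u - z) - l)%C with ((F u - F z - l * (u - z)) / (u - z))%C
        by (field; easy).
      rewrite Cmod_div by easy. apply (Rmult_lt_reg_r (Cmod (u - z))); [easy|].
      unfold Rdiv. rewrite Rmult_assoc, Rinv_l, Rmult_1_r by lra.
      specialize (H' u Hu). nra.
    + destruct (Ceq_dec z z); easy.
    + intros u. destruct (Ceq_dec u z) as [->|n]; [ring|]. field.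
      now apply Cminus_eq_contra.
  - intros [Q [HQ [Hl E]]] e He. destruct (HQ e He) as [d [Hd H]]. exists d. split; [easy|].
    intros u Hu. rewrite (E u).
    replace (F z + Q u * (u - z) - F z - l * (u - z))%C with ((Q u - l) * (u - z))%C by ring.
    rewrite Cmod_mult. apply Rmult_le_compat_r; [apply Cmod_ge_0|].
    rewrite <- Hl. left. auto.
Qed.

Lemma cdiff_ccont (F : C -> C) z l : cdiff F z l -> ccont F z.
Proof.
  intros H. apply cdiff_slope in H. destruct H as [Q [HQ [_ E]]].
  apply (ccont_ext_loc (fun u => F z + Q u * (u - z))%C).
  - exists 1. split; [lra|]. intros u _. now rewrite (E u).
  - apply ccont_plus; [apply ccont_const|]. apply ccont_mult; [easy|].
    apply ccont_minus; [apply ccont_id|apply ccont_const].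
Qed.

Lemma cdiff_const (c z : C) : cdiff (fun _ => c) z 0.
Proof.
  apply cdiff_slope. exists (fun _ => RtoC 0). split; [apply ccont_const|]. split; [easy|].
  intros. ring.
Qed.

Lemma cdiff_id (z : C) : cdiff (fun u => u) z 1.
Proof.
  apply cdiff_slope. exists (fun _ => RtoC 1). split; [apply ccont_const|]. split; [easy|].
  intros. ring.
Qed.

Lemma cdiff_plus (F G : C -> C) z l m :
  cdiff F z l -> cdiff G z m -> cdiff (fun u => F u + G u)%C z (l + m).
Proof.
  intros HF HG. apply cdiff_slope in HF, HG. destruct HF as [P [HP [<- EP]]].
  destruct HG as [Q [HQ [<- EQ]]]. apply cdiff_slope.
  exists (fun u => P u + Q u)%C. split; [now apply ccont_plus|]. split; [easy|].
  intros u. rewrite (EP u), (EQ u). ring.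
Qed.

Lemma cdiff_mult (F G : C -> C) z l m :
  cdiff F z l -> cdiff G z m -> cdiff (fun u => F u * G u)%C z (l * G z + F z * m).
Proof.
  intros HF HG. assert (cG := cdiff_ccont _ _ _ HG).
  apply cdiff_slope in HF, HG. destruct HF as [P [HP [<- EP]]].
  destruct HG as [Q [HQ [<- EQ]]]. apply cdiff_slope.
  exists (fun u => P u * G u + F z * Q u)%C. split; [|split; [easy|]].
  - apply ccont_plus; apply ccont_mult; try easy. apply ccont_const.
  - intros u. rewrite (EP u), (EQ u). ring.
Qed.

Lemma cdiff_opp (F : C -> C) z l : cdiff F z l -> cdiff (fun u => - F u)%C z (- l).
Proof.
  intros HF e He. destruct (HF e He) as [d [Hd H]]. exists d. split; [easy|]. intros u Hu.
  replace (- F u - - F z - - l * (u - z))%C with (- (F u - F z - l * (u - z)))%C by ring.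
  rewrite Cmod_opp. auto.
Qed.

Lemma cdiff_minus (F G : C -> C) z l m :
  cdiff F z l -> cdiff G z m -> cdiff (fun u => F u - G u)%C z (l - m).
Proof. intros HF HG. exact (cdiff_plus F _ z l _ HF (cdiff_opp G z m HG)). Qed.

Lemma cdiff_inv (F : C -> C) z l :
  F z <> 0 -> cdiff F z l -> cdiff (fun u => / F u)%C z (- l / (F z * F z)).
Proof.
  intros Hz HF e He. assert (cF := cdiff_ccont _ _ _ HF).
  destruct (ccont_neq0 F z cF Hz) as [d0 [Hd0 H0]].
  apply cdiff_slope in HF. destruct HF as [P [HP [<- EP]]].
  set (Q := fun u => (- P u * / (F u * F z))%C).
  assert (HQ : ccont Q z).
  { apply ccont_mult; [now apply ccont_opp|]. apply ccont_inv; [|now apply Cmult_neq_0].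
    apply ccont_mult; [easy|apply ccont_const]. }
  destruct (HQ e He) as [d [Hd H]].
  exists (Rmin d0 d). split; [now apply Rmin_glb_lt|]. intros u Hu.
  assert (h := Rmin_l d0 d). assert (h' := Rmin_r d0 d).
  specialize (H0 u ltac:(lra)). specialize (H u ltac:(lra)).
  assert (HFu : F u <> 0) by (apply Cmod_gt_0; apply Cmod_gt_0 in Hz; lra).
  replace (/ F u - / F z - - P z / (F z * F z) * (u - z))%C with ((Q u - Q z) * (u - z))%C.
  - rewrite Cmod_mult. apply Rmult_le_compat_r; [apply Cmod_ge_0|lra].
  - unfold Q. replace (/ F u - / F z)%C with ((F z - F u) / (F u * F z))%C by (field; auto).
    rewrite (EP u) at 2. field. auto.
Qed.

Lemma cdiff_comp (F G : C -> C) z l m :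
  cdiff F (G z) l -> cdiff G z m -> cdiff (fun u => F (G u)) z (l * m).
Proof.
  intros HF HG. assert (cG := cdiff_ccont _ _ _ HG).
  apply cdiff_slope in HF, HG. destruct HF as [P [HP [<- EP]]].
  destruct HG as [Q [HQ [<- EQ]]]. apply cdiff_slope.
  exists (fun u => P (G u) * Q u)%C. split; [|split; [easy|]].
  - apply ccont_mult; [|easy]. now apply ccont_comp.
  - intros u. rewrite (EP (G u)), (EQ u) at 1. rewrite <- (EQ u). 
    replace (G z + Q u * (u - z) - G z)%C with (Q u * (u - z))%C by ring. rewrite (EQ u); ring.
Qed.

Lemma cdiff_ext_loc (F G : C -> C) z l :
  (exists d, 0 < d /\ forall u, Cmod (u - z) < d -> F u = G u) -> cdiff F z l -> cdiff G z l.
Proof.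
  intros [d0 [Hd0 E]] H e He. destruct (H e He) as [d [Hd H']].
  exists (Rmin d0 d). split; [now apply Rmin_glb_lt|]. intros u Hu.
  assert (h := Rmin_l d0 d). assert (h' := Rmin_r d0 d).
  rewrite <- (E u), <- (E z); [apply H'; lra|rewrite Cmod_minus_self; lra|lra].
Qed.

Lemma cdiff_pow (F : C -> C) (n : nat) z l :
  cdiff F z l -> exists m, cdiff (fun u => F u ^ n)%C z m.
Proof.
  intros H. induction n as [|n [m IH]]; [exists (RtoC 0); exact (cdiff_const 1 z)|].
  eexists. exact (cdiff_mult F (fun u => F u ^ n)%C z _ _ H IH).
Qed.

(** * Integrals of complex functions of a real variable *)

Definition Cint (g : R -> C) (a b : R) : C := @RInt C_R_CompleteNormedModule g a b.

Definition rcont (g : R -> C) (t : R) : Prop :=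
  forall e, 0 < e -> exists d, 0 < d /\ forall s, Rabs (s - t) < d -> Cmod (g s - g t) < e.

Lemma rcont_continuous (g : R -> C) t : rcont g t -> @continuous _ C_R_CompleteNormedModule g t.
Proof.
  intros H. apply filterlim_locally. intros e. destruct (H e (cond_pos e)) as [d [Hd H']].
  exists (mkposreal d Hd). intros s Hs.
  apply C_NormedModule_mixin_compat1. exact (H' s Hs).
Qed.

Lemma rcont_ex_RInt (g : R -> C) a b :
  (forall t, a <= t <= b -> rcont g t) -> a <= b -> @ex_RInt C_R_CompleteNormedModule g a b.
Proof.
  intros H Hab. apply (@ex_RInt_continuous C_R_CompleteNormedModule). intros t Ht.
  rewrite Rmin_left, Rmax_right in Ht by easy. now apply rcont_continuous, H.
Qed.

Lemma rcont_comp (F : C -> C) (g : R -> C) t :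
  ccont F (g t) -> rcont g t -> rcont (fun s => F (g s)) t.
Proof.
  intros HF Hg e He. destruct (HF e He) as [d [Hd H]]. destruct (Hg d Hd) as [d' [Hd' H']].
  exists d'. split; auto.
Qed.

Lemma rcont_const (c : C) t : rcont (fun _ => c) t.
Proof. intros e He. exists 1. split; [lra|]. intros. now rewrite Cmod_minus_self. Qed.

Lemma rcont_minus (f g : R -> C) t : rcont f t -> rcont g t -> rcont (fun s => f s - g s)%C t.
Proof.
  intros Hf Hg e He.
  destruct (Hf (e / 2)) as [d1 [Hd1 V1]]; [lra|]. destruct (Hg (e / 2)) as [d2 [Hd2 V2]]; [lra|].
  exists (Rmin d1 d2). split; [now apply Rmin_glb_lt|]. intros r Hr.
  assert (q1 := Rmin_l d1 d2). assert (q2 := Rmin_r d1 d2).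
  specialize (V1 r ltac:(lra)). specialize (V2 r ltac:(lra)).
  replace (f r - g r - (f t - g t))%C with ((f r - f t) - (g r - g t))%C by ring.
  eapply Rle_lt_trans; [apply Cmod_triangle_minus|]. lra.
Qed.

Lemma Cint_minus (f g : R -> C) a b : a <= b ->
  (forall t, a <= t <= b -> rcont f t) -> (forall t, a <= t <= b -> rcont g t) ->
  Cint (fun t => f t - g t)%C a b = (Cint f a b - Cint g a b)%C.
Proof.
  intros Hab Hf Hg. apply (@RInt_minus C_R_CompleteNormedModule); now apply rcont_ex_RInt.
Qed.

Lemma Cint_plus (f g : R -> C) a b : a <= b ->
  (forall t, a <= t <= b -> rcont f t) -> (forall t, a <= t <= b -> rcont g t) ->
  Cint (fun t => f t + g t)%C a b = (Cint f a b + Cint g a b)%C.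
Proof.
  intros Hab Hf Hg. apply (@RInt_plus C_R_CompleteNormedModule); now apply rcont_ex_RInt.
Qed.

(** The integral lives in a module over the reals, so a complex factor has to pass through real and
    imaginary parts. *)
Lemma Cint_scal (c : C) (f : R -> C) a b : a <= b ->
  (forall t, a <= t <= b -> rcont f t) ->
  Cint (fun t => c * f t)%C a b = (c * Cint f a b)%C.
Proof.
  intros Hab Hf. apply (@is_RInt_unique C_R_CompleteNormedModule).
  assert (H : is_RInt f a b (Cint f a b)).
  { apply (@RInt_correct C_R_CompleteNormedModule). now apply rcont_ex_RInt. }
  assert (H1 := is_RInt_fct_extend_fst (U:=R_NormedModule) (V:=R_NormedModule) _ _ _ _ H).
  assert (H2 := is_RInt_fct_extend_snd (U:=R_NormedModule) (V:=R_NormedModule) _ _ _ _ H).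
  apply (is_RInt_fct_extend_pair (U:=R_NormedModule) (V:=R_NormedModule)).
  - exact (is_RInt_minus _ _ _ _ _ _ (is_RInt_scal _ _ _ (fst c) _ H1)
             (is_RInt_scal _ _ _ (snd c) _ H2)).
  - exact (is_RInt_plus _ _ _ _ _ _ (is_RInt_scal _ _ _ (fst c) _ H2)
             (is_RInt_scal _ _ _ (snd c) _ H1)).
Qed.

Lemma Cint_const (c : C) a b : Cint (fun _ => c) a b = (RtoC (b - a) * c)%C.
Proof.
  unfold Cint. rewrite (@RInt_const C_R_CompleteNormedModule). apply scal_R_Cmult.
Qed.

Lemma Cint_ext (f g : R -> C) a b : a <= b ->
  (forall t, a <= t <= b -> f t = g t) -> Cint f a b = Cint g a b.
Proof.
  intros Hab H. apply (@RInt_ext C_R_CompleteNormedModule). intros t Ht.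
  rewrite Rmin_left, Rmax_right in Ht by easy. apply H. lra.
Qed.

Lemma Cint_Chasles (f : R -> C) a b c : a <= b -> b <= c ->
  (forall t, a <= t <= c -> rcont f t) ->
  (Cint f a b + Cint f b c)%C = Cint f a c.
Proof.
  intros Hab Hbc H.
  apply (@RInt_Chasles C_R_CompleteNormedModule); apply rcont_ex_RInt; try easy;
  intros; apply H; lra.
Qed.

Lemma Cmod_Cint_le (f : R -> C) a b M : a <= b ->
  (forall t, a <= t <= b -> rcont f t) -> (forall t, a <= t <= b -> Cmod (f t) <= M) ->
  Cmod (Cint f a b) <= (b - a) * M.
Proof.
  intros Hab Hf HM.
  assert (H : is_RInt f a b (Cint f a b)).
  { apply (@RInt_correct C_R_CompleteNormedModule). now apply rcont_ex_RInt. }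
  assert (E : forall z : C, @norm _ C_R_NormedModule z = Cmod z) by (intros; symmetry; apply Cmod_norm).
  rewrite <- E. apply (@norm_RInt_le_const C_R_NormedModule f); try easy.
  intros x Hx. rewrite E. auto.
Qed.

(** * Goursat's theorem *)

Lemma half_pow_pos (n : nat) : 0 < (/ 2) ^ n.
Proof. apply pow_lt. lra. Qed.

Lemma half_pow_small (w d : R) : 0 < d -> exists n, w * (/ 2) ^ n < d.
Proof.
  intros Hd. destruct (Rle_lt_dec w 0) as [Hw|Hw].
  - exists O. simpl. lra.
  - destruct (pow_lt_1_zero (/2)) with (y := d / w) as [N HN].
    + rewrite Rabs_pos_eq; lra.
    + now apply Rdiv_lt_0_compat.
    + exists N. specialize (HN N (Nat.le_refl _)).
      rewrite Rabs_pos_eq in HN by (left; apply half_pow_pos).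
      apply (Rmult_lt_compat_l w) in HN; [|easy].
      replace (w * (d / w)) with d in HN by (field; lra). easy.
Qed.

(** The left ends increase and stay below every right end [x n + w / 2^n], so their supremum lies in
    all the intervals. *)
Lemma nested_intervals_point (x : nat -> R) (w : R) : 0 <= w ->
  (forall n, x n <= x (S n) <= x n + w * (/ 2) ^ S n) ->
  exists p, forall n, x n <= p <= x n + w * (/ 2) ^ n.
Proof.
  intros Hw H.
  assert (A : forall n m, x n <= x (n + m)%nat <= x n + w * (/ 2) ^ n - w * (/2) ^ (n + m)).
  { intros n. induction m as [|m IH].
    - rewrite Nat.add_0_r. lra.
    - rewrite Nat.add_succ_r. specialize (H (n + m)%nat). simpl in *. lra. }
  destruct (completeness (fun y => exists n, y = x n)) as [p [Hp1 Hp2]].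
  - exists (x O + w). intros y [n ->]. specialize (A O n). simpl in A.
    generalize (half_pow_pos n). nra.
  - exists (x O). now exists O.
  - exists p. intros n. split; [apply Hp1; now exists n|].
    apply Hp2. intros y [m ->].
    destruct (Nat.le_ge_cases n m) as [h|h].
    + specialize (A n (m - n)%nat). replace (n + (m - n))%nat with m in A by lia.
      generalize (half_pow_pos m). nra.
    + specialize (A m (n - m)%nat). replace (m + (n - m))%nat with n in A by lia.
      generalize (half_pow_pos n). nra.
Qed.

(** [Phi x1 x2 y1 y2] is a function of the rectangle [x1,x2] x [y1,y2]; cuts may produce degenerate
    pieces. *)
Definition rect_additive (a b c d : R) (Phi : R -> R -> R -> R -> C) : Prop :=
  (forall x1 m x2 y1 y2, a <= x1 -> x1 <= m -> m <= x2 -> x2 <= b ->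
     c <= y1 -> y1 <= y2 -> y2 <= d ->
     Phi x1 x2 y1 y2 = (Phi x1 m y1 y2 + Phi m x2 y1 y2)%C) /\
  (forall x1 x2 y1 m y2, a <= x1 -> x1 <= x2 -> x2 <= b ->
     c <= y1 -> y1 <= m -> m <= y2 -> y2 <= d ->
     Phi x1 x2 y1 y2 = (Phi x1 x2 y1 m + Phi x1 x2 m y2)%C).

(** Quartering: some quarter always carries at least a fourth of the modulus. The nested rectangles
    shrink to a point, where the assumed bound, of order o(size^2), contradicts a decay no faster
    than [4^-n]. *)
Lemma rect_additive_vanish (a b c d : R) (Phi : R -> R -> R -> R -> C) :
  a <= b -> c <= d -> rect_additive a b c d Phi ->
  (forall x y e, a <= x <= b -> c <= y <= d -> 0 < e -> exists del, 0 < del /\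
     forall x1 x2 y1 y2, a <= x1 <= x -> x <= x2 <= b -> c <= y1 <= y -> y <= y2 <= d ->
       x2 - x1 < del -> y2 - y1 < del ->
       Cmod (Phi x1 x2 y1 y2) <= e * ((x2 - x1) + (y2 - y1)) ^ 2) ->
  Phi a b c d = 0.
Proof.
  intros Hab Hcd [Ax Ay] Hloc.
  destruct (Ceq_dec (Phi a b c d) 0) as [E|NE]; [easy|exfalso].
  apply Cmod_gt_0 in NE. set (c0 := Cmod (Phi a b c d)) in *.
  set (w := b - a). set (v := d - c).
  set (P := fun n (p : R * R) => Phi (fst p) (fst p + w * (/2) ^ n) (snd p) (snd p + v * (/2) ^ n)).
  set (big := fun n p => c0 * (/4) ^ n <= Cmod (P n p)).
  set (ok := fun n (p : R * R) => a <= fst p /\ fst p + w * (/2)^n <= b /\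
                       c <= snd p /\ snd p + v * (/2)^n <= d).
  set (sub := fun n (p q : R * R) =>
    fst p <= fst q <= fst p + w * (/2) ^ S n /\ snd p <= snd q <= snd p + v * (/2) ^ S n).
  assert (Hw : 0 <= w) by (unfold w; lra). assert (Hv : 0 <= v) by (unfold v; lra).
  assert (step : forall n p, ok n p -> big n p ->
            exists q, ok (S n) q /\ big (S n) q /\ sub n p q).
  { intros n [x y] (O1 & O2 & O3 & O4) B. unfold big, P in B. simpl fst in *; simpl snd in *.
    assert (hn := half_pow_pos n).
    set (h := w * (/2) ^ S n). set (k := v * (/2) ^ S n).
    assert (Eh : w * (/2) ^ n = h + h) by (unfold h; simpl; lra).
    assert (Ek : v * (/2) ^ n = k + k) by (unfold k; simpl; lra).
    assert (Hh : 0 <= h) by (unfold h; apply Rmult_le_pos; [easy|left; apply half_pow_pos]).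
    assert (Hk : 0 <= k) by (unfold k; apply Rmult_le_pos; [easy|left; apply half_pow_pos]).
    rewrite Eh, Ek in *.
    assert (X : exists x1 x2, x1 = x + h /\ x2 = x1 + h) by eauto.
    assert (Y : exists y1 y2, y1 = y + k /\ y2 = y1 + k) by eauto.
    destruct X as (x1 & x2 & Ex1 & Ex2). destruct Y as (y1 & y2 & Ey1 & Ey2).
    replace (x + (h + h)) with x2 in * by lra. replace (y + (k + k)) with y2 in * by lra.
    assert (S4 : Phi x x2 y y2 =
      ((Phi x x1 y y1 + Phi x1 x2 y y1) + (Phi x x1 y1 y2 + Phi x1 x2 y1 y2))%C).
    { rewrite (Ay x x2 y y1 y2) by lra.
      rewrite (Ax x x1 x2 y y1) by lra. now rewrite (Ax x x1 x2 y1 y2) by lra. }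
    assert (Q : big (S n) (x, y) \/ big (S n) (x1, y) \/ big (S n) (x, y1)
                \/ big (S n) (x1, y1)).
    { unfold big, P; simpl fst; simpl snd; fold h k. rewrite <- Ex1, <- Ex2, <- Ey1, <- Ey2.
      destruct (Rle_lt_dec (c0 * (/4) ^ S n) (Cmod (Phi x x1 y y1))) as [|N1]; [tauto|].
      destruct (Rle_lt_dec (c0 * (/4) ^ S n) (Cmod (Phi x1 x2 y y1))) as [|N2]; [tauto|].
      destruct (Rle_lt_dec (c0 * (/4) ^ S n) (Cmod (Phi x x1 y1 y2))) as [|N3]; [tauto|].
      destruct (Rle_lt_dec (c0 * (/4) ^ S n) (Cmod (Phi x1 x2 y1 y2))) as [|N4]; [tauto|].
      exfalso. rewrite S4 in B.
      assert (T1 := Cmod_triangle (Phi x x1 y y1 + Phi x1 x2 y y1)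
                                  (Phi x x1 y1 y2 + Phi x1 x2 y1 y2)).
      assert (T2 := Cmod_triangle (Phi x x1 y y1) (Phi x1 x2 y y1)).
      assert (T3 := Cmod_triangle (Phi x x1 y1 y2) (Phi x1 x2 y1 y2)).
      simpl pow in N1, N2, N3, N4. lra. }
    unfold ok, sub. simpl fst; simpl snd. fold h k.
    destruct Q as [Q|[Q|[Q|Q]]]; eexists; (split; [|split; [exact Q|]]); simpl; lra. }
  (* Dependent choice of the lower left corners; width and height are determined by the level
     [n]. *)
  set (next := fun n p => epsilon (inhabits p) (fun q => ok (S n) q /\ big (S n) q /\ sub n p q)).
  set (s := fix s n := match n with O => (a, c) | S n => next n (s n) end).
  assert (Hs : forall n, ok n (s n) /\ big n (s n)).
  { induction n as [|n [I1 I2]].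
    - unfold ok, big, P. simpl. unfold w, v.
      replace (a + (b - a) * 1) with b by ring. replace (c + (d - c) * 1) with d by ring.
      fold c0. repeat split; lra.
    - destruct (epsilon_spec (inhabits (s n)) _ (step n (s n) I1 I2)) as (h1 & h2 & _).
      split; [exact h1|exact h2]. }
  assert (Hsub : forall n, sub n (s n) (s (S n))).
  { intros n. destruct (Hs n) as [I1 I2].
    exact (proj2 (proj2 (epsilon_spec (inhabits (s n)) _ (step n (s n) I1 I2)))). }
  destruct (nested_intervals_point (fun n => fst (s n)) w Hw) as [x Hx]; [intros n; apply Hsub|].
  destruct (nested_intervals_point (fun n => snd (s n)) v Hv) as [y Hy]; [intros n; apply Hsub|].
  (* The summand 1 keeps [K] positive for a degenerate rectangle; the tolerance [c0 / (2 * K)] then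
     leaves at most half of the required [c0 * 4^-n]. *)
  set (K := (w + v) ^ 2 + 1).
  assert (HK : 0 < K) by (unfold K; nra).
  destruct (Hloc x y (c0 / (2 * K))) as [del [Hdel H]].
  { specialize (Hx O). simpl in Hx. unfold w in Hx. lra. }
  { specialize (Hy O). simpl in Hy. unfold v in Hy. lra. }
  { apply Rdiv_lt_0_compat; lra. }
  destruct (half_pow_small (w + v) del Hdel) as [n Hn].
  destruct (Hs n) as [(O1 & O2 & O3 & O4) B].
  specialize (Hx n). specialize (Hy n). assert (hn := half_pow_pos n).
  assert (0 <= w * (/2)^n) by nra. assert (0 <= v * (/2)^n) by nra.
  specialize (H (fst (s n)) (fst (s n) + w * (/2)^n) (snd (s n)) (snd (s n) + v * (/2)^n)
    ltac:(lra) ltac:(lra) ltac:(lra) ltac:(lra) ltac:(lra) ltac:(lra)).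
  unfold big, P in B.
  replace (fst (s n) + w * (/ 2) ^ n - fst (s n) + (snd (s n) + v * (/ 2) ^ n - snd (s n)))
    with ((w + v) * (/2)^n) in H by ring.
  rewrite Rpow_mult_distr in H.
  assert (E4 : ((/2)^n)^2 = (/4)^n).
  { rewrite <- pow_mult, Nat.mul_comm, pow_mult. f_equal. simpl. field. }
  rewrite E4 in H.
  assert (h4 : 0 < (/4)^n) by (apply pow_lt; lra).
  assert (c0 * (/4)^n <= c0 / (2*K) * (w+v)^2 * (/4)^n) by lra.
  assert (c0 <= c0 / (2*K) * (w+v)^2) by nra.
  assert (c0 / (2*K) * (w+v)^2 <= c0/(2*K) * K).
  { apply Rmult_le_compat_l; [left; apply Rdiv_lt_0_compat; lra|unfold K; lra]. }
  replace (c0/(2*K)*K) with (c0/2) in * by (field; lra). lra.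
Qed.

Lemma rcont_vertical (h : C -> C) x y : ccont h (x, y) -> rcont (fun t => h (x, t)) y.
Proof.
  intros H. apply (rcont_comp h (fun t => (x, t) : C) y H). intros e He. exists e. split; [easy|].
  intros s Hs. eapply Rle_lt_trans; [|exact Hs]. unfold Cmod, Cminus, Cplus, Copp; simpl.
  right. rewrite <- sqrt_Rsqr_abs. unfold Rsqr. f_equal. ring.
Qed.

Lemma rcont_horizontal (h : C -> C) x y : ccont h (x, y) -> rcont (fun t => h (t, y)) x.
Proof.
  intros H. apply (rcont_comp h (fun t => (t, y) : C) x H). intros e He. exists e. split; [easy|].
  intros s Hs. eapply Rle_lt_trans; [|exact Hs]. unfold Cmod, Cminus, Cplus, Copp; simpl.
  right. rewrite <- sqrt_Rsqr_abs. unfold Rsqr. f_equal. ring.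
Qed.

Lemma Cmod_le_abs (x y : R) : Cmod (x, y) <= Rabs x + Rabs y.
Proof.
  replace ((x, y) : C) with (RtoC x + Ci * RtoC y)%C
    by (unfold Ci, RtoC, Cmult, Cplus; simpl; f_equal; ring).
  eapply Rle_trans; [apply Cmod_triangle|]. rewrite Cmod_mult, Cmod_Ci, !Cmod_R. lra.
Qed.

(** The counterclockwise contour integral of [h dz] along the boundary; [Ci] comes from dz = i dy on
    the vertical sides. *)
Definition rect_int (h : C -> C) (x1 x2 y1 y2 : R) : C :=
  (Ci * (Cint (fun y => h (x2, y)) y1 y2 - Cint (fun y => h (x1, y)) y1 y2) +
   (Cint (fun x => h (x, y1)) x1 x2 - Cint (fun x => h (x, y2)) x1 x2))%C.

(** The affine part of [h] at a point contributes [Ci * l * (x2 - x1) * (y2 - y1)] through the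
    vertical sides and its negative through the horizontal ones. Only the first-order error
    survives, and it is at most [e * s ^ 2]. *)
Lemma goursat_rectangle (h : C -> C) (a b c d : R) : a <= b -> c <= d ->
  (forall x y, a <= x <= b -> c <= y <= d -> exists l, cdiff h (x, y) l) ->
  rect_int h a b c d = 0.
Proof.
  intros Hab Hcd Hd.
  assert (Hc : forall x y, a <= x <= b -> c <= y <= d -> ccont h (x, y)).
  { intros x y Hx Hy. destruct (Hd x y Hx Hy) as [l Hl]. exact (cdiff_ccont _ _ _ Hl). }
  assert (Vc : forall x y, a <= x <= b -> c <= y <= d -> rcont (fun t => h (x, t)) y).
  { intros. now apply rcont_vertical, Hc. }
  assert (Wc : forall x y, a <= x <= b -> c <= y <= d -> rcont (fun t => h (t, y)) x).
  { intros. now apply rcont_horizontal, Hc. }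
  apply rect_additive_vanish; [easy|easy|split|].
  - intros x1 m x2 y1 y2 **. unfold rect_int.
    rewrite <- (Cint_Chasles (fun x => h (x, y1)) x1 m x2); [|lra|lra|intros; apply Wc; lra].
    rewrite <- (Cint_Chasles (fun x => h (x, y2)) x1 m x2); [|lra|lra|intros; apply Wc; lra].
    ring.
  - intros x1 x2 y1 m y2 **. unfold rect_int.
    rewrite <- (Cint_Chasles (fun y => h (x1, y)) y1 m y2); [|lra|lra|intros; apply Vc; lra].
    rewrite <- (Cint_Chasles (fun y => h (x2, y)) y1 m y2); [|lra|lra|intros; apply Vc; lra].
    ring.
  - intros x y e Hx Hy He. destruct (Hd x y Hx Hy) as [l Hl].
    (* Half of [e] because two opposite sides each contribute the error; half of [del] below because
       distances are bounded by the sum of the two side lengths. *)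
    destruct (Hl (e / 2)) as [del [Hdel H]]; [lra|].
    exists (del / 2). split; [lra|]. intros x1 x2 y1 y2 Hx1 Hx2 Hy1 Hy2 Dx Dy.
    set (s := (x2 - x1) + (y2 - y1)).
    set (p := (x, y) : C) in *.
    assert (E : forall u v, x1 <= u <= x2 -> y1 <= v <= y2 ->
              Cmod (h (u, v) - h p - l * ((u, v) - p)) <= e / 2 * s).
    { intros u v Hu Hv.
      assert (Hm : Cmod ((u, v) - p) <= s).
      { unfold p. replace ((u, v) - (x, y))%C with ((u - x, v - y) : C)
          by (unfold Cminus, Cplus, Copp; reflexivity).
        eapply Rle_trans; [apply Cmod_le_abs|]. unfold s.
        apply Rplus_le_compat; apply Rabs_le; lra. }
      eapply Rle_trans; [apply H; unfold s in Hm; lra|]. apply Rmult_le_compat_l; lra. }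
    assert (V : Cmod (Cint (fun y => h (x2, y)) y1 y2 - Cint (fun y => h (x1, y)) y1 y2
              - RtoC (y2 - y1) * (l * RtoC (x2 - x1))) <= (y2 - y1) * (e * s)).
    { rewrite <- Cint_const, <- !Cint_minus; try lra; intros; try apply rcont_minus;
        try apply rcont_const; try (apply Vc; lra).
      apply Cmod_Cint_le; [lra| |].
      - intros; repeat apply rcont_minus; try apply rcont_const; apply Vc; lra.
      - intros t Ht.
        replace (h (x2, t) - h (x1, t) - l * RtoC (x2 - x1))%C with
          ((h (x2, t) - h p - l * ((x2, t) - p)) - (h (x1, t) - h p - l * ((x1, t) - p)))%C.
        + eapply Rle_trans; [apply Cmod_triangle_minus|].
          assert (E2 := E x2 t ltac:(lra) ltac:(lra)).
          assert (E1 := E x1 t ltac:(lra) ltac:(lra)). lra.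
        + replace (RtoC (x2 - x1)) with (((x2, t) : C) - (x1, t))%C; [ring|].
          unfold RtoC, Cminus, Cplus, Copp; simpl; f_equal; ring. }
    assert (W : Cmod (Cint (fun x => h (x, y1)) x1 x2 - Cint (fun x => h (x, y2)) x1 x2
              - RtoC (x2 - x1) * (- l * (Ci * RtoC (y2 - y1)))) <= (x2 - x1) * (e * s)).
    { rewrite <- Cint_const, <- !Cint_minus; try lra; intros; try apply rcont_minus;
        try apply rcont_const; try (apply Wc; lra).
      apply Cmod_Cint_le; [lra| |].
      - intros; repeat apply rcont_minus; try apply rcont_const; apply Wc; lra.
      - intros t Ht.
        replace (h (t, y1) - h (t, y2) - - l * (Ci * RtoC (y2 - y1)))%C with
          ((h (t, y1) - h p - l * ((t, y1) - p)) - (h (t, y2) - h p - l * ((t, y2) - p)))%C.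
        + eapply Rle_trans; [apply Cmod_triangle_minus|].
          assert (E2 := E t y2 ltac:(lra) ltac:(lra)).
          assert (E1 := E t y1 ltac:(lra) ltac:(lra)). lra.
        + replace (Ci * RtoC (y2 - y1))%C with (((t, y2) : C) - (t, y1))%C; [ring|].
          unfold Ci, RtoC, Cminus, Cplus, Copp, Cmult; simpl; f_equal; ring. }
    unfold rect_int.
    match goal with |- Cmod (Ci * ?A + ?B) <= _ =>
      replace (Ci * A + B)%C with
        (Ci * (A - RtoC (y2 - y1) * (l * RtoC (x2 - x1))) +
         (B - RtoC (x2 - x1) * (- l * (Ci * RtoC (y2 - y1)))))%C by ring end.
    eapply Rle_trans; [apply Cmod_triangle|]. rewrite Cmod_mult, Cmod_Ci.
    unfold s in *. simpl. lra.
Qed.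

(** * The exponential and integrals over circles *)

Lemma eit_plus (s t : R) : eit (s + t) = (eit s * eit t)%C.
Proof. unfold eit, Cmult; simpl. rewrite cos_plus, sin_plus. f_equal; ring. Qed.

Lemma Cmod_eit (t : R) : Cmod (eit t) = 1.
Proof.
  unfold eit, Cmod. cbn [fst snd]. rewrite <- !Rsqr_pow2, Rplus_comm, sin2_cos2. apply sqrt_1.
Qed.

Lemma eit_0 : eit 0 = 1.
Proof. unfold eit. now rewrite cos_0, sin_0. Qed.

Lemma eit_2PI (t : R) : eit (t + 2 * PI) = eit t.
Proof. unfold eit. now rewrite cos_plus, sin_plus, cos_2PI, sin_2PI, !Rmult_0_r, !Rmult_1_r, Rminus_0_r, Rplus_0_r. Qed.

Definition cexp (w : C) : C := (RtoC (exp (fst w)) * eit (snd w))%C.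

Lemma cexp_plus (v w : C) : cexp (v + w) = (cexp v * cexp w)%C.
Proof. unfold cexp. simpl. rewrite exp_plus, eit_plus, RtoC_mult. ring. Qed.

Lemma Cmod_cexp (w : C) : Cmod (cexp w) = exp (fst w).
Proof.
  unfold cexp. rewrite Cmod_mult, Cmod_eit, Cmod_R, Rabs_pos_eq; [ring|left; apply exp_pos].
Qed.

Lemma derivable_pt_lim_first_order (f : R -> R) (l : R) : derivable_pt_lim f 0 l ->
  forall e, 0 < e -> exists d, 0 < d /\
    forall h, Rabs h < d -> Rabs (f h - f 0 - l * h) <= e * Rabs h.
Proof.
  intros H e He. destruct (H e He) as [d Hd]. exists d. split; [apply cond_pos|].
  intros h Hh. destruct (Req_dec h 0) as [->|N].
  - replace (f 0 - f 0 - l * 0) with 0 by ring. rewrite Rabs_R0. lra.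
  - specialize (Hd h N Hh). rewrite Rplus_0_l in Hd.
    replace (f h - f 0 - l * h) with (((f h - f 0) / h - l) * h) by (field; easy).
    rewrite Rabs_mult. apply Rmult_le_compat_r; [apply Rabs_pos|lra].
Qed.

Lemma cdiff_cexp_0 : cdiff cexp 0 1.
Proof.
  intros e He.
  (* The error is split below into three terms bounded by [a * r], [4 * a * r] and [a * r], where
     [r] is the modulus of [u]: hence the 6. The bound [a <= 1] gives [Cmod (1 + x) <= 2]. *)
  set (a := Rmin (e / 6) 1).
  assert (Ha : 0 < a) by (apply Rmin_glb_lt; lra).
  assert (Ha1 : a <= e / 6) by apply Rmin_l. assert (Ha2 : a <= 1) by apply Rmin_r.
  destruct (derivable_pt_lim_first_order exp 1 derivable_pt_lim_exp_0 a Ha) as [d1 [D1 H1]].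
  destruct (derivable_pt_lim_first_order _ _ (derivable_pt_lim_cos 0) a Ha) as [d2 [D2 H2]].
  destruct (derivable_pt_lim_first_order _ _ (derivable_pt_lim_sin 0) a Ha) as [d3 [D3 H3]].
  rewrite cos_0, sin_0, exp_0 in *.
  exists (Rmin a (Rmin d1 (Rmin d2 d3))). split; [repeat apply Rmin_glb_lt; lra|].
  intros u. replace (u - 0)%C with u by ring. destruct u as [x y]. intros Hu.
  assert (q1 := Rmin_l a (Rmin d1 (Rmin d2 d3))). assert (q2 := Rmin_r a (Rmin d1 (Rmin d2 d3))).
  assert (q3 := Rmin_l d1 (Rmin d2 d3)). assert (q4 := Rmin_r d1 (Rmin d2 d3)).
  assert (q5 := Rmin_l d2 d3). assert (q6 := Rmin_r d2 d3).
  assert (M := Rmax_Cmod (x, y)). simpl in M.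
  assert (Mx := Rmax_l (Rabs x) (Rabs y)). assert (My := Rmax_r (Rabs x) (Rabs y)).
  specialize (H1 x ltac:(lra)). specialize (H2 y ltac:(lra)). specialize (H3 y ltac:(lra)).
  set (r := Cmod (x, y)) in *.
  replace (cexp (x, y) - cexp 0 - 1 * (x, y))%C with
    (RtoC (exp x - 1 - x) * eit y + (1 + RtoC x) * (eit y - 1 - Ci * RtoC y) + RtoC x * (Ci * RtoC y))%C.
  2:{ unfold cexp; simpl. rewrite exp_0, eit_0.
      replace ((x, y) : C) with (RtoC x + Ci * RtoC y)%C
        by (unfold Ci, RtoC, Cmult, Cplus; simpl; f_equal; ring).
      rewrite !RtoC_minus. ring. }
  eapply Rle_trans; [apply Cmod_triangle|].
  assert (T1 := Cmod_triangle (RtoC (exp x - 1 - x) * eit y) ((1 + RtoC x) * (eit y - 1 - Ci * RtoC y))).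
  rewrite !Cmod_mult, Cmod_eit, !Cmod_R, Cmod_Ci in *.
  assert (T2 : Cmod (1 + RtoC x) <= 2).
  { eapply Rle_trans; [apply Cmod_triangle|]. rewrite !Cmod_R, Rabs_R1. lra. }
  assert (T3 : Cmod (eit y - 1 - Ci * RtoC y) <= 2 * a * Rabs y).
  { replace (eit y - 1 - Ci * RtoC y)%C with ((cos y - 1, sin y - y) : C)
      by (unfold eit, Ci, RtoC, Cminus, Cplus, Copp, Cmult; simpl; f_equal; ring).
    eapply Rle_trans; [apply Cmod_le_abs|].
    replace (cos y - 1 - - 0 * y) with (cos y - 1) in H2 by ring.
    replace (sin y - 0 - 1 * y) with (sin y - y) in H3 by ring. lra. }
  replace (exp x - 1 - 1 * x) with (exp x - 1 - x) in H1 by ring.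
  assert (P0 := Rabs_pos x). assert (P1 := Rabs_pos y).
  assert (Cmod (1 + RtoC x) * Cmod (eit y - 1 - Ci * RtoC y) <= 2 * (2 * a * Rabs y)).
  { apply Rmult_le_compat; try apply Cmod_ge_0; easy. }
  assert (Rabs x * (1 * Rabs y) <= a * r) by nra.
  assert (a * Rabs x <= a * r) by nra. assert (a * Rabs y <= a * r) by nra.
  assert (a * r <= e / 6 * r) by nra. lra.
Qed.

Lemma cdiff_cexp (w : C) : cdiff cexp w (cexp w).
Proof.
  intros e He. assert (P := exp_pos (fst w)).
  destruct (cdiff_cexp_0 (e / exp (fst w))) as [d [Hd H]]; [now apply Rdiv_lt_0_compat|].
  exists d. split; [easy|]. intros u Hu.
  specialize (H (u - w)%C). replace (u - w - 0)%C with (u - w)%C in H by ring.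
  specialize (H Hu).
  replace (cexp u) with (cexp w * cexp (u - w))%C by (rewrite <- cexp_plus; f_equal; ring).
  assert (E0 : cexp 0 = 1) by (unfold cexp; simpl; rewrite exp_0, eit_0; ring).
  rewrite E0 in H.
  replace (cexp w * cexp (u - w) - cexp w - cexp w * (u - w))%C
    with (cexp w * (cexp (u - w) - 1 - 1 * (u - w)))%C by ring.
  rewrite Cmod_mult, Cmod_cexp. apply (Rmult_le_compat_l (exp (fst w))) in H; [|lra].
  replace (exp (fst w) * (e / exp (fst w) * Cmod (u - w))) with (e * Cmod (u - w)) in H
    by (field; lra). easy.
Qed.

(** The integral is taken against the angle, so for [r > 0] it is the contour integral of F(w) / (i
    w). Cauchy's kernel therefore appears below as [w / (w - z)], and radius 0 makes sense. *)
Definition circ (r : R) (F : C -> C) : C := Cint (fun t => F (RtoC r * eit t)%C) 0 (2 * PI).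

Lemma Cmod_circle_pt (r t : R) : 0 <= r -> Cmod (RtoC r * eit t) = r.
Proof. intros. rewrite Cmod_mult, Cmod_eit, Cmod_R, Rabs_pos_eq; lra. Qed.

Lemma two_PI_pos : 0 < 2 * PI.
Proof. generalize PI_RGT_0. lra. Qed.

Lemma cexp_ln (r t : R) : 0 < r -> cexp (ln r, t) = (RtoC r * eit t)%C.
Proof. intros. unfold cexp; simpl. now rewrite exp_ln. Qed.

(* Goursat's theorem for [F (exp w)] on a rectangle of height [2 PI]: by periodicity the
   horizontal sides cancel. *)
Lemma circ_annulus (F : C -> C) (r1 r2 : R) : 0 < r1 -> r1 <= r2 ->
  (forall z, r1 <= Cmod z <= r2 -> exists l, cdiff F z l) -> circ r1 F = circ r2 F.
Proof.
  intros H1 H12 H.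
  assert (P := two_PI_pos).
  assert (Hln : ln r1 <= ln r2).
  { destruct H12 as [h| ->]; [left; now apply ln_increasing|lra]. }
  assert (G := goursat_rectangle (fun w => F (cexp w)) (ln r1) (ln r2) 0 (2 * PI) Hln ltac:(lra)).
  unfold rect_int in G.
  assert (E : forall x, cexp (x, 0) = cexp (x, 2 * PI)).
  { intros x. unfold cexp; simpl. now rewrite <- (eit_2PI 0), Rplus_0_l. }
  rewrite (Cint_ext (fun x => F (cexp (x, 0))) (fun x => F (cexp (x, 2 * PI)))) in G
    by (intros; try rewrite E; easy).
  unfold circ.
  rewrite <- (Cint_ext (fun y => F (cexp (ln r1, y))) (fun t => F (RtoC r1 * eit t)%C))
    by (intros; try rewrite cexp_ln; lra || easy).
  rewrite <- (Cint_ext (fun y => F (cexp (ln r2, y))) (fun t => F (RtoC r2 * eit t)%C))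
    by (intros; try rewrite cexp_ln; lra || easy).
  symmetry. apply Ceq_minus.
  match goal with |- ?A = _ => assert (Ci * A = 0)%C end.
  - rewrite <- G; [ring|]. intros x y Hx Hy.
    destruct (H (cexp (x, y))) as [l Hl].
    + rewrite Cmod_cexp. simpl. split.
      * rewrite <- (exp_ln r1) by easy.
        destruct (proj1 Hx) as [h| ->]; [left; now apply exp_increasing|lra].
      * rewrite <- (exp_ln r2) by lra.
        destruct (proj2 Hx) as [h| ->]; [left; now apply exp_increasing|lra].
    + eexists. apply cdiff_comp; [exact Hl|apply cdiff_cexp].
  - match goal with |- ?A = _ => replace A with (- Ci * (Ci * A))%C; [rewrite H0; ring|] end.
    replace (- Ci * (Ci * _))%C with ((- Ci * Ci) * (Cint (fun y : R => F (cexp (ln r2, y))) 0 (2 * PI) -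
  Cint (fun y : R => F (cexp (ln r1, y))) 0 (2 * PI)))%C by ring.
    replace (- Ci * Ci)%C with (RtoC 1); [ring|].
    unfold Ci, RtoC, Cmult, Copp; simpl; f_equal; ring.
Qed.

Lemma eit_rcont (t : R) : rcont eit t.
Proof.
  intros e He.
  destruct (continuity_cos t (e / 2)) as [d1 [D1 H1]]; [lra|].
  destruct (continuity_sin t (e / 2)) as [d2 [D2 H2]]; [lra|].
  exists (Rmin d1 d2). split; [now apply Rmin_glb_lt|]. intros s Hs.
  assert (q1 := Rmin_l d1 d2). assert (q2 := Rmin_r d1 d2).
  destruct (Req_dec t s) as [->|N]; [now rewrite Cmod_minus_self|].
  specialize (H1 s (conj (conj I N) (Rlt_le_trans _ _ _ Hs q1))).
  specialize (H2 s (conj (conj I N) (Rlt_le_trans _ _ _ Hs q2))).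
  simpl in H1, H2. unfold R_dist in H1, H2.
  replace (eit s - eit t)%C with ((cos s - cos t, sin s - sin t) : C)
    by (unfold eit, Cminus, Cplus, Copp; reflexivity).
  eapply Rle_lt_trans; [apply Cmod_le_abs|]. lra.
Qed.

Lemma circle_rcont (F : C -> C) (r t : R) :
  ccont F (RtoC r * eit t)%C -> rcont (fun s => F (RtoC r * eit s)%C) t.
Proof.
  intros H. apply (rcont_comp F (fun s => RtoC r * eit s)%C t H).
  apply (rcont_comp (fun u => RtoC r * u)%C eit t); [|apply eit_rcont].
  apply ccont_mult; [apply ccont_const|apply ccont_id].
Qed.

(** * Compactness of boxes *)

(** Transport between functions on a finite index type and tuples, on which [compactness_value]
    operates. *)
Fixpoint tn_of {J : Type} (l : list J) (x : J -> R) : Compactness.Tn (length l) R :=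
  match l with
  | nil => tt
  | j :: l' => (x j, tn_of l' x)
  end.

(** The list may repeat an index: its first occurrence decides. Off the list the value is 0. *)
Fixpoint fun_of {J : Type} (l : list J) : Compactness.Tn (length l) R -> J -> R :=
  match l with
  | nil => fun _ _ => 0
  | j :: l' => fun t i => if excluded_middle_informative (i = j) then fst t else fun_of l' (snd t) i
  end.

Lemma bounded_tn_of {J : Type} (l : list J) (a b x : J -> R) :
  (forall j, a j <= x j <= b j) -> bounded_n (length l) (tn_of l a) (tn_of l b) (tn_of l x).
Proof. intros H. induction l as [|j l IH]; simpl; auto. Qed.

Lemma fun_of_bounded {J : Type} (l : list J) (a b : J -> R) t :
  bounded_n (length l) (tn_of l a) (tn_of l b) t ->
  forall j, In j l -> a j <= fun_of l t j <= b j.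
Proof.
  induction l as [|j l IH]; simpl; [easy|]. destruct t as [t1 t2]. simpl.
  intros [H1 H2] i Hi. destruct (excluded_middle_informative (i = j)) as [->|N]; [easy|].
  apply IH; [easy|]. destruct Hi; congruence.
Qed.

Lemma fun_of_close {J : Type} (l : list J) (x : J -> R) d t :
  close_n (length l) d (tn_of l x) t -> forall j, In j l -> Rabs (x j - fun_of l t j) < d.
Proof.
  induction l as [|j l IH]; simpl; [easy|]. destruct t as [t1 t2]. simpl.
  intros [H1 H2] i Hi. destruct (excluded_middle_informative (i = j)) as [->|N]; [easy|].
  apply IH; [easy|]. destruct Hi; congruence.
Qed.

(* Lebesgue numbers: a property [Q x d] that gets weaker when [d] decreases and holds
   locally uniformly on a box holds uniformly there. *)
Lemma box_uniform {J : Type} (l : list J) (Hl : forall j, In j l) (a b : J -> R)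
  (Q : (J -> R) -> R -> Prop) :
  (forall x d d', 0 < d' <= d -> Q x d -> Q x d') ->
  (forall x, (forall j, a j <= x j <= b j) -> exists d, 0 < d /\
     forall y, (forall j, Rabs (y j - x j) < d) -> Q y d) ->
  exists d, 0 < d /\ forall x, (forall j, a j <= x j <= b j) -> Q x d.
Proof.
  intros Hmono Hloc.
  (* [d] serves both as the radius of a neighbourhood and as the value for which [Q] holds there;
     outside the box the gauge [delta] is arbitrary. *)
  set (good := fun (t : Compactness.Tn (length l) R) (d : posreal) =>
    forall y, (forall j, Rabs (y j - fun_of l t j) < d) -> Q y d).
  set (delta := fun t => epsilon (inhabits (mkposreal 1 Rlt_0_1)) (good t)).
  assert (Hdelta : forall t, bounded_n (length l) (tn_of l a) (tn_of l b) t -> good t (delta t)).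
  { intros t Ht. unfold delta. apply epsilon_spec.
    destruct (Hloc (fun_of l t)) as [d [Hd H]].
    - intros j. now apply fun_of_bounded.
    - exists (mkposreal d Hd). exact H. }
  destruct (compactness_value (length l) (tn_of l a) (tn_of l b) delta) as [d Hd].
  exists d. split; [apply cond_pos|]. intros x Hx.
  (* [compactness_value] delivers the covering point [t] only up to double negation. *)
  apply NNPP. intros N. apply (Hd (tn_of l x)); [now apply bounded_tn_of|].
  intros [t (Ht & Hc & Hle)]. apply N.
  apply (Hmono x (delta t)); [split; [apply cond_pos|easy]|].
  apply (Hdelta t Ht). intros j. now apply fun_of_close.
Qed.

Lemma interval_uniform (a b : R) (Q : R -> R -> Prop) :
  (forall x d d', 0 < d' <= d -> Q x d -> Q x d') ->
  (forall x, a <= x <= b -> exists d, 0 < d /\ forall y, Rabs (y - x) < d -> Q y d) ->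
  exists d, 0 < d /\ forall x, a <= x <= b -> Q x d.
Proof.
  intros Hm Hloc.
  destruct (box_uniform (J := unit) (tt :: nil) ltac:(intros []; simpl; auto)
    (fun _ => a) (fun _ => b) (fun x d => Q (x tt) d)) as [d [Hd H]].
  - intros x d d'. apply Hm.
  - intros x Hx. destruct (Hloc (x tt) (Hx tt)) as [d [Hd H]]. exists d. split; [easy|].
    intros y Hy. apply H, Hy.
  - exists d. split; [easy|]. intros x Hx. apply (H (fun _ => x)). now intros _.
Qed.

(** * The Cauchy formula and Taylor remainders *)

Lemma circ_rcont (F : C -> C) r : 0 <= r -> (forall z, Cmod z = r -> ccont F z) ->
  forall t, 0 <= t <= 2 * PI -> rcont (fun s => F (RtoC r * eit s)%C) t.
Proof. intros Hr H t _. apply circle_rcont, H. now apply Cmod_circle_pt. Qed.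

Lemma circ_minus (F G : C -> C) r : 0 <= r ->
  (forall z, Cmod z = r -> ccont F z) -> (forall z, Cmod z = r -> ccont G z) ->
  circ r (fun z => F z - G z)%C = (circ r F - circ r G)%C.
Proof.
  intros Hr HF HG. assert (P := two_PI_pos).
  apply (Cint_minus (fun t => F (RtoC r * eit t)%C) (fun t => G (RtoC r * eit t)%C));
    [lra| |]; now apply circ_rcont.
Qed.

Lemma circ_plus (F G : C -> C) r : 0 <= r ->
  (forall z, Cmod z = r -> ccont F z) -> (forall z, Cmod z = r -> ccont G z) ->
  circ r (fun z => F z + G z)%C = (circ r F + circ r G)%C.
Proof.
  intros Hr HF HG. assert (P := two_PI_pos).
  apply (Cint_plus (fun t => F (RtoC r * eit t)%C) (fun t => G (RtoC r * eit t)%C));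
    [lra| |]; now apply circ_rcont.
Qed.

Lemma circ_scal (c : C) (F : C -> C) r : 0 <= r ->
  (forall z, Cmod z = r -> ccont F z) -> circ r (fun z => c * F z)%C = (c * circ r F)%C.
Proof.
  intros Hr HF. assert (P := two_PI_pos).
  apply (Cint_scal c (fun t => F (RtoC r * eit t)%C)); [lra|]; now apply circ_rcont.
Qed.

Lemma circ_ext (F G : C -> C) r : 0 <= r ->
  (forall z, Cmod z = r -> F z = G z) -> circ r F = circ r G.
Proof.
  intros Hr H. assert (P := two_PI_pos). apply Cint_ext; [lra|]. intros t _.
  apply H. now apply Cmod_circle_pt.
Qed.

Lemma circ_const (c : C) r : circ r (fun _ => c) = (RtoC (2 * PI) * c)%C.
Proof. unfold circ. rewrite Cint_const. now rewrite Rminus_0_r. Qed.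

Lemma circ_0 (F : C -> C) : circ 0 F = (RtoC (2 * PI) * F 0)%C.
Proof.
  rewrite <- (circ_const (F 0) 0). apply circ_ext; [lra|]. intros z Hz.
  now rewrite (Cmod_eq_0 z Hz).
Qed.

Lemma Cmod_circ_le (F : C -> C) r M : 0 <= r -> (forall z, Cmod z = r -> ccont F z) ->
  (forall t, 0 <= t <= 2 * PI -> Cmod (F (RtoC r * eit t)%C) <= M) ->
  Cmod (circ r F) <= 2 * PI * M.
Proof.
  intros Hr HF HM. assert (P := two_PI_pos).
  replace (2 * PI * M) with ((2 * PI - 0) * M) by ring.
  apply Cmod_Cint_le; [lra| |easy]. now apply circ_rcont.
Qed.

(** Continuity of [F] made uniform in the angle passes the limit in the radius under the integral.
    The case [p = 0] connects circles with the value at the centre. *)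
Lemma circ_continuous (F : C -> C) (R0 p : R) : 0 <= p < R0 ->
  (forall z, Cmod z < R0 -> ccont F z) ->
  forall e, 0 < e -> exists d, 0 < d /\
    forall r, 0 <= r -> Rabs (r - p) < d -> Cmod (circ r F - circ p F) <= e.
Proof.
  intros Hp HF e He. assert (P := two_PI_pos).
  set (e' := e / (2 * PI)). assert (He' : 0 < e') by now apply Rdiv_lt_0_compat.
  destruct (interval_uniform 0 (2 * PI) (fun t d => forall r, 0 <= r -> Rabs (r - p) < d ->
    Cmod (F (RtoC r * eit t)%C - F (RtoC p * eit t)%C) <= e')) as [d [Hd H]].
  - intros t d d' Hd H r Hr Hrp. apply H; lra.
  - intros t _.
    destruct (HF (RtoC p * eit t)%C) with (e := e' / 2) as [d1 [D1 H1]];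
      [rewrite Cmod_circle_pt; lra|lra|].
    destruct (eit_rcont t (d1 / 2 / (p + 1))) as [d2 [D2 H2]];
      [apply Rdiv_lt_0_compat; lra|].
    exists (Rmin (d1 / 2) d2). split; [apply Rmin_glb_lt; lra|].
    intros s Hs r Hr Hrp.
    assert (q1 := Rmin_l (d1 / 2) d2). assert (q2 := Rmin_r (d1 / 2) d2).
    specialize (H2 s ltac:(lra)).
    assert (Hps : Cmod (RtoC p * eit s - RtoC p * eit t) < d1 / 2).
    { replace (RtoC p * eit s - RtoC p * eit t)%C with (RtoC p * (eit s - eit t))%C by ring.
      rewrite Cmod_mult, Cmod_R, Rabs_pos_eq by lra.
      assert (X := Cmod_ge_0 (eit s - eit t)).
      apply Rle_lt_trans with ((p + 1) * Cmod (eit s - eit t)); [nra|].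
      apply (Rmult_lt_compat_l (p + 1)) in H2; [|lra].
      replace ((p + 1) * (d1 / 2 / (p + 1))) with (d1 / 2) in H2 by (field; lra). easy. }
    assert (Hrs : Cmod (RtoC r * eit s - RtoC p * eit s) < d1 / 2).
    { replace (RtoC r * eit s - RtoC p * eit s)%C with (RtoC (r - p) * eit s)%C
        by (rewrite RtoC_minus; ring).
      rewrite Cmod_mult, Cmod_R, Cmod_eit. lra. }
    assert (A := H1 (RtoC p * eit s)%C ltac:(lra)).
    assert (B : Cmod (F (RtoC r * eit s)%C - F (RtoC p * eit t)%C) < e' / 2).
    { apply H1. eapply Rle_lt_trans; [apply (Cmod_minus_triangle _ (RtoC p * eit s))|]. lra. }
    eapply Rle_trans; [apply (Cmod_minus_triangle _ (F (RtoC p * eit t)%C))|].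
    rewrite (Cmod_minus_sym (F (RtoC p * eit t)%C)). lra.
  - exists (Rmin d (R0 - p)). split; [apply Rmin_glb_lt; lra|]. intros r Hr Hrp.
    assert (q1 := Rmin_l d (R0 - p)). assert (q2 := Rmin_r d (R0 - p)).
    assert (Hr0 : r < R0) by (generalize (Rle_abs (r - p)); lra).
    unfold circ. rewrite <- Cint_minus; [|lra| |].
    + replace e with ((2 * PI - 0) * e') by (unfold e'; field; lra).
      apply Cmod_Cint_le; [lra| |].
      * intros t Ht. apply rcont_minus; apply circle_rcont, HF; rewrite Cmod_circle_pt; lra.
      * intros t Ht. apply H; lra.
    + intros t Ht. apply circle_rcont, HF; rewrite Cmod_circle_pt; lra.
    + intros t Ht. apply circle_rcont, HF; rewrite Cmod_circle_pt; lra.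
Qed.

(* The circles of radius [p] and [r] themselves need not lie in the domain of holomorphy. *)
Lemma circ_open_annulus (F : C -> C) (R0 p r : R) : 0 <= p -> p < r -> r < R0 ->
  (forall z, Cmod z < R0 -> ccont F z) ->
  (forall z, p < Cmod z < r -> exists l, cdiff F z l) -> circ p F = circ r F.
Proof.
  intros Hp Hpr Hr HF HD. apply Cmod_arch_eq. intros e He.
  destruct (circ_continuous F R0 p ltac:(lra) HF (e / 2) ltac:(lra)) as [d1 [D1 H1]].
  destruct (circ_continuous F R0 r ltac:(lra) HF (e / 2) ltac:(lra)) as [d2 [D2 H2]].
  set (a := Rmin (d1 / 2) ((r - p) / 3)). set (b := Rmin (d2 / 2) ((r - p) / 3)).
  assert (Ha : 0 < a) by (apply Rmin_glb_lt; lra).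
  assert (Hb : 0 < b) by (apply Rmin_glb_lt; lra).
  assert (a1 : a <= d1 / 2) by apply Rmin_l. assert (a2 : a <= (r - p) / 3) by apply Rmin_r.
  assert (b1 : b <= d2 / 2) by apply Rmin_l. assert (b2 : b <= (r - p) / 3) by apply Rmin_r.
  specialize (H1 (p + a) ltac:(lra)). specialize (H2 (r - b) ltac:(lra)).
  replace (p + a - p) with a in H1 by ring. replace (r - b - r) with (- b) in H2 by ring.
  rewrite Rabs_Ropp, Rabs_pos_eq in H2 by lra. rewrite Rabs_pos_eq in H1 by lra.
  specialize (H1 ltac:(lra)). specialize (H2 ltac:(lra)).
  assert (E : circ (p + a) F = circ (r - b) F).
  { apply circ_annulus; try lra. intros z Hz. apply HD. lra. }
  rewrite E in H1. rewrite Cmod_minus_sym in H1.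
  eapply Rle_trans; [apply (Cmod_minus_triangle _ (circ (r - b) F))|]. lra.
Qed.

(** [p] is an exceptional radius on whose circle [F] is merely continuous. It serves for a
    difference quotient based at [z], with [p = Cmod z]; the value [p = R0] means that there is no
    exception. *)
Lemma mean_value (F : C -> C) (R0 p r : R) : 0 < r < R0 ->
  (forall z, Cmod z < R0 -> ccont F z) ->
  (forall z, 0 < Cmod z < R0 -> Cmod z <> p -> exists l, cdiff F z l) ->
  circ r F = (RtoC (2 * PI) * F 0)%C.
Proof.
  intros Hr HF HD. rewrite <- circ_0. symmetry.
  destruct (Rlt_dec 0 p) as [h1|h1]; [destruct (Rlt_dec p r) as [h2|h2]|].
  - transitivity (circ p F); apply (circ_open_annulus F R0); try lra; try easy;
      intros; apply HD; lra.
  - apply (circ_open_annulus F R0); try lra; try easy; intros; apply HD; lra.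
  - apply (circ_open_annulus F R0); try lra; try easy; intros; apply HD; lra.
Qed.

Lemma Cmod_neq_minus (z w : C) : Cmod z <> Cmod w -> (z - w)%C <> 0.
Proof. intros H E. apply H. f_equal. now apply Ceq_minus. Qed.

Lemma kernel_ccont (z u : C) : Cmod u <> Cmod z -> ccont (fun w => w / (w - z))%C u.
Proof.
  intros H. apply ccont_mult; [apply ccont_id|]. apply ccont_inv; [|now apply Cmod_neq_minus].
  apply ccont_minus; [apply ccont_id|apply ccont_const].
Qed.

(** The integral does not depend on the radius, and the kernel tends to 1 as the radius grows. *)
Lemma circ_kernel (z : C) (r : R) : Cmod z < r ->
  circ r (fun w => w / (w - z))%C = RtoC (2 * PI).
Proof.
  intros Hz. assert (P := two_PI_pos). assert (P0 := Cmod_ge_0 z). apply Cmod_arch_eq. intros e He.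
  (* On this circle [Cmod (w - z) >= 2 * PI * Cmod z / e], so the kernel differs from 1 by at most
     [e / (2 * PI)]. *)
  set (r' := r + 2 * PI * Cmod z / e).
  assert (X : 0 <= 2 * PI * Cmod z / e).
  { apply Rmult_le_pos; [nra|]. left. now apply Rinv_0_lt_compat. }
  rewrite (circ_annulus _ r r'); [|lra|unfold r'; lra|].
  - replace (RtoC (2 * PI)) with (circ r' (fun _ => RtoC 1)) by (rewrite circ_const; ring).
    assert (Hr' : Cmod z < r') by (unfold r'; lra).
    rewrite <- circ_minus; [|lra|intros; apply kernel_ccont; lra|intros; apply ccont_const].
    replace e with (2 * PI * (e / (2 * PI))) by (field; lra).
    apply Cmod_circ_le; [lra| |].
    + intros w Hw. apply ccont_minus; [apply kernel_ccont; lra|apply ccont_const].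
    + intros t _. set (w := (RtoC r' * eit t)%C).
      assert (Hw : Cmod w = r') by (apply Cmod_circle_pt; lra).
      assert (N : (w - z)%C <> 0) by (apply Cmod_neq_minus; lra).
      replace (w / (w - z) - 1)%C with (z / (w - z))%C by (field; easy).
      rewrite Cmod_div by easy.
      assert (L : 2 * PI * Cmod z / e <= Cmod (w - z)).
      { generalize (Cmod_le_add_minus w z). unfold r' in Hw. lra. }
      assert (Q : 0 < Cmod (w - z)) by now apply Cmod_gt_0.
      apply (Rmult_le_reg_r (Cmod (w - z))); [easy|].
      unfold Rdiv at 1. rewrite Rmult_assoc, Rinv_l, Rmult_1_r by lra.
      apply (Rmult_le_compat_l (e / (2 * PI))) in L; [|left; now apply Rdiv_lt_0_compat].
      replace (e / (2 * PI) * (2 * PI * Cmod z / e)) with (Cmod z) in L by (field; lra). easy.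
  - intros u Hu.
    eexists. apply cdiff_mult; [apply cdiff_id|]. apply cdiff_inv.
    + apply Cmod_neq_minus; lra.
    + apply cdiff_minus; [apply cdiff_id|apply cdiff_const].
Qed.

(** What Taylor expansion at 0 and passage to uniform limits rely on, stated without any
    differentiability. *)
Definition cauchy_repr (F : C -> C) (r : R) : Prop :=
  (forall z, Cmod z = r -> ccont F z) /\
  forall z, Cmod z < r ->
    circ r (fun w => F w * (w / (w - z)))%C = (RtoC (2 * PI) * F z)%C.

(* At the centre only continuity is assumed, so that removability of isolated singularities
   comes for free. *)
Lemma cauchy_formula (F : C -> C) (R0 r : R) : 0 < r < R0 ->
  (forall z, Cmod z < R0 -> ccont F z) ->
  (forall z, 0 < Cmod z < R0 -> exists l, cdiff F z l) -> cauchy_repr F r.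
Proof.
  intros Hr HF HD. split; [intros; apply HF; lra|]. intros z Hz.
  (* At the centre [F] need not have a difference quotient, but there the kernel is 1 and the
     formula is the mean value property. *)
  destruct (Ceq_dec z 0) as [->|Nz].
  { rewrite Cmod_0 in Hz. rewrite <- (mean_value F R0 R0 r Hr HF).
    - apply circ_ext; [lra|]. intros w Hw. field. apply Cmod_gt_0. lra.
    - intros. now apply HD. }
  assert (Pz := Nz). apply Cmod_gt_0 in Pz.
  destruct (HD z ltac:(lra)) as [l Hl]. apply cdiff_slope in Hl.
  destruct Hl as [Q [HQ [_ EQ]]].
  assert (EQ' : forall w, (w - z)%C <> 0 -> Q w = ((F w - F z) / (w - z))%C).
  { intros w Hw. rewrite (EQ w). field. easy. }
  assert (near : forall u, u <> z -> exists d, 0 < d /\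
            forall w, Cmod (w - u) < d -> ((F w - F z) / (w - z))%C = Q w).
  { intros u Hu. exists (Cmod (u - z)). split.
    - apply Cmod_gt_0. now apply Cminus_eq_contra.
    - intros w Hw. symmetry. apply EQ'. intros E. apply Ceq_minus in E. subst w.
      rewrite Cmod_minus_sym in Hw. lra. }
  assert (cQ : forall u, Cmod u < R0 -> ccont Q u).
  { intros u Hu. destruct (Ceq_dec u z) as [->|N]; [easy|].
    apply (ccont_ext_loc _ _ _ (near u N)).
    apply ccont_mult; [apply ccont_minus; [now apply HF|apply ccont_const]|].
    apply ccont_inv; [apply ccont_minus; [apply ccont_id|apply ccont_const]|].
    now apply Cminus_eq_contra. }
  (* [Q] is the difference quotient of [F] at [z], and [w * Q w] vanishes at 0. It equals [F w * (w
     / (w - z)) - F z * (w / (w - z))], so the formula follows from [circ_kernel]. *)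
  assert (M : circ r (fun w => w * Q w)%C = 0).
  { rewrite (mean_value _ R0 (Cmod z) r Hr); [ring| |].
    - intros u Hu. apply ccont_mult; [apply ccont_id|now apply cQ].
    - intros u Hu Hne. destruct (HD u Hu) as [m Hm].
      assert (N : u <> z) by (intros ->; easy).
      eexists. apply cdiff_mult; [apply cdiff_id|].
      apply (cdiff_ext_loc _ _ _ _ (near u N)).
      apply cdiff_mult; [apply cdiff_minus; [exact Hm|apply cdiff_const]|].
      apply cdiff_inv; [now apply Cminus_eq_contra|].
      apply cdiff_minus; [apply cdiff_id|apply cdiff_const]. }
  rewrite (circ_ext _ (fun w => w * Q w + F z * (w / (w - z)))%C r).
  - rewrite circ_plus, M, circ_scal, circ_kernel; try lra; try easy.
    + ring.
    + intros; apply kernel_ccont; lra.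
    + intros u Hu. apply ccont_mult; [apply ccont_id|apply cQ; lra].
    + intros u Hu. apply ccont_mult; [apply ccont_const|]. apply kernel_ccont; lra.
  - lra.
  - intros w Hw. assert (N : (w - z)%C <> 0) by (apply Cmod_neq_minus; lra).
    rewrite (EQ' w N). field. easy.
Qed.

Lemma cauchy_repr_uniform_limit (F : C -> C) (r : R) : 0 < r ->
  (forall e, 0 < e -> exists G, cauchy_repr G r /\
     forall z, Cmod z <= r -> Cmod (G z - F z) <= e) ->
  (forall z, Cmod z = r -> ccont F z) -> cauchy_repr F r.
Proof.
  intros Hr Happ HF. split; [easy|]. intros z Hz. assert (P := two_PI_pos).
  assert (P0 := Cmod_ge_0 z).
  set (K := r / (r - Cmod z)).
  assert (HK : 0 < K) by (apply Rdiv_lt_0_compat; lra).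
  apply Cmod_arch_eq. intros e He.
  (* [K] bounds the kernel on the circle; the integral accounts for [2 * PI * K * e'] and the value
     at [z] for [2 * PI * e']. *)
  set (e' := e / (2 * PI * (K + 1))).
  assert (He' : 0 < e') by (apply Rdiv_lt_0_compat; [easy|apply Rmult_lt_0_compat; lra]).
  destruct (Happ e' He') as [G [[cG HG] Hap]].
  assert (cFk : forall u, Cmod u = r -> ccont (fun w => F w * (w / (w - z)))%C u).
  { intros u Hu. apply ccont_mult; [now apply HF|apply kernel_ccont; lra]. }
  assert (cGk : forall u, Cmod u = r -> ccont (fun w => G w * (w / (w - z)))%C u).
  { intros u Hu. apply ccont_mult; [now apply cG|apply kernel_ccont; lra]. }
  assert (A : Cmod (circ r (fun w => G w * (w / (w - z)))%C - circ r (fun w => F w * (w / (w - z)))%C)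
              <= 2 * PI * (e' * K)).
  { rewrite <- circ_minus; try easy; [|lra]. apply Cmod_circ_le; [lra| |].
    - intros u Hu. apply ccont_minus; auto.
    - intros t _. set (w := (RtoC r * eit t)%C).
      assert (Hw : Cmod w = r) by (apply Cmod_circle_pt; lra).
      assert (N : (w - z)%C <> 0) by (apply Cmod_neq_minus; lra).
      replace (G w * (w / (w - z)) - F w * (w / (w - z)))%C with ((G w - F w) * (w / (w - z)))%C
        by (field; easy).
      rewrite Cmod_mult, Cmod_div by easy. rewrite Hw.
      assert (Q : r - Cmod z <= Cmod (w - z)) by (generalize (Cmod_le_add_minus w z); lra).
      apply Rmult_le_compat; [apply Cmod_ge_0| |apply Hap; lra|].
      + left. apply Rdiv_lt_0_compat; lra.
      + unfold K. apply Rmult_le_compat_l; [lra|]. apply Rinv_le_contravar; lra. }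
  rewrite HG in A by easy.
  eapply Rle_trans; [apply (Cmod_minus_triangle _ (RtoC (2 * PI) * G z)%C)|].
  rewrite Cmod_minus_sym in A.
  replace (RtoC (2 * PI) * G z - RtoC (2 * PI) * F z)%C with (RtoC (2 * PI) * (G z - F z))%C by ring.
  rewrite Cmod_mult, Cmod_R, Rabs_pos_eq by lra.
  assert (B := Hap z ltac:(lra)).
  assert (E : e = 2 * PI * (e' * K) + 2 * PI * e') by (unfold e'; field; lra).
  rewrite E. apply Rplus_le_compat; [easy|]. apply Rmult_le_compat_l; lra.
Qed.

(* The [q]-th Taylor remainder: [F z = c0 + c1 z + ... + z^q * taylor_rem F r q z]. *)
Definition taylor_rem (F : C -> C) (r : R) (q : nat) (z : C) : C :=
  (/ RtoC (2 * PI) * circ r (fun w => F w * (w / (w - z)) * (/ w) ^ q))%C.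

Section Taylor.
Variables (F : C -> C) (r : R).
Hypothesis (Hr : 0 < r) (HF : cauchy_repr F r).

Let two_PI_C : RtoC (2 * PI) <> 0.
Proof. apply Cmod_gt_0. rewrite Cmod_R, Rabs_pos_eq; generalize two_PI_pos; lra. Qed.

Lemma taylor_rem_ccont q z u : Cmod u = r -> Cmod z < r ->
  ccont (fun w => F w * (w / (w - z)) * (/ w) ^ q)%C u.
Proof.
  intros Hu Hz. apply ccont_mult; [apply ccont_mult; [now apply HF|apply kernel_ccont; lra]|].
  apply ccont_pow, ccont_inv; [apply ccont_id|]. apply Cmod_gt_0. lra.
Qed.

Lemma taylor_rem_0 z : Cmod z < r -> taylor_rem F r 0 z = F z.
Proof.
  intros Hz. unfold taylor_rem.
  rewrite (circ_ext _ (fun w => F w * (w / (w - z)))%C); [|lra|intros; simpl; ring].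
  rewrite (proj2 HF z Hz). field. exact two_PI_C.
Qed.

(** Integrates one step of the geometric series, [w / (w - z) = 1 + (z / w) * (w / (w - z))]. The
    remainder at 0 is the Taylor coefficient of degree [q]. *)
Lemma taylor_rem_S q z : Cmod z < r ->
  taylor_rem F r q z = (taylor_rem F r q 0 + z * taylor_rem F r (S q) z)%C.
Proof.
  intros Hz. unfold taylor_rem.
  replace (z * (/ RtoC (2 * PI) * circ r (fun w => F w * (w / (w - z)) * (/ w) ^ S q)))%C with
    (/ RtoC (2 * PI) * (z * circ r (fun w => F w * (w / (w - z)) * (/ w) ^ S q)))%C by ring.
  rewrite <- Cmult_plus_distr_l. f_equal.
  rewrite <- circ_scal, <- circ_plus; try lra.
  - apply circ_ext; [lra|]. intros w Hw. simpl.
    assert ((w - z)%C <> 0) by (apply Cmod_neq_minus; lra).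
    assert (w <> 0) by (apply Cmod_gt_0; lra).
    generalize ((/ w) ^ q)%C. intros v. field. auto.
  - intros u Hu. apply taylor_rem_ccont; [easy|rewrite Cmod_0; lra].
  - intros u Hu. apply ccont_mult; [apply ccont_const|]. now apply taylor_rem_ccont.
  - intros u Hu. now apply taylor_rem_ccont.
Qed.

Lemma circle_bounded : exists M, 0 < M /\ forall t, 0 <= t <= 2 * PI -> Cmod (F (RtoC r * eit t)%C) <= M.
Proof.
  (* The bound is written [/ d] so that it weakens as [d] decreases, as [interval_uniform]
     demands. *)
  destruct (interval_uniform 0 (2 * PI) (fun t d => Cmod (F (RtoC r * eit t)%C) <= / d)) as [d [Hd H]].
  - intros t d d' Hd H. eapply Rle_trans; [exact H|]. apply Rinv_le_contravar; lra.
  - intros t _. set (m := Cmod (F (RtoC r * eit t)%C) + 1).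
    assert (Hm : 0 < m) by (unfold m; generalize (Cmod_ge_0 (F (RtoC r * eit t)%C)); lra).
    destruct (circle_rcont F r t) with (e := 1) as [d [Hd H]]; [|lra|].
    { apply HF. apply Cmod_circle_pt. lra. }
    exists (Rmin d (/ m)). split; [apply Rmin_glb_lt; [easy|now apply Rinv_0_lt_compat]|].
    intros s Hs. assert (q1 := Rmin_l d (/ m)). assert (q2 := Rmin_r d (/ m)).
    apply Rle_trans with m.
    + specialize (H s ltac:(lra)). unfold m.
      generalize (Cmod_le_add_minus (F (RtoC r * eit s)%C) (F (RtoC r * eit t)%C)). lra.
    + rewrite <- (Rinv_inv m) at 1. apply Rinv_le_contravar; [|easy].
      apply Rmin_glb_lt; [easy|now apply Rinv_0_lt_compat].
  - exists (/ d). split; [now apply Rinv_0_lt_compat|easy].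
Qed.

(** For [Cmod z <= r / 2] the kernel has modulus at most [r / (r / 2) = 2]. *)
Lemma Cmod_taylor_rem_le M q z :
  (forall t, 0 <= t <= 2 * PI -> Cmod (F (RtoC r * eit t)%C) <= M) ->
  Cmod z <= r / 2 -> Cmod (taylor_rem F r q z) <= 2 * M * (/ r) ^ q.
Proof.
  intros HM Hz. unfold taylor_rem. assert (P := two_PI_pos).
  rewrite Cmod_mult, Cmod_inv, Cmod_R, Rabs_pos_eq by (exact two_PI_C || lra).
  apply (Rmult_le_reg_l (2 * PI)); [easy|].
  rewrite <- Rmult_assoc, Rinv_r, Rmult_1_l by lra.
  apply Cmod_circ_le; [lra|intros; apply taylor_rem_ccont; lra|].
  intros t Ht. specialize (HM t Ht). set (w := (RtoC r * eit t)%C) in *.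
  assert (Hw : Cmod w = r) by (apply Cmod_circle_pt; lra).
  assert (N : (w - z)%C <> 0) by (apply Cmod_neq_minus; lra).
  assert (N' : w <> 0) by (apply Cmod_gt_0; lra).
  rewrite !Cmod_mult, Cmod_pow, Cmod_div, Cmod_inv, Hw by easy.
  assert (L : r / 2 <= Cmod (w - z)) by (generalize (Cmod_le_add_minus w z); lra).
  apply Rmult_le_compat_r; [apply pow_le; left; now apply Rinv_0_lt_compat|].
  rewrite (Rmult_comm 2). apply Rmult_le_compat; [apply Cmod_ge_0| |easy|].
  - left. apply Rdiv_lt_0_compat; lra.
  - apply (Rmult_le_reg_r (Cmod (w - z))); [lra|]. unfold Rdiv.
    rewrite Rmult_assoc, Rinv_l by lra. lra.
Qed.

(** The two kernels differ by [w * (z - z') / ((w - z) * (w - z'))], and [r / (r / 2)^2 = 4 / r]. *)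
Lemma taylor_rem_lipschitz M q z z' :
  (forall t, 0 <= t <= 2 * PI -> Cmod (F (RtoC r * eit t)%C) <= M) ->
  Cmod z <= r / 2 -> Cmod z' <= r / 2 ->
  Cmod (taylor_rem F r q z - taylor_rem F r q z') <= M * (4 / r) * (/ r) ^ q * Cmod (z - z').
Proof.
  intros HM Hz Hz'. unfold taylor_rem. assert (P := two_PI_pos).
  match goal with |- Cmod (_ * ?A - _ * ?B) <= _ =>
    replace (/ RtoC (2 * PI) * A - / RtoC (2 * PI) * B)%C with (/ RtoC (2 * PI) * (A - B))%C by ring end.
  rewrite Cmod_mult, Cmod_inv, Cmod_R, Rabs_pos_eq by (exact two_PI_C || lra).
  apply (Rmult_le_reg_l (2 * PI)); [easy|].
  rewrite <- Rmult_assoc, Rinv_r, Rmult_1_l by lra.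
  rewrite <- circ_minus; [|lra|intros; apply taylor_rem_ccont; lra|intros; apply taylor_rem_ccont; lra].
  apply Cmod_circ_le; [lra|intros; apply ccont_minus; apply taylor_rem_ccont; lra|].
  intros t Ht. specialize (HM t Ht). set (w := (RtoC r * eit t)%C) in *.
  assert (Hw : Cmod w = r) by (apply Cmod_circle_pt; lra).
  assert (N : (w - z)%C <> 0) by (apply Cmod_neq_minus; lra).
  assert (N2 : (w - z')%C <> 0) by (apply Cmod_neq_minus; lra).
  assert (N' : w <> 0) by (apply Cmod_gt_0; lra).
  replace (F w * (w / (w - z)) * (/ w) ^ q - F w * (w / (w - z')) * (/ w) ^ q)%C
    with (F w * (w / ((w - z) * (w - z'))) * (/ w) ^ q * (z - z'))%C
    by (generalize ((/ w) ^ q)%C; intros; field; auto).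
  rewrite !Cmod_mult, Cmod_pow, Cmod_div, Cmod_inv, Cmod_mult, Hw by (easy || now apply Cmult_neq_0).
  assert (L : r / 2 <= Cmod (w - z)) by (generalize (Cmod_le_add_minus w z); lra).
  assert (L' : r / 2 <= Cmod (w - z')) by (generalize (Cmod_le_add_minus w z'); lra).
  apply Rmult_le_compat_r; [apply Cmod_ge_0|].
  apply Rmult_le_compat_r; [apply pow_le; left; now apply Rinv_0_lt_compat|].
  assert (LL : r / 2 * (r / 2) <= Cmod (w - z) * Cmod (w - z')) by (apply Rmult_le_compat; lra).
  assert (r2 : 0 < r / 2 * (r / 2)) by nra.
  apply Rmult_le_compat; [apply Cmod_ge_0| |easy|].
  - left. apply Rdiv_lt_0_compat; lra.
  - replace (4 / r) with (r / (r / 2 * (r / 2))) by (field; lra).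
    apply Rmult_le_compat_l; [lra|]. apply Rinv_le_contravar; lra.
Qed.

(** The second remainder is bounded near 0, so F(z) = F(0) + c1 z + O(z^2). Other centres are
    reached by translation. *)
Lemma cauchy_repr_cdiff : exists l, cdiff F 0 l.
Proof.
  destruct circle_bounded as [M [HM0 HM]].
  exists (taylor_rem F r 1 0). intros e He.
  set (K := 2 * M * (/ r) ^ 2).
  assert (HK : 0 < K) by (apply Rmult_lt_0_compat; [lra|apply pow_lt; now apply Rinv_0_lt_compat]).
  exists (Rmin (r / 2) (e / K)). split; [apply Rmin_glb_lt; [lra|now apply Rdiv_lt_0_compat]|].
  intros z Hz. replace (z - 0)%C with z in * by ring.
  assert (q1 := Rmin_l (r / 2) (e / K)). assert (q2 := Rmin_r (r / 2) (e / K)).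
  assert (H0 : Cmod 0 < r) by (rewrite Cmod_0; lra).
  rewrite <- (taylor_rem_0 z), <- (taylor_rem_0 0) by lra.
  rewrite (taylor_rem_S 0 z), (taylor_rem_S 1 z) by lra.
  match goal with |- Cmod ?A <= _ => replace A with (z * z * taylor_rem F r 2 z)%C by ring end.
  rewrite !Cmod_mult. assert (B := Cmod_taylor_rem_le M 2 z HM ltac:(lra)). fold K in B.
  assert (P := Cmod_ge_0 z).
  assert (Cmod z * K <= e).
  { apply Rle_trans with (e / K * K); [apply Rmult_le_compat_r; lra|right; field; lra]. }
  assert (Cmod z * Cmod (taylor_rem F r 2 z) <= e).
  { eapply Rle_trans; [|exact H]. now apply Rmult_le_compat_l. }
  nra.
Qed.

(** The coefficients assumed to vanish are those of degrees 1 to [q]. *)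
Lemma taylor_leading q : (forall j, (j < q)%nat -> taylor_rem F r (S j) 0 = 0) ->
  forall z, Cmod z < r -> F z = (F 0 + z ^ S q * taylor_rem F r (S q) z)%C.
Proof.
  intros Hq z Hz. assert (H0 : Cmod 0 < r) by (rewrite Cmod_0; lra). induction q as [|q IH].
  - rewrite <- (taylor_rem_0 z), <- (taylor_rem_0 0) by easy.
    rewrite (taylor_rem_S 0 z) by easy. simpl; ring.
  - rewrite IH at 1 by (intros; apply Hq; lia).
    rewrite (taylor_rem_S (S q) z), (Hq q) by (lia || easy). simpl. ring.
Qed.

(** For [Cmod z < r / 2] the remainder term of order [n + 1] is at most [2 * M * 2^-(n+1)], which
    tends to 0. *)
Lemma taylor_vanishing : (forall j, taylor_rem F r (S j) 0 = 0) ->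
  forall z, Cmod z < r / 2 -> F z = F 0.
Proof.
  intros H z Hz. destruct circle_bounded as [M [HM0 HM]].
  assert (P := Cmod_ge_0 z).
  apply Cmod_arch_eq. intros e He.
  destruct (half_pow_small (2 * M) e He) as [n Hn].
  rewrite (taylor_leading n) by (easy || lra).
  match goal with |- Cmod ?A <= _ => replace A with (z ^ S n * taylor_rem F r (S n) z)%C by ring end.
  rewrite Cmod_mult, Cmod_pow.
  assert (B := Cmod_taylor_rem_le M (S n) z HM ltac:(lra)).
  assert (Q : Cmod z ^ S n <= (r / 2) ^ S n) by (apply pow_incr; lra).
  apply Rle_trans with ((r / 2) ^ S n * (2 * M * (/ r) ^ S n)).
  - apply Rmult_le_compat; try easy; [now apply pow_le|apply Cmod_ge_0].
  - replace ((r / 2) ^ S n * (2 * M * (/ r) ^ S n)) with (2 * M * ((r / 2) * (/ r)) ^ S n)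
      by (rewrite Rpow_mult_distr; ring).
    replace (r / 2 * / r) with (/ 2) by (field; lra). simpl.
    generalize (half_pow_pos n). nra.
Qed.

End Taylor.

(** * Critical points and holomorphic inverses *)

Lemma cdiff_shift (F : C -> C) (z0 z l : C) :
  cdiff F (z0 + z)%C l -> cdiff (fun u => F (z0 + u)%C) z l.
Proof.
  intros H e He. destruct (H e He) as [d [Hd H']]. exists d. split; [easy|]. intros u Hu.
  specialize (H' (z0 + u)%C). replace (z0 + u - (z0 + z))%C with (u - z)%C in H' by ring. auto.
Qed.

Lemma cdiff_unshift (F : C -> C) (z0 l : C) :
  cdiff (fun u => F (z0 + u)%C) 0 l -> cdiff F z0 l.
Proof.
  intros H e He. destruct (H e He) as [d [Hd H']]. exists d. split; [easy|]. intros u Hu.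
  specialize (H' (u - z0)%C). replace (u - z0 - 0)%C with (u - z0)%C in H' by ring.
  replace (z0 + (u - z0))%C with u in H' by ring. replace (z0 + 0)%C with z0 in H' by ring. auto.
Qed.

Lemma ccont_shift (F : C -> C) (z0 z : C) :
  ccont F (z0 + z)%C -> ccont (fun u => F (z0 + u)%C) z.
Proof.
  intros H. apply (ccont_comp F (fun u => z0 + u)%C); [easy|].
  apply ccont_plus; [apply ccont_const|apply ccont_id].
Qed.

Lemma removable_singularity (F : C -> C) (z0 : C) (R0 : R) : 0 < R0 ->
  (forall z, Cmod (z - z0) < R0 -> ccont F z) ->
  (forall z, z <> z0 -> Cmod (z - z0) < R0 -> exists l, cdiff F z l) ->
  exists l, cdiff F z0 l.
Proof.
  intros HR HF HD.
  destruct (cauchy_repr_cdiff (fun u => F (z0 + u)%C) (R0 / 2)) as [l Hl]; [lra| |].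
  - apply (cauchy_formula _ R0); [lra| |].
    + intros z Hz. apply ccont_shift, HF. now replace (z0 + z - z0)%C with z by ring.
    + intros z Hz. destruct (HD (z0 + z)%C) as [l Hl].
      * intros E. assert (z = 0) as ->; [|rewrite Cmod_0 in Hz; lra].
        replace z with ((z0 + z) - z0)%C by ring. rewrite E. ring.
      * now replace (z0 + z - z0)%C with z by ring.
      * exists l. now apply cdiff_shift.
  - exists l. now apply cdiff_unshift.
Qed.

(** Weierstrass's theorem: the Cauchy formula survives uniform limits and gives back the derivative
    at the centre. *)
Lemma uniform_limit_cdiff (F : C -> C) (z0 : C) (R0 : R) : 0 < R0 ->
  (forall z, Cmod (z - z0) < R0 -> ccont F z) ->
  (forall e, 0 < e -> exists G,
     (forall z, Cmod (z - z0) < R0 -> exists l, cdiff G z l) /\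
     forall z, Cmod (z - z0) < R0 -> Cmod (G z - F z) <= e) ->
  exists l, cdiff F z0 l.
Proof.
  intros HR HF Happ.
  assert (S : forall z, Cmod z < R0 -> Cmod (z0 + z - z0) < R0).
  { intros z Hz. now replace (z0 + z - z0)%C with z by ring. }
  destruct (cauchy_repr_cdiff (fun u => F (z0 + u)%C) (R0 / 2)) as [l Hl]; [lra| |].
  - apply cauchy_repr_uniform_limit; [lra| |].
    + intros e He. destruct (Happ e He) as [G [HG HGF]]. exists (fun u => G (z0 + u)%C). split.
      * apply (cauchy_formula _ R0); [lra| |].
        -- intros z Hz. destruct (HG _ (S z Hz)) as [l Hl]. apply ccont_shift.
           exact (cdiff_ccont _ _ _ Hl).
        -- intros z Hz. destruct (HG (z0 + z)%C) as [l Hl]; [now apply S|].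
           exists l. now apply cdiff_shift.
      * intros z Hz. apply HGF, S. lra.
    + intros z Hz. apply ccont_shift, HF, S. lra.
  - exists l. now apply cdiff_unshift.
Qed.

Lemma least_nat (P : nat -> Prop) : (exists n, P n) -> exists n, P n /\ forall m, (m < n)%nat -> ~ P m.
Proof.
  intros [n Hn]. induction n as [n IH] using lt_wf_ind.
  destruct (classic (exists m, (m < n)%nat /\ P m)) as [[m [Hm HP]]|N].
  - exact (IH m Hm HP).
  - exists n. split; [easy|]. intros m Hm HP. apply N. eauto.
Qed.

(* With [F u = F 0 + u^q G u], [G 0 <> 0] and [G] Lipschitz, moving from [z] to [z (1 + s)]
   changes [F] by at least a multiple of [s |z|^q]. *)
Lemma critical_points_isolated (F : C -> C) (R0 : R) : 0 < R0 ->
  (forall z, Cmod z < R0 -> exists l, cdiff F z l) ->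
  (forall p, 0 < p -> exists z, Cmod z < p /\ F z <> F 0) ->
  exists p, 0 < p /\ forall z, 0 < Cmod z < p -> ~ cdiff F z 0.
Proof.
  intros HR HD HN. set (r := R0 / 2). assert (Hr : 0 < r) by (unfold r; lra).
  assert (HF : cauchy_repr F r).
  { apply (cauchy_formula _ R0); [unfold r; lra| |].
    - intros z Hz. destruct (HD z Hz) as [l Hl]. exact (cdiff_ccont _ _ _ Hl).
    - intros z Hz. apply HD. lra. }
  (* Otherwise [F] would be constant near 0. The least such [j] gives the leading exponent [S q]. *)
  assert (Hex : exists j, taylor_rem F r (S j) 0 <> 0).
  { apply NNPP. intros N. destruct (HN (r / 2)) as [z [Hz HFz]]; [lra|]. apply HFz.
    apply (taylor_vanishing F r Hr HF); [|easy]. intros j. apply NNPP. intros N'. eauto. }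
  destruct (least_nat _ Hex) as [q [Hq Hmin]].
  assert (Hlead := taylor_leading F r Hr HF q (fun j Hj => NNPP _ (Hmin j Hj))).
  set (G := taylor_rem F r (S q)) in *.
  destruct (circle_bounded F r Hr HF) as [M [HM0 HM]].
  assert (HL : exists L, 0 < L /\ forall z z', Cmod z <= r / 2 -> Cmod z' <= r / 2 ->
            Cmod (G z - G z') <= L * Cmod (z - z')).
  { exists (M * (4 / r) * (/ r) ^ S q). split.
    - apply Rmult_lt_0_compat; [|apply pow_lt; now apply Rinv_0_lt_compat].
      apply Rmult_lt_0_compat; [easy|]. apply Rdiv_lt_0_compat; lra.
    - intros z z' Hz Hz'. now apply (taylor_rem_lipschitz F r Hr HF M). }
  destruct HL as [L [HL0 HL]].
  assert (Hg := Hq). apply Cmod_gt_0 in Hg. set (g := Cmod (G 0)) in *.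
  (* [u] below has modulus at most [2 * p]: the first bound keeps it where [G] is Lipschitz, the
     second keeps [G u] within [g / 4] of [G 0]. *)
  set (p := Rmin (r / 4) (g / (8 * L))).
  assert (Hp : 0 < p) by (apply Rmin_glb_lt; [lra|apply Rdiv_lt_0_compat; lra]).
  assert (p1 : p <= r / 4) by apply Rmin_l.
  assert (p2 : L * p <= g / 8).
  { replace (g / 8) with (L * (g / (8 * L))) by (field; lra).
    apply Rmult_le_compat_l; [lra|apply Rmin_r]. }
  exists p. split; [easy|]. intros z Hz Hcrit.
  assert (Hzq : 0 < Cmod z ^ S q) by (apply pow_lt; lra).
  (* Makes the critical-point estimate [e * Cmod (u - z)] equal to [Cmod z ^ S q * s * (g / 8)].
     Together with an equal bound for the variation of [G] this is too small for a main term of at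
     least [Cmod z ^ S q * s * (g / 2)]. *)
  set (e := Cmod z ^ S q * (g / 8) / Cmod z).
  assert (He : 0 < e).
  { apply Rdiv_lt_0_compat; [|lra]. apply Rmult_lt_0_compat; lra. }
  destruct (Hcrit e He) as [d [Hd H]].
  set (s := Rmin (/ 2) (d / 2 / Cmod z)).
  assert (Hs : 0 < s) by (apply Rmin_glb_lt; [lra|apply Rdiv_lt_0_compat; lra]).
  assert (s1 : s <= / 2) by apply Rmin_l.
  assert (s2 : s * Cmod z <= d / 2).
  { replace (d / 2) with (d / 2 / Cmod z * Cmod z) by (field; lra).
    apply Rmult_le_compat_r; [lra|apply Rmin_r]. }
  set (u := (z * RtoC (1 + s))%C).
  assert (Euz : (u - z)%C = (z * RtoC s)%C) by (unfold u; rewrite RtoC_plus; ring).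
  assert (Muz : Cmod (u - z) = s * Cmod z).
  { rewrite Euz, Cmod_mult, Cmod_R, Rabs_pos_eq by lra. ring. }
  assert (Mu : Cmod u <= 2 * p).
  { unfold u. rewrite Cmod_mult, Cmod_R, Rabs_pos_eq by lra. nra. }
  specialize (H u ltac:(lra)).
  replace (F u - F z - 0 * (u - z))%C with
    ((u ^ S q - z ^ S q) * G u + z ^ S q * (G u - G z))%C in H
    by (rewrite (Hlead u), (Hlead z) by lra; ring).
  assert (Gu : g / 2 <= Cmod (G u)).
  { assert (A := HL 0 u ltac:(rewrite Cmod_0; lra) ltac:(lra)).
    rewrite (Cmod_minus_sym 0 u) in A. replace (u - 0)%C with u in A by ring.
    assert (B := Cmod_le_add_minus (G 0) (G u)). fold g in B.
    assert (L * Cmod u <= L * (2 * p)) by (apply Rmult_le_compat_l; lra). lra. }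
  assert (Gd : Cmod (G u - G z) <= L * (s * Cmod z)).
  { rewrite <- Muz. apply HL; lra. }
  (* Moving radially reduces this to the real inequality [s <= (1 + s) ^ S q - 1]. *)
  assert (D : Cmod z ^ S q * s <= Cmod (u ^ S q - z ^ S q)).
  { unfold u. rewrite Cpow_mult_l, <- RtoC_pow.
    replace (z ^ S q * RtoC ((1 + s) ^ S q) - z ^ S q)%C with
      (z ^ S q * RtoC ((1 + s) ^ S q - 1))%C by (rewrite RtoC_minus; ring).
    rewrite Cmod_mult, Cmod_pow, Cmod_R.
    apply Rmult_le_compat_l; [lra|].
    assert (B := pow_R1_Rle (1 + s) q ltac:(lra)).
    assert (s <= (1 + s) ^ S q - 1) by (simpl; nra).
    eapply Rle_trans; [|apply Rle_abs]. easy. }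
  rewrite Muz in H.
  assert (T := Cmod_le_add_minus ((u ^ S q - z ^ S q) * G u)
    ((u ^ S q - z ^ S q) * G u + z ^ S q * (G u - G z))).
  match type of T with _ <= _ + Cmod ?A =>
    replace A with (- (z ^ S q * (G u - G z)))%C in T by ring end.
  rewrite Cmod_opp, !Cmod_mult, Cmod_pow in T.
  assert (X1 : Cmod z ^ S q * s * (g / 2) <= Cmod (u ^ S q - z ^ S q) * Cmod (G u)).
  { apply Rmult_le_compat; [apply Rmult_le_pos; lra|lra|exact D|exact Gu]. }
  assert (X2 : Cmod z ^ S q * Cmod (G u - G z) <= Cmod z ^ S q * s * (g / 8)).
  { replace (Cmod z ^ S q * s * (g / 8)) with (Cmod z ^ S q * (s * (g / 8))) by ring.
    apply Rmult_le_compat_l; [lra|]. eapply Rle_trans; [exact Gd|].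
    replace (L * (s * Cmod z)) with (s * (L * Cmod z)) by ring.
    apply Rmult_le_compat_l; [lra|]. nra. }
  assert (X3 : e * (s * Cmod z) = Cmod z ^ S q * s * (g / 8)) by (unfold e; field; lra).
  assert (0 < Cmod z ^ S q * s * g) by (apply Rmult_lt_0_compat; [apply Rmult_lt_0_compat|]; lra).
  lra.
Qed.

(** Substituting [psi w] into the slope form of [F] gives [w - w0 = Q (psi w) * (psi w - psi w0)];
    hence [/ Q (psi w)] is a continuous slope of [psi]. *)
Lemma cdiff_inverse_regular (F psi : C -> C) (w0 l : C) (d : R) :
  cdiff F (psi w0) l -> l <> 0 -> ccont psi w0 -> 0 < d ->
  (forall w, Cmod (w - w0) < d -> F (psi w) = w) -> exists m, cdiff psi w0 m.
Proof.
  intros HF Hl Hpsi Hd Hinv. apply cdiff_slope in HF. destruct HF as [Q [HQ [Ql E]]].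
  assert (HQp : ccont (fun w => Q (psi w)) w0) by now apply ccont_comp.
  assert (N0 : Q (psi w0) <> 0) by now rewrite Ql.
  destruct (ccont_neq0 _ _ HQp N0) as [d' [Hd' H']].
  set (P := fun w => (/ Q (psi w))%C).
  exists (P w0). apply (cdiff_ext_loc (fun w => psi w0 + P w * (w - w0))%C).
  - exists (Rmin d d'). split; [now apply Rmin_glb_lt|]. intros w Hw.
    assert (q1 := Rmin_l d d'). assert (q2 := Rmin_r d d').
    specialize (H' w ltac:(lra)). assert (I := Hinv w ltac:(lra)).
    assert (I0 := Hinv w0 ltac:(rewrite Cmod_minus_self; lra)).
    rewrite (E (psi w)), I0 in I. unfold P. rewrite <- I at 2.
    apply Cmod_gt_0 in N0. field. apply Cmod_gt_0. lra.
  - apply cdiff_slope. exists P. split; [|split; [easy|]].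
    + now apply ccont_inv.
    + intros u. ring.
Qed.

Lemma cdiff_inverse (F psi : C -> C) (w0 : C) (R0 d : R) : 0 < R0 -> 0 < d ->
  (forall z, Cmod (z - psi w0) < R0 -> exists l, cdiff F z l) ->
  (forall w, Cmod (w - w0) < d -> ccont psi w) ->
  (forall w, Cmod (w - w0) < d -> F (psi w) = w) -> exists m, cdiff psi w0 m.
Proof.
  intros HR Hd HD Hpsi Hinv. set (z0 := psi w0) in *.
  assert (H00 : Cmod (w0 - w0) < d) by (rewrite Cmod_minus_self; lra).
  destruct (critical_points_isolated (fun u => F (z0 + u)%C) R0 HR) as [p [Hp Hiso]].
  - intros z Hz. destruct (HD (z0 + z)%C) as [l Hl].
    + now replace (z0 + z - z0)%C with z by ring.
    + exists l. now apply cdiff_shift.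
  (* [F] is not constant near [z0]: continuity of [psi] brings [psi (w0 + a)] within [p] of [z0],
     and [F] sends these two points to [w0 + a] and [w0]. *)
  - intros p Hp. destruct (Hpsi w0 H00 p Hp) as [d' [Hd' H']]. fold z0 in H'.
    set (a := Rmin d d' / 2).
    assert (q1 := Rmin_l d d'). assert (q2 := Rmin_r d d').
    assert (q3 : 0 < Rmin d d') by now apply Rmin_glb_lt.
    assert (Ha : 0 < a) by (unfold a; lra).
    set (w := (w0 + RtoC a)%C).
    assert (Mw : Cmod (w - w0) = a).
    { unfold w. replace (w0 + RtoC a - w0)%C with (RtoC a) by ring.
      rewrite Cmod_R, Rabs_pos_eq; lra. }
    exists (psi w - z0)%C. split; [apply H'; unfold a in *; lra|].
    replace (z0 + (psi w - z0))%C with (psi w) by ring.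
    replace (z0 + 0)%C with z0 by ring.
    unfold z0. rewrite !Hinv by (unfold a in *; lra).
    intros E. rewrite E, Cmod_minus_self in Mw. lra.
  (* For [w] near but different from [w0], [psi w] lies in the punctured disc free of critical
     points, so only [w0] remains as a possible singularity of [psi]. *)
  - destruct (Hpsi w0 H00 (Rmin p R0)) as [d' [Hd' H']]; [now apply Rmin_glb_lt|]. fold z0 in H'.
    assert (q1 := Rmin_l d d'). assert (q2 := Rmin_r d d').
    assert (r1 := Rmin_l p R0). assert (r2 := Rmin_r p R0).
    apply (removable_singularity psi w0 (Rmin d d')); [now apply Rmin_glb_lt| |].
    + intros w Hw. apply Hpsi. lra.
    + intros w Nw Hw. specialize (H' w ltac:(lra)).
      destruct (HD (psi w) ltac:(lra)) as [l Hl].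
      assert (Nz : psi w <> z0).
      { intros E. apply Nw. rewrite <- (Hinv w), E by lra. unfold z0. now apply Hinv. }
      apply (cdiff_inverse_regular F psi w l (d - Cmod (w - w0))); try easy; try lra.
      * intros ->. apply (Hiso (psi w - z0)%C).
        -- split; [|lra]. apply Cmod_gt_0. now apply Cminus_eq_contra.
        -- apply cdiff_shift. now replace (z0 + (psi w - z0))%C with (psi w) by ring.
      * apply Hpsi. lra.
      * intros w' Hw'. apply Hinv. generalize (Cmod_minus_triangle w' w w0). lra.
Qed.

(** * The Riemann sphere and Riemann maps *)

Definition chord (z : C) : R := sqrt (1 + Cmod z ^ 2).

Lemma chord_ge_1 (z : C) : 1 <= chord z.
Proof. unfold chord. rewrite <- sqrt_1 at 1. apply sqrt_le_1_alt. generalize (pow2_ge_0 (Cmod z)). lra. Qed.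

Lemma chord_le (z : C) : chord z <= 1 + Cmod z.
Proof.
  unfold chord. assert (P := Cmod_ge_0 z). rewrite <- (sqrt_pow2 (1 + Cmod z)) by lra.
  apply sqrt_le_1_alt. nra.
Qed.

Lemma dChat_Some (z w : C) : dChat (Some z) (Some w) = 2 * Cmod (z - w) / (chord z * chord w).
Proof. reflexivity. Qed.

Lemma dC_sym (z w : C) : dC z w = dC w z.
Proof. apply Cmod_minus_sym. Qed.

Lemma dChat_sym (x y : Chat) : dChat x y = dChat y x.
Proof.
  destruct x as [z|], y as [w|]; try easy. rewrite !dChat_Some, Cmod_minus_sym. f_equal. ring.
Qed.

Lemma dChat_refl (x : Chat) : dChat x x = 0.
Proof.
  destruct x as [z|]; [|easy]. rewrite dChat_Some, Cmod_minus_self. unfold Rdiv. ring.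
Qed.

Lemma dChat_le_dC (z w : C) : dChat (Some z) (Some w) <= 2 * dC z w.
Proof.
  rewrite dChat_Some. fold (dC z w). assert (P : 0 <= dC z w) by apply Cmod_ge_0.
  assert (A := chord_ge_1 z). assert (B := chord_ge_1 w).
  assert (D : 1 <= chord z * chord w) by nra.
  apply (Rmult_le_reg_r (chord z * chord w)); [lra|].
  unfold Rdiv. rewrite Rmult_assoc, Rinv_l by lra. nra.
Qed.

Lemma dChat_near_finite (w : C) (e0 : R) : 0 < e0 -> exists e, 0 < e /\
  forall y, dChat (Some w) y < e -> exists z, y = Some z /\ dC w z < e0.
Proof.
  intros He0. assert (W1 := chord_ge_1 w). set (W := chord w) in *.
  assert (P := Cmod_ge_0 w).
  (* The bound [e * W <= 1] excludes infinity, at distance [2 / W]. For finite [z] at Euclidean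
     distance [d] it yields [2 * d < e * W * (1 + Cmod w) + d], and the second bound turns this into
     [d < e0]. *)
  set (e := Rmin (/ W) (e0 / (W * (1 + Cmod w)))).
  assert (e1 : e <= / W) by apply Rmin_l.
  assert (e2 : e * (W * (1 + Cmod w)) <= e0).
  { replace e0 with (e0 / (W * (1 + Cmod w)) * (W * (1 + Cmod w))) by (field; split; lra).
    apply Rmult_le_compat_r; [nra|apply Rmin_r]. }
  assert (e3 : e * W <= 1).
  { apply (Rmult_le_compat_r W) in e1; [|lra]. rewrite Rinv_l in e1; lra. }
  assert (He : 0 < e).
  { apply Rmin_glb_lt; [apply Rinv_0_lt_compat; lra|]. apply Rdiv_lt_0_compat; [easy|].
    apply Rmult_lt_0_compat; lra. }
  exists e. split; [easy|].
  - intros [z|] H.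
    + exists z. split; [easy|]. rewrite dChat_Some in H. fold W in H. unfold dC.
      set (d := Cmod (w - z)) in *. assert (Hd : 0 <= d) by apply Cmod_ge_0.
      assert (Z1 := chord_ge_1 z). assert (Z2 := chord_le z).
      assert (Z3 := Cmod_le_add_minus z w). rewrite Cmod_minus_sym in Z3. fold d in Z3.
      apply (Rmult_lt_compat_r (W * chord z)) in H; [|nra].
      unfold Rdiv in H. rewrite Rmult_assoc, Rinv_l in H by nra.
      assert (e * (W * chord z) <= e * W * (1 + Cmod w + d)).
      { replace (e * (W * chord z)) with (e * W * chord z) by ring.
        apply Rmult_le_compat_l; [nra|lra]. }
      nra.
    + exfalso. change (2 / W < e) in H.
      assert (0 < / W) by (apply Rinv_0_lt_compat; lra). unfold Rdiv in H. lra.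
Qed.

(** Along a path joining the two parts of a separation, the function equal to -1 on one and 1 on the
    other would be continuous, against the intermediate value theorem. Paths are defined on the
    whole line, to match [IVT]. *)
Lemma mconnected_of_paths {X : Type} (d : X -> X -> R) (B : X -> Prop) (c : X) :
  (forall y, B y -> exists g : R -> X, g 0 = c /\ g 1 = y /\ (forall t, B (g t)) /\
     forall t e, 0 < e -> exists del, 0 < del /\
       forall s, Rabs (s - t) < del -> d (g t) (g s) < e) ->
  mconnected d B.
Proof.
  intros Hpath.
  assert (K : forall U W : X -> Prop, mopen d U -> mopen d W ->
     (forall x, B x -> U x \/ W x) -> (forall x, B x -> U x -> W x -> False) ->
     U c -> forall y, B y -> W y -> False).
  { intros U W HU HW Hcov Hdis Hc y By Wy.
    destruct (Hpath y By) as (g & g0 & g1 & gB & gc).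
    set (f := fun t => if excluded_middle_informative (U (g t)) then - (1) else 1).
    assert (fc : continuity f).
    { intros t e He.
      assert (loc : exists del, 0 < del /\ forall s, Rabs (s - t) < del -> f s = f t).
      { destruct (Hcov _ (gB t)) as [Ut|Wt].
        - destruct (HU _ Ut) as [e' [He' H']]. destruct (gc t e' He') as [del [Hdel H]].
          exists del. split; [easy|]. intros s Hs. unfold f.
          destruct (excluded_middle_informative (U (g s))) as [|N]; [|exfalso; apply N, H', H, Hs].
          destruct (excluded_middle_informative (U (g t))); easy.
        - destruct (HW _ Wt) as [e' [He' H']]. destruct (gc t e' He') as [del [Hdel H]].
          exists del. split; [easy|]. intros s Hs. unfold f.
          assert (Ws := H' _ (H s Hs)).
          destruct (excluded_middle_informative (U (g s))) as [Us|N].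
          + exfalso. exact (Hdis _ (gB s) Us Ws).
          + destruct (excluded_middle_informative (U (g t))) as [Ut|N']; [|easy].
            exfalso. exact (Hdis _ (gB t) Ut Wt). }
      destruct loc as [del [Hdel H]]. exists del. split; [easy|].
      intros s [_ Hs]. simpl in *. unfold R_dist in *. rewrite (H s Hs).
      rewrite Rminus_diag, Rabs_R0. easy. }
    destruct (IVT f 0 1 fc) as [t [_ Ht]]; [lra| | |].
    - unfold f. rewrite g0. destruct (excluded_middle_informative (U c)); [lra|easy].
    - unfold f. rewrite g1. destruct (excluded_middle_informative (U y)) as [Uy|]; [|lra].
      exfalso. exact (Hdis y By Uy Wy).
    - unfold f in Ht. destruct (excluded_middle_informative (U (g t))); lra. }
  intros (U & W & HU & HW & Hcov & [x [Bx Ux]] & [y [By Wy]] & Hdis).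
  assert (Bc : B c).
  { destruct (Hpath x Bx) as (g & <- & _ & gB & _). apply gB. }
  destruct (Hcov c Bc) as [Uc|Wc].
  - exact (K U W HU HW Hcov Hdis Uc y By Wy).
  - apply (K W U HW HU) with (y := x); try easy.
    + intros z Bz. destruct (Hcov z Bz); auto.
    + intros z Bz Wz Uz. exact (Hdis z Bz Uz Wz).
Qed.

(** The projection onto [0,1]; it extends paths to the whole line. *)
Definition clamp (t : R) : R := Rmax 0 (Rmin t 1).

Lemma clamp_range t : 0 <= clamp t <= 1.
Proof. unfold clamp. split; [apply Rmax_l|]. apply Rmax_lub; [lra|apply Rmin_r]. Qed.

Lemma clamp_0 : clamp 0 = 0.
Proof. unfold clamp. rewrite Rmin_left, Rmax_left; lra. Qed.

Lemma clamp_1 : clamp 1 = 1.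
Proof. unfold clamp. rewrite Rmin_left, Rmax_right; lra. Qed.

Lemma clamp_lipschitz s t : Rabs (clamp s - clamp t) <= Rabs (s - t).
Proof.
  unfold clamp, Rmax, Rmin. repeat destruct Rle_dec; unfold Rabs; repeat destruct Rcase_abs; lra.
Qed.

Lemma mconnected_disc (w : C) (r : R) : 0 < r ->
  mconnected dChat (fun x => exists z, x = Some z /\ dC w z < r).
Proof.
  intros Hr. apply (mconnected_of_paths _ _ (Some w)). intros y [z [-> Hz]].
  exists (fun t => Some (w + RtoC (clamp t) * (z - w))%C). split; [|split; [|split]].
  - rewrite clamp_0. f_equal. ring.
  - rewrite clamp_1. f_equal. ring.
  - intros t. eexists. split; [reflexivity|]. unfold dC in *.
    replace (w - (w + RtoC (clamp t) * (z - w)))%C with (RtoC (clamp t) * (w - z))%C by ring.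
    assert (c := clamp_range t). rewrite Cmod_mult, Cmod_R, Rabs_pos_eq by lra.
    assert (P := Cmod_ge_0 (w - z)). nra.
  - intros t e He. assert (P : 0 <= dC z w) by apply Cmod_ge_0.
    exists (e / (2 * (dC z w + 1))). split; [apply Rdiv_lt_0_compat; lra|].
    intros s Hs. eapply Rle_lt_trans; [apply dChat_le_dC|]. unfold dC at 1.
    match goal with |- 2 * Cmod ?A < _ =>
      replace A with (RtoC (clamp t - clamp s) * (z - w))%C by (rewrite RtoC_minus; ring) end.
    rewrite Cmod_mult, Cmod_R. fold (dC z w).
    assert (L := clamp_lipschitz s t). rewrite (Rabs_minus_sym (clamp s)) in L.
    apply (Rmult_lt_compat_r (2 * (dC z w + 1))) in Hs; [|lra].
    replace (e / (2 * (dC z w + 1)) * (2 * (dC z w + 1))) with e in Hs by (field; lra).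
    assert (Q := Rabs_pos (clamp t - clamp s)). nra.
Qed.

(** Infinity is joined to [z] by the ray [z / c], with [c] running from 0 to 1. Its chordal
    Lipschitz constant is [2 / Cmod z], the end [c = 0] included. *)
Lemma mconnected_infinity (m : R) : 0 < m ->
  mconnected dChat (fun x => match x with Some z => m < Cmod z | None => True end).
Proof.
  intros Hm. apply (mconnected_of_paths _ _ None). intros [z|] Hz.
  2:{ exists (fun _ => None). repeat split; try easy. intros t e He. exists 1. split; [lra|].
      intros. simpl. easy. }
  set (g := fun c : R => if Req_dec_T c 0 then None else Some (z / RtoC c)%C).
  assert (Nc : forall c : R, c <> 0 -> RtoC c <> 0) by (intros c Hc E; apply Hc; now injection E).
  assert (Ez : forall c, 0 <= c -> c <> 0 -> chord (z / RtoC c) = sqrt (c ^ 2 + Cmod z ^ 2) / c).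
  { intros c Hc Nz. unfold chord. rewrite Cmod_div, Cmod_R, Rabs_pos_eq by auto.
    replace (1 + (Cmod z / c) ^ 2) with ((c ^ 2 + Cmod z ^ 2) / c ^ 2) by (field; easy).
    rewrite sqrt_div_alt by (apply pow_lt; lra). now rewrite sqrt_pow2. }
  assert (S1 : forall c, Cmod z <= sqrt (c ^ 2 + Cmod z ^ 2)).
  { intros c. rewrite <- (sqrt_pow2 (Cmod z)) at 1 by apply Cmod_ge_0.
    apply sqrt_le_1_alt. generalize (pow2_ge_0 c). lra. }
  assert (L : forall a b, 0 <= a -> 0 <= b -> dChat (g a) (g b) <= 2 * Rabs (a - b) / Cmod z).
  { assert (L0 : forall a, 0 <= a -> a <> 0 -> 2 / chord (z / RtoC a) <= 2 * Rabs (a - 0) / Cmod z).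
    { intros a Ha Na. rewrite Ez, Rminus_0_r, Rabs_pos_eq by easy. specialize (S1 a).
      replace (2 / (sqrt (a ^ 2 + Cmod z ^ 2) / a)) with (2 * a * / sqrt (a ^ 2 + Cmod z ^ 2))
        by (field; lra).
      apply Rmult_le_compat_l; [lra|]. apply Rinv_le_contravar; lra. }
    intros a b Ha Hb. unfold g.
    destruct (Req_dec_T a 0) as [->|Na], (Req_dec_T b 0) as [->|Nb].
    - simpl. rewrite Rminus_0_r, Rabs_R0. unfold Rdiv. lra.
    - rewrite Rabs_minus_sym. now apply L0.
    - now apply L0.
    - rewrite dChat_Some, !Ez by easy.
      replace (z / RtoC a - z / RtoC b)%C with (z * RtoC (b - a) / (RtoC a * RtoC b))%C
        by (rewrite RtoC_minus; field; auto).
      rewrite Cmod_div, !Cmod_mult, !Cmod_R by (apply Cmult_neq_0; auto).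
      rewrite (Rabs_pos_eq a), (Rabs_pos_eq b), (Rabs_minus_sym b a) by easy.
      assert (A := S1 a). assert (B := S1 b).
      set (A' := sqrt (a ^ 2 + Cmod z ^ 2)) in *. set (B' := sqrt (b ^ 2 + Cmod z ^ 2)) in *.
      replace (2 * (Cmod z * Rabs (a - b) / (a * b)) / (A' / a * (B' / b))) with
        (2 * Rabs (a - b) * (Cmod z * / (A' * B'))) by (field; repeat split; lra).
      apply Rmult_le_compat_l; [generalize (Rabs_pos (a - b)); lra|].
      apply (Rmult_le_reg_r (Cmod z * (A' * B'))); [repeat apply Rmult_lt_0_compat; lra|].
      replace (Cmod z * / (A' * B') * (Cmod z * (A' * B'))) with (Cmod z * Cmod z) by (field; lra).
      replace (/ Cmod z * (Cmod z * (A' * B'))) with (A' * B') by (field; lra).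
      apply Rmult_le_compat; lra. }
  exists (fun t => g (clamp t)). split; [|split; [|split]].
  - rewrite clamp_0. unfold g. now destruct (Req_dec_T 0 0).
  - rewrite clamp_1. unfold g. destruct (Req_dec_T 1 0) as [h|_]; [lra|].
    replace (z / RtoC 1)%C with z; [easy|]. field.
  - intros t. unfold g. destruct (Req_dec_T (clamp t) 0) as [|N]; [easy|].
    assert (c := clamp_range t). rewrite Cmod_div, Cmod_R, Rabs_pos_eq by (auto; lra).
    apply (Rmult_lt_reg_r (clamp t)); [lra|]. unfold Rdiv.
    rewrite Rmult_assoc, Rinv_l by easy. nra.
  - intros t e He. exists (e * Cmod z / 2). split; [apply Rdiv_lt_0_compat; nra|].
    intros s Hs. eapply Rle_lt_trans; [apply L; apply clamp_range|].
    assert (K := clamp_lipschitz s t). rewrite (Rabs_minus_sym (clamp s)) in K.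
    apply (Rmult_lt_reg_r (Cmod z / 2)); [lra|].
    replace (2 * Rabs (clamp t - clamp s) / Cmod z * (Cmod z / 2)) with (Rabs (clamp t - clamp s))
      by (field; lra). lra.
Qed.

(** Discs around finite points and exteriors of discs around infinity are connected neighbourhoods;
    boundedness of [Om] puts the latter off its closure. *)
Lemma compl_closure_locally_connected (Om : C -> Prop) (x : Chat) : boundedC Om ->
  compl_closure Om x -> exists B e, mconnected dChat B /\ (forall y, B y -> compl_closure Om y) /\
    0 < e /\ forall y, dChat x y < e -> B y.
Proof.
  intros [M HM] Hx. destruct x as [w|].
  - simpl in Hx. unfold closC, mclosure in Hx. apply not_all_ex_not in Hx. destruct Hx as [e0 He0].
    apply imply_to_and in He0. destruct He0 as [He0 Hno].
    destruct (dChat_near_finite w e0 He0) as [e [He H]].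
    exists (fun y => exists z, y = Some z /\ dC w z < e0), e.
    split; [now apply mconnected_disc|]. split; [|split; [easy|exact H]].
    intros y [z [-> Hz]]. simpl. intros Hcl. destruct (Hcl (e0 - dC w z)) as [u [Hu Hd]]; [lra|].
    apply Hno. exists u. split; [easy|]. unfold dC in *.
    generalize (Cmod_minus_triangle w z u). lra.
  - set (m := Rmax M 0 + 1).
    assert (m1 : M < m) by (unfold m; generalize (Rmax_l M 0); lra).
    assert (m2 : 0 < m) by (unfold m; generalize (Rmax_r M 0); lra).
    (* As [chord z <= 1 + Cmod z], chordal distance to infinity below [2 / (1 + m)] forces
       [m < Cmod z]. *)
    exists (fun x => match x with Some z => m < Cmod z | None => True end), (2 / (1 + m)).
    split; [now apply mconnected_infinity|]. split; [|split].
    + intros [z|] Hz; [|easy]. simpl. intros Hcl.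
      destruct (Hcl (Cmod z - M)) as [u [Hu Hd]]; [lra|]. specialize (HM u Hu).
      unfold dC in Hd. generalize (Cmod_le_add_minus z u). lra.
    + apply Rdiv_lt_0_compat; lra.
    + intros [z|] Hz; [|easy]. change (2 / chord z < 2 / (1 + m)) in Hz.
      assert (A := chord_ge_1 z). assert (B := chord_le z).
      assert (D : 1 + m < chord z); [|lra].
      apply Rnot_le_lt. intros N.
      assert (/ (1 + m) <= / chord z) by (apply Rinv_le_contravar; lra).
      unfold Rdiv in Hz. lra.
Qed.

(** Were [x] off the closure of [Om], a connected neighbourhood of it would meet [V], hence lie in
    [V] by maximality; but it also contains points off the closure of [V]. *)
Lemma component_boundary (Om : C -> Prop) (V : Chat -> Prop) (x : Chat) : boundedC Om ->
  is_component dChat (compl_closure Om) V -> closChat V x -> closChat (OmegaHat V) x ->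
  exists w, x = Some w /\ closC Om w.
Proof.
  intros Hb (_ & _ & _ & Hmax) Hx1 Hx2.
  assert (N : ~ compl_closure Om x).
  { intros Hc. destruct (compl_closure_locally_connected Om x Hb Hc) as (B & e & BC & BO & He & HB).
    destruct (Hx1 e He) as [y [Vy Hy]]. destruct (Hx2 e He) as [y' [Oy' Hy']].
    apply Oy'. intros e' He'. exists y'. split; [|now rewrite dChat_refl].
    apply (Hmax B BC BO); [exists y; auto|auto]. }
  destruct x as [w|]; [|now destruct N]. exists w. split; [easy|]. now apply NNPP.
Qed.

Lemma domain_in_OmegaHat (Om : C -> Prop) (V : Chat -> Prop) (z : C) : mopen dC Om ->
  is_component dChat (compl_closure Om) V -> Om z -> OmegaHat V (Some z).
Proof.
  intros Ho (_ & Hsub & _) Hz Hcl. destruct (Ho z Hz) as [e0 [He0 H0]].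
  destruct (dChat_near_finite z e0 He0) as [e [He H]].
  destruct (Hcl e He) as [y [Vy Hy]]. destruct (H y Hy) as [u [-> Hu]].
  apply (Hsub _ Vy). intros e' He'. exists u. split; [now apply H0|].
  unfold dC. now rewrite Cmod_minus_self.
Qed.

(** * Boundary values and inverse of a Riemann map *)

Section RiemannMap.
Variables (Om : C -> Prop) (V : Chat -> Prop) (phi : C -> Chat).
Hypotheses (HOm : bounded_domain Om) (HV : is_component dChat (compl_closure Om) V)
  (Hphi : riemann_map (OmegaHat V) phi).

(** By injectivity no boundary point of the disc is sent into [OmegaHat V], which is already covered
    by the open disc. So [phi (eit t)] lies in the closure of [V] as well as in that of
    [OmegaHat V]. *)
Lemma riemann_boundary_finite (t : R) : exists w, phi (eit t) = Some w /\ closC Om w.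
Proof.
  destruct HOm as (_ & Ho & _ & Hb).
  destruct Hphi as (P1 & P2 & P3 & P4 & P5 & P6 & P7 & P8).
  assert (Ht : closed_disc (eit t)) by (unfold closed_disc; rewrite Cmod_eit; lra).
  apply (component_boundary Om V); try easy; [|now apply P1].
  apply NNPP. intros N. destruct (P7 (phi (eit t)) N) as [z [Hz E]].
  assert (z = eit t) as ->.
  { apply P3; try easy. unfold open_disc, closed_disc in *. lra. }
  unfold open_disc in Hz. rewrite Cmod_eit in Hz. lra.
Qed.

Lemma riemann_boundary_in (t : R) : closC Om (fin (phi (eit t))).
Proof. destruct (riemann_boundary_finite t) as [w [-> Hw]]. exact Hw. Qed.

Lemma riemann_boundary_rcont (t : R) : rcont (fun s => fin (phi (eit s))) t.
Proof.
  destruct Hphi as (P1 & P2 & P3 & P4 & P5 & P6 & P7 & P8).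
  assert (Ht : forall t, closed_disc (eit t)) by (intros; unfold closed_disc; rewrite Cmod_eit; lra).
  intros e He. destruct (riemann_boundary_finite t) as [w [Ew _]].
  destruct (dChat_near_finite w e He) as [e' [He' H]].
  destruct (P4 (eit t) e' (Ht t) He') as [d [Hd H']].
  destruct (eit_rcont t d Hd) as [d' [Hd' H'']].
  exists d'. split; [easy|]. intros s Hs.
  specialize (H' (eit s) (Ht s) (H'' s Hs)). rewrite Ew, dChat_sym in H'.
  destruct (H _ H') as [z [-> Hz]]. rewrite Ew. simpl. unfold dC in Hz.
  now rewrite Cmod_minus_sym.
Qed.

Lemma closC_in_closChat (z : C) : closC Om z -> closChat (OmegaHat V) (Some z).
Proof.
  intros Hz e He. destruct (Hz (e / 2)) as [u [Hu Hd]]; [lra|]. exists (Some u). split.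
  - destruct HOm as (_ & Ho & _). exact (domain_in_OmegaHat Om V u Ho HV Hu).
  - eapply Rle_lt_trans; [apply dChat_le_dC|]. lra.
Qed.

(** Meaningful when [w] has a preimage in the closed disc, in particular on the closure of [Om], and
    arbitrary otherwise. *)
Definition riemann_inv (w : C) : C :=
  epsilon (inhabits (RtoC 0)) (fun z => closed_disc z /\ phi z = Some w).

Lemma riemann_inv_spec (w : C) : closC Om w ->
  closed_disc (riemann_inv w) /\ phi (riemann_inv w) = Some w.
Proof.
  intros Hw. unfold riemann_inv. apply epsilon_spec.
  destruct Hphi as (P1 & P2 & _). apply P2. now apply closC_in_closChat.
Qed.

Lemma riemann_inv_eit (t : R) : riemann_inv (fin (phi (eit t))) = eit t.
Proof.
  destruct Hphi as (P1 & P2 & P3 & _).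
  destruct (riemann_boundary_finite t) as [w [Ew Hw]]. rewrite Ew. simpl.
  destruct (riemann_inv_spec w Hw) as [A B]. apply P3; [easy| |now rewrite Ew].
  unfold closed_disc; rewrite Cmod_eit; lra.
Qed.

Lemma riemann_inv_continuous (z : C) (e : R) : closC Om z -> 0 < e -> exists d, 0 < d /\
  forall z', closC Om z' -> dC z' z < d -> dC (riemann_inv z') (riemann_inv z) < e.
Proof.
  intros Hz He. destruct Hphi as (P1 & P2 & P3 & P4 & P5 & _).
  destruct (riemann_inv_spec z Hz) as [A B].
  destruct (P5 _ e A He) as [d [Hd H]]. exists (d / 2). split; [lra|]. intros z' Hz' Hd'.
  destruct (riemann_inv_spec z' Hz') as [A' B'].
  apply H; [easy|]. rewrite B, B'. eapply Rle_lt_trans; [apply dChat_le_dC|]. lra.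
Qed.

Lemma mem_closC (z : C) : Om z -> closC Om z.
Proof. intros Hz e He. exists z. split; [easy|]. unfold dC. now rewrite Cmod_minus_self. Qed.

Lemma riemann_inv_cdiff (w0 : C) : Om w0 -> exists l, cdiff riemann_inv w0 l.
Proof.
  intros Hw0. destruct HOm as (_ & Ho & _).
  assert (Hphi' := Hphi). destruct Hphi' as (P1 & P2 & P3 & P4 & P5 & P6 & P7 & P8).
  destruct (riemann_inv_spec w0 (mem_closC w0 Hw0)) as [A B].
  assert (A' : open_disc (riemann_inv w0)).
  { destruct (P7 (Some w0)) as [z [Hz Ez]]; [exact (domain_in_OmegaHat Om V w0 Ho HV Hw0)|].
    replace (riemann_inv w0) with z; [easy|]. apply P3; [|easy|congruence].
    unfold open_disc, closed_disc in *; lra. }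
  destruct (Ho w0 Hw0) as [d [Hd HdO]].
  (* The radius 1 is arbitrary: this only makes [phi] finite near [riemann_inv w0], where
     [holo_Chat_at] then refers to the ordinary chart. *)
  destruct (dChat_near_finite w0 1 Rlt_0_1) as [e' [He' H]].
  destruct (P4 _ e' A He') as [d' [Hd' H']].
  unfold open_disc in A'. set (m := 1 - Cmod (riemann_inv w0)).
  apply (cdiff_inverse (fun u => fin (phi u)) riemann_inv w0 (Rmin d' m) d).
  - apply Rmin_glb_lt; unfold m; lra.
  - easy.
  - intros z Hz. assert (q1 := Rmin_l d' m). assert (q2 := Rmin_r d' m).
    assert (Oz : open_disc z).
    { unfold open_disc. generalize (Cmod_le_add_minus z (riemann_inv w0)). unfold m in *. lra. }
    assert (D : dChat (phi z) (phi (riemann_inv w0)) < e').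
    { apply H'; [unfold open_disc, closed_disc in *; lra|]. unfold dC. lra. }
    rewrite B, dChat_sym in D. destruct (H _ D) as [v [Ev _]].
    specialize (P8 z Oz). unfold holo_Chat_at in P8. rewrite Ev in P8.
    now apply ex_derive_cdiff in P8.
  - intros w Hw e He. assert (Ow : Om w) by (apply HdO; now rewrite dC_sym).
    destruct (riemann_inv_continuous w e (mem_closC w Ow) He) as [d1 [Hd1 H1]].
    destruct (Ho w Ow) as [d2 [Hd2 H2]].
    exists (Rmin d1 d2). split; [now apply Rmin_glb_lt|]. intros u Hu.
    assert (q1 := Rmin_l d1 d2). assert (q2 := Rmin_r d1 d2).
    apply H1; [|unfold dC; lra]. apply mem_closC, H2. rewrite dC_sym. unfold dC. lra.
  - intros w Hw. destruct (riemann_inv_spec w) as [_ E]; [|now rewrite E].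
    apply mem_closC, HdO. now rewrite dC_sym.
Qed.

End RiemannMap.

(** * Steep functions on the torus *)

Lemma finite_min {J : Type} (l : list J) (P : J -> R -> Prop) :
  (forall j d d', 0 < d' <= d -> P j d -> P j d') ->
  (forall j, exists d, 0 < d /\ P j d) ->
  exists d, 0 < d /\ forall j, In j l -> P j d.
Proof.
  intros Hm H. induction l as [|j l [d [Hd IH]]].
  - exists 1. split; [lra|easy].
  - destruct (H j) as [d' [Hd' Hj]]. exists (Rmin d d').
    assert (q := Rmin_glb_lt _ _ _ Hd Hd').
    split; [easy|]. intros i [<-|Hi].
    + apply (Hm j d'); [split; [easy|apply Rmin_r]|easy].
    + apply (Hm i d); [split; [easy|apply Rmin_l]|auto].
Qed.

Lemma finite_supnorm {J : Type} (l : list J) (Hl : forall j, In j l) (j0 : J) (v : J -> R) :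
  exists M, is_supnorm v M.
Proof.
  assert (A : forall l' : list J, exists j, forall i, In i l' -> Rabs (v i) <= Rabs (v j)).
  { induction l' as [|i l' [j IH]]; [now exists j0|].
    destruct (Rle_dec (Rabs (v i)) (Rabs (v j))) as [h|h].
    - exists j. intros i' [<-|Hi]; auto.
    - exists i. intros i' [<-|Hi]; [lra|]. specialize (IH i' Hi). lra. }
  destruct (A l) as [j Hj]. exists (Rabs (v j)). split; [now exists j|]. auto.
Qed.

Lemma eit_period_Z (n : Z) (t : R) : eit (t + 2 * PI * IZR n) = eit t.
Proof.
  induction n as [|n IH|n IH] using Z.peano_ind.
  - now rewrite Rmult_0_r, Rplus_0_r.
  - rewrite succ_IZR, Rmult_plus_distr_l, Rmult_1_r, <- Rplus_assoc, eit_2PI. exact IH.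
  - rewrite <- IH. unfold Z.pred. rewrite plus_IZR.
    rewrite <- (eit_2PI (t + 2 * PI * (IZR n + -1))). f_equal. ring.
Qed.

Lemma eit_reduce (x : R) : exists c, 0 <= x + c <= 2 * PI /\ forall y, eit (y + c) = eit y.
Proof.
  assert (P := two_PI_pos). destruct (archimed (x / (2 * PI))) as [A B].
  exists (2 * PI * IZR (1 - up (x / (2 * PI)))). split; [|intros; apply eit_period_Z].
  rewrite minus_IZR. set (u := IZR (up (x / (2 * PI)))) in *.
  assert (E : x = 2 * PI * (x / (2 * PI))) by (field; lra).
  set (y := x / (2 * PI)) in *. rewrite E. nra.
Qed.

Lemma eit_pow (t : R) (n : nat) : (eit t ^ n)%C = eit (INR n * t).
Proof.
  induction n as [|n IH]; [simpl; now rewrite Rmult_0_l, eit_0|].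
  rewrite Cpow_S, IH, <- eit_plus, S_INR. f_equal. ring.
Qed.

(** A half turn changes the cosine by [2 * |cos a|]. If that is below 1/3, the sine is near 1 or -1
    and a quarter turn gives a larger change. *)
Lemma cos_jump (a : R) : exists x, 0 < x <= PI /\ / 3 <= Rabs (cos (a + x) - cos a).
Proof.
  assert (P := PI_RGT_0).
  destruct (Rle_dec (/ 6) (Rabs (cos a))) as [h|h].
  - exists PI. split; [lra|]. rewrite neg_cos.
    replace (- cos a - cos a) with (- (2 * cos a)) by ring.
    rewrite Rabs_Ropp, Rabs_mult, (Rabs_pos_eq 2); lra.
  - exists (PI / 2). split; [lra|]. rewrite cos_plus, cos_PI2, sin_PI2.
    replace (cos a * 0 - sin a * 1 - cos a) with (- (sin a + cos a)) by ring. rewrite Rabs_Ropp.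
    assert (S := sin2_cos2 a). unfold Rsqr in S.
    unfold Rabs in *. repeat destruct Rcase_abs; nra.
Qed.

Section Torus.
Context {I : Type}.
Variables (l : list I) (Hl : forall i, In i l) (i0 : I).

(** Periodicity in all coordinates at once, which [re_comp] has by construction; [torus_continuous]
    states it one coordinate at a time. *)
Definition angular (u : (I -> R) -> R) : Prop :=
  forall th th', (forall j, eit (th j) = eit (th' j)) -> u th = u th'.

(** The sup norm is replaced by a quantifier over coordinates, and [gap] is the margin of the strict
    inequality; the condition in [in_D] is the case [gap = 0]. *)
Definition steep (n : nat) (u : (I -> R) -> R) (gap : R) (th v : I -> R) : Prop :=
  exists t, Rabs t < / INR n /\ forall j, INR n * Rabs (t * v j) + gap < 
    Rabs (u th - u (fun i => th i + t * v i)).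

Definition direction (k : I) (s : nat) (v : I -> R) : Prop :=
  / INR s <= Rabs (v k) <= INR s /\ forall j, Rabs (v j) <= INR s.

Lemma in_D_steep n k s (u : (I -> R) -> R) :
  in_D n k s u <-> torus_continuous u /\ forall th v, direction k s v -> steep n u 0 th v.
Proof.
  split; intros [Hc H]; (split; [exact Hc|]).
  - intros th v [H1 H2]. destruct (H th v H1 H2) as [t [Ht [M [[_ HM] Hu]]]].
    exists t. split; [apply Rabs_def1; lra|]. intros j. rewrite Rplus_0_r.
    specialize (HM j). cbv beta in HM. replace (th j + t * v j - th j) with (t * v j) in HM by ring.
    eapply Rle_lt_trans; [|apply Hu]. apply Rmult_le_compat_l; [apply pos_INR|easy].
  - intros th v H1 H2. destruct (H th v (conj H1 H2)) as [t [Ht Hu]].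
    exists t. apply Rabs_def2 in Ht. split; [lra|]. cbv zeta.
    destruct (finite_supnorm l Hl i0 (fun j => th j + t * v j - th j)) as [M HM].
    exists M. split; [easy|]. destruct HM as [[j ->] _].
    replace (th j + t * v j - th j) with (t * v j) by ring. specialize (Hu j). lra.
Qed.

(** A larger [s] admits more directions, a larger [n] shortens the segment and raises the slope;
    this reduces the family to its diagonal. *)
Lemma in_D_mono n n' k s s' (u : (I -> R) -> R) :
  (1 <= n)%nat -> (n <= n')%nat -> (1 <= s)%nat -> (s <= s')%nat ->
  in_D n' k s' u -> in_D n k s u.
Proof.
  intros Hn Hnn Hs Hss. rewrite !in_D_steep. intros [Hc H]. split; [easy|].
  apply le_INR in Hn, Hnn, Hs, Hss. simpl in Hn, Hs.
  intros th v [[H1 H2] H3]. destruct (H th v) as [t [Ht Hu]].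
  - split; [split; [|lra]|].
    + eapply Rle_trans; [|exact H1]. apply Rinv_le_contravar; lra.
    + intros j. specialize (H3 j). lra.
  - exists t. split.
    + eapply Rlt_le_trans; [exact Ht|]. apply Rinv_le_contravar; lra.
    + intros j. eapply Rle_lt_trans; [|apply (Hu j)]. apply Rplus_le_compat_r.
      apply Rmult_le_compat_r; [apply Rabs_pos|lra].
Qed.

Lemma angular_reduce (th : I -> R) : exists c : I -> R,
  (forall j, 0 <= th j + c j <= 2 * PI) /\ forall y j, eit (y + c j) = eit y.
Proof.
  exists (fun j => epsilon (inhabits 0) (fun c => 0 <= th j + c <= 2 * PI /\ forall y, eit (y + c) = eit y)).
  split; [intros j|intros y j];
  apply (epsilon_spec (inhabits 0) _ (eit_reduce (th j))).
Qed.

Lemma angular_uniform (u : (I -> R) -> R) : angular u -> torus_continuous u ->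
  forall e, 0 < e -> exists d, 0 < d /\
    forall th th', (forall j, Rabs (th' j - th j) < d) -> Rabs (u th' - u th) < e.
Proof.
  intros Ha [_ Hc] e He.
  destruct (box_uniform l Hl (fun _ => 0) (fun _ => 2 * PI)
    (fun th d => forall th', (forall j, Rabs (th' j - th j) < d) -> Rabs (u th' - u th) < e))
    as [d [Hd H]].
  - intros th d d' Hd H th' Hth'. apply H. intros j. specialize (Hth' j). lra.
  - intros th _. destruct (Hc th (e / 2)) as [d [Hd H]]; [lra|]. exists (d / 2). split; [lra|].
    intros y Hy y' Hy'.
    assert (A := H y ltac:(intros j; specialize (Hy j); lra)).
    assert (B : Rabs (u y' - u th) < e / 2).
    { apply H. intros j. specialize (Hy j). specialize (Hy' j).
      replace (y' j - th j) with ((y' j - y j) + (y j - th j)) by ring.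
      eapply Rle_lt_trans; [apply Rabs_triang|]. lra. }
    replace (u y' - u y) with ((u y' - u th) + - (u y - u th)) by ring.
    eapply Rle_lt_trans; [apply Rabs_triang|]. rewrite Rabs_Ropp. lra.
  - exists d. split; [easy|]. intros th th' Hth.
    (* Both points are translated by the same periods, so their difference is unchanged; only [th]
       has to land in the box. *)
    destruct (angular_reduce th) as [c [Hc1 Hc2]].
    rewrite (Ha th (fun j => th j + c j)) by (intros; now rewrite Hc2).
    rewrite (Ha th' (fun j => th' j + c j)) by (intros; now rewrite Hc2).
    apply (H _ Hc1). intros j. replace (th' j + c j - (th j + c j)) with (th' j - th j) by ring.
    apply Hth.
Qed.

(** Compactness for the pair (theta, v), viewed as one point of a box indexed by [I + I], with theta
    reduced to one period. *)
Lemma steep_uniform n k s (u : (I -> R) -> R) : (1 <= n)%nat -> (1 <= s)%nat ->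
  angular u -> torus_continuous u ->
  (forall th v, direction k s v -> steep n u 0 th v) ->
  exists gap, 0 < gap /\ forall th v, direction k s v -> steep n u gap th v.
Proof.
  intros Hn Hs Ha [_ Hc] H.
  apply le_INR in Hn, Hs. simpl in Hn, Hs.
  set (l2 := map (@inl I I) l ++ map (@inr I I) l).
  assert (Hl2 : forall x, In x l2).
  { intros [x|x]; apply in_or_app; [left|right]; now apply in_map. }
  set (lo := fun x : I + I => match x with inl _ => 0 | inr _ => - INR s end).
  set (hi := fun x : I + I => match x with inl _ => 2 * PI | inr _ => INR s end).
  destruct (box_uniform l2 Hl2 lo hi (fun x d => direction k s (fun i => x (inr i)) ->
    steep n u d (fun i => x (inl i)) (fun i => x (inr i)))) as [gap [Hgap HH]].
  - intros x d d' Hd Hx Hdir. destruct (Hx Hdir) as [t [Ht Hu]]. exists t. split; [easy|].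
    intros j. specialize (Hu j). lra.
  - intros x Hx. set (th := fun i => x (inl i)). set (v := fun i => x (inr i)).
    destruct (classic (direction k s v)) as [Hdir|Hdir].
    + destruct (H th v Hdir) as [t [Ht Hu]].
      set (D := Rabs (u th - u (fun i => th i + t * v i))) in *.
      destruct (finite_min l (fun j g => INR n * Rabs (t * v j) + g < D)) as [g [Hg Hgj]].
      { intros; lra. }
      { intros j. specialize (Hu j). exists ((D - INR n * Rabs (t * v j)) / 2). split; lra. }
      (* The same [t] is kept at nearby pairs. Of the margin [g], the two values of [u] use [g / 8]
         each, the change of [n * |t * v j|] at most [d <= g / 4], and the new gap is [d] again. The
         endpoint moves by less than [2 * d], hence [d2 / 2]. *)
      destruct (Hc th (g / 8)) as [d1 [Hd1 H1]]; [lra|].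
      destruct (Hc (fun i => th i + t * v i) (g / 8)) as [d2 [Hd2 H2]]; [lra|].
      set (d := Rmin d1 (Rmin (d2 / 2) (g / 4))).
      assert (dd1 : d <= d1) by apply Rmin_l.
      assert (dd2 : d <= d2 / 2) by (eapply Rle_trans; [apply Rmin_r|apply Rmin_l]).
      assert (dd3 : d <= g / 4) by (eapply Rle_trans; [apply Rmin_r|apply Rmin_r]).
      assert (Hd : 0 < d) by (repeat apply Rmin_glb_lt; lra).
      assert (Hnt : INR n * Rabs t <= 1).
      { apply Rlt_le in Ht. apply (Rmult_le_compat_l (INR n)) in Ht; [|lra].
        rewrite Rinv_r in Ht; lra. }
      assert (Ht1 : Rabs t <= 1) by (generalize (Rabs_pos t); nra).
      exists d. split; [easy|]. intros y Hy _. exists t. split; [easy|]. intros j.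
      specialize (H1 (fun i => y (inl i)) ltac:(intros i; specialize (Hy (inl i)); unfold th; lra)).
      assert (B : Rabs (u (fun i => y (inl i) + t * y (inr i)) - u (fun i => th i + t * v i)) < g / 8).
      { apply H2. intros i.
        replace (y (inl i) + t * y (inr i) - (th i + t * v i)) with
          ((y (inl i) - x (inl i)) + t * (y (inr i) - x (inr i))) by (unfold th, v; ring).
        eapply Rle_lt_trans; [apply Rabs_triang|]. rewrite Rabs_mult.
        assert (E1 := Hy (inl i)). assert (E2 := Hy (inr i)).
        assert (Rabs t * Rabs (y (inr i) - x (inr i)) <= 1 * Rabs (y (inr i) - x (inr i))).
        { apply Rmult_le_compat_r; [apply Rabs_pos|easy]. }
        lra. }
      assert (E : INR n * Rabs (t * y (inr j)) <= INR n * Rabs (t * v j) + d).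
      { replace (t * y (inr j)) with (t * v j + t * (y (inr j) - x (inr j))) by (unfold v; ring).
        assert (T := Rabs_triang (t * v j) (t * (y (inr j) - x (inr j)))).
        rewrite (Rabs_mult t (y (inr j) - x (inr j))) in T.
        assert (E2 := Hy (inr j)).
        apply (Rmult_le_compat_l (INR n)) in T; [|lra].
        assert (INR n * Rabs t * Rabs (y (inr j) - x (inr j)) <= 1 * d).
        { apply Rmult_le_compat; [|apply Rabs_pos|easy|lra].
          apply Rmult_le_pos; [lra|apply Rabs_pos]. }
        lra. }
      specialize (Hgj j (Hl j)).
      set (a := u (fun i => y (inl i))) in *. set (b := u (fun i => y (inl i) + t * y (inr i))) in *.
      assert (F : D <= Rabs (a - b) + g / 8 + g / 8).
      { unfold D. replace (u th - u (fun i => th i + t * v i)) with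
          ((a - b) + (- (a - u th) + (b - u (fun i => th i + t * v i)))) by ring.
        eapply Rle_trans; [apply Rabs_triang|].
        assert (T := Rabs_triang (- (a - u th)) (b - u (fun i => th i + t * v i))).
        rewrite Rabs_Ropp in T. lra. }
      lra.
    (* Inside the box only [|v k| >= 1/s] can fail, and this failure is an open condition, so the
       claim is vacuous nearby. *)
    + assert (B : forall j, Rabs (v j) <= INR s).
      { intros j. specialize (Hx (inr j)). simpl in Hx. apply Rabs_le. exact Hx. }
      assert (N : Rabs (v k) < / INR s).
      { apply Rnot_le_lt. intros h. apply Hdir. split; [split; [easy|apply B]|exact B]. }
      exists (/ INR s - Rabs (v k)). split; [lra|]. intros y Hy [[Hy' _] _]. exfalso.
      specialize (Hy (inr k)). unfold v in *.
      assert (T := Rabs_triang (x (inr k)) (y (inr k) - x (inr k))).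
      replace (x (inr k) + (y (inr k) - x (inr k))) with (y (inr k)) in T by ring. lra.
  - exists gap. split; [easy|]. intros th v Hdir.
    destruct (angular_reduce th) as [c [Hc1 Hc2]].
    destruct (HH (fun x => match x with inl i => th i + c i | inr i => v i end)) as [t [Ht Hu]].
    + intros [j|j]; simpl; [apply Hc1|]. apply Rabs_le_between, Hdir.
    + exact Hdir.
    + exists t. split; [easy|]. intros j.
      rewrite (Ha th (fun i => th i + c i)) by (intros; now rewrite Hc2).
      rewrite (Ha (fun i => th i + t * v i) (fun i => th i + c i + t * v i)).
      * apply Hu.
      * intros i. replace (th i + c i + t * v i) with (th i + t * v i + c i) by ring.
        now rewrite Hc2.
Qed.

(* A rapid oscillation of fixed amplitude in the direction [k] dominates, at its own scale,
   the variation of any given uniformly continuous function. *)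
Lemma oscillation_steep n k s (u : (I -> R) -> R) (e : R) : (1 <= n)%nat -> (1 <= s)%nat ->
  angular u -> torus_continuous u -> 0 < e ->
  exists N : nat, forall th v, direction k s v ->
    steep n (fun th => u th + e * cos (INR N * th k)) 0 th v.
Proof.
  intros Hn Hs Ha Hc He. assert (P := PI_RGT_0).
  apply le_INR in Hn, Hs. simpl in Hn, Hs.
  destruct (angular_uniform u Ha Hc (e / 12)) as [d [Hd Hu]]; [lra|].
  (* [d] keeps the change of [u] below [e / 12], [e / 4] bounds [n] times the displacement, and 1
     keeps [t] in its interval. The balance is [e / 3 - e / 12 = e / 4]. *)
  set (m := Rmin d (Rmin (e / 4) 1)).
  assert (m1 : m <= d) by apply Rmin_l.
  assert (m2 : m <= e / 4) by (eapply Rle_trans; [apply Rmin_r|apply Rmin_l]).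
  assert (m3 : m <= 1) by (eapply Rle_trans; [apply Rmin_r|apply Rmin_r]).
  assert (Hm : 0 < m) by (repeat apply Rmin_glb_lt; lra).
  (* As [|v k| >= 1/s], the witness will satisfy [|t| <= PI * s / N]; so [n] times the displacement
     is at most [K / N]. *)
  set (K := PI * INR s * INR s * INR n).
  destruct (INR_unbounded (K / m)) as [N HN].
  assert (HK : 0 < K) by (unfold K; apply Rmult_lt_0_compat; [apply Rmult_lt_0_compat; [apply Rmult_lt_0_compat|]|]; lra).
  assert (Hpos : 0 < INR N) by (generalize (Rdiv_lt_0_compat K m HK Hm); lra).
  assert (HNm : K / INR N < m).
  { apply (Rmult_lt_reg_r (INR N)); [easy|]. unfold Rdiv. rewrite Rmult_assoc, Rinv_l by lra.
    apply (Rmult_lt_compat_r m) in HN; [|easy]. unfold Rdiv in HN.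
    rewrite Rmult_assoc, Rinv_l in HN by lra. lra. }
  exists N. intros th v [[Hv1 Hv2] Hv3].
  destruct (cos_jump (INR N * th k)) as [x [Hx Hjump]].
  assert (Hs' : 0 < / INR s) by (apply Rinv_0_lt_compat; lra).
  assert (Nv : v k <> 0) by (intros E; rewrite E, Rabs_R0 in Hv1; lra).
  (* Chosen so that the phase [N * th k] advances by exactly [x], the jump provided by
     [cos_jump]. *)
  exists (x / (INR N * v k)). set (t := x / (INR N * v k)).
  assert (Et : t * (INR N * v k) = x) by (unfold t; field; lra).
  assert (P0 := Rabs_pos t).
  assert (Ht0 : Rabs t * (INR N * / INR s) <= PI).
  { apply Rle_trans with (Rabs t * (INR N * Rabs (v k))).
    - apply Rmult_le_compat_l; [easy|]. apply Rmult_le_compat_l; lra.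
    - rewrite <- (Rabs_pos_eq (INR N)), <- !Rabs_mult, Et, Rabs_pos_eq by lra. lra. }
  assert (Ht : Rabs t * INR s * INR n < m).
  { eapply Rle_lt_trans; [|exact HNm].
    replace (Rabs t * INR s * INR n) with (Rabs t * (INR N * / INR s) * (INR s * INR s * INR n / INR N))
      by (field; lra).
    replace (K / INR N) with (PI * (INR s * INR s * INR n / INR N)) by (unfold K; field; lra).
    apply Rmult_le_compat_r; [|easy]. left. apply Rdiv_lt_0_compat; [|easy].
    repeat apply Rmult_lt_0_compat; lra. }
  assert (Hts : 0 <= Rabs t * INR s) by (apply Rmult_le_pos; lra).
  assert (Htv : forall j, Rabs (t * v j) <= Rabs t * INR s).
  { intros j. rewrite Rabs_mult. now apply Rmult_le_compat_l. }
  split.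
  - apply (Rmult_lt_reg_r (INR n)); [lra|]. rewrite Rinv_l by lra. nra.
  - intros j. rewrite Rplus_0_r.
    assert (A : Rabs (u (fun i => th i + t * v i) - u th) < e / 12).
    { apply Hu. intros i. replace (th i + t * v i - th i) with (t * v i) by ring.
      specialize (Htv i). nra. }
    replace (INR N * (th k + t * v k)) with (INR N * th k + x) by (rewrite <- Et; ring).
    set (b := u (fun i => th i + t * v i)) in *. set (a := u th) in *.
    set (q := cos (INR N * th k + x)) in *. set (p := cos (INR N * th k)) in *.
    assert (B : INR n * Rabs (t * v j) < e / 4).
    { specialize (Htv j). nra. }
    assert (D : e * / 3 <= e * Rabs (q - p)) by (apply Rmult_le_compat_l; lra).
    assert (F : e * Rabs (q - p) <= Rabs (a + e * p - (b + e * q)) + Rabs (b - a)).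
    { rewrite <- (Rabs_pos_eq e) at 1 by lra. rewrite <- Rabs_mult.
      rewrite (Rabs_minus_sym (a + e * p)).
      replace (e * (q - p)) with ((b + e * q - (a + e * p)) + - (b - a)) by ring.
      eapply Rle_trans; [apply Rabs_triang|]. rewrite Rabs_Ropp. lra. }
    lra.
Qed.

End Torus.

(** * Baire category in A(Omega) *)

Lemma upd_same {I T : Type} (z : I -> T) i w : upd z i w i = w.
Proof. unfold upd. now destruct (excluded_middle_informative (i = i)). Qed.

Lemma upd_other {I T : Type} (z : I -> T) i j w : j <> i -> upd z i w j = z j.
Proof. intros H. unfold upd. now destruct (excluded_middle_informative (j = i)). Qed.

Lemma finite_choices {I : Type} (l : list I) (Hl : forall i, In i l) (k : I -> nat) :
  exists L : list (I -> nat), forall r, (forall i, (r i < k i)%nat) -> In r L.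
Proof.
  assert (A : forall l' : list I, exists L : list (I -> nat), forall r, (forall i, (r i < k i)%nat) ->
            exists r', In r' L /\ forall i, In i l' -> r' i = r i).
  { induction l' as [|j l' [L IH]].
    - exists ((fun _ => O) :: nil). intros r _. exists (fun _ => O). simpl. split; [auto|easy].
    - exists (flat_map (fun r' => map (fun m => upd r' j m) (seq 0 (k j))) L).
      intros r Hr. destruct (IH r Hr) as [r' [H1 H2]]. exists (upd r' j (r j)). split.
      + apply in_flat_map. exists r'. split; [easy|]. apply in_map_iff. exists (r j).
        split; [easy|]. apply in_seq. specialize (Hr j). lia.
      + intros i Hi. destruct (classic (i = j)) as [->|N]; [apply upd_same|].
        rewrite upd_other by easy. apply H2. destruct Hi; congruence. }
  destruct (A l) as [L HL]. exists L. intros r Hr. destruct (HL r Hr) as [r' [H1 H2]].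
  replace r with r'; [easy|]. apply functional_extensionality. intros i. now apply H2.
Qed.

Section FunctionSpace.
Context {I : Type}.
Variable (Om : I -> C -> Prop).
Hypothesis (Hopen : forall i, mopen dC (Om i)).

Lemma in_Omega_in_bar z : in_Omega Om z -> in_Omega_bar Om z.
Proof. intros H i. now apply mem_closC. Qed.

Lemma in_Omega_upd z i w : in_Omega Om z -> Om i w -> in_Omega Om (upd z i w).
Proof.
  intros Hz Hw j. destruct (classic (j = i)) as [->|N]; [now rewrite upd_same|].
  now rewrite upd_other.
Qed.

(** Closedness of A(Omega) under uniform limits: Weierstrass's theorem is applied in each variable,
    on a disc inside [Om i]. *)
Lemma in_A_limit (f : (I -> C) -> C) :
  (forall e, 0 < e -> exists g, in_A Om g /\
     forall z, in_Omega_bar Om z -> Cmod (g z - f z) <= e) -> in_A Om f.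
Proof.
  intros Happ.
  assert (Hc : forall z, in_Omega_bar Om z -> forall e, 0 < e -> exists del, 0 < del /\
     forall w, in_Omega_bar Om w -> (forall i, dC (w i) (z i) < del) -> dC (f w) (f z) < e).
  { intros z Hz e He. destruct (Happ (e / 4)) as [g [[Hg _] Hgf]]; [lra|].
    destruct (Hg z Hz (e / 4)) as [d [Hd H]]; [lra|]. exists d. split; [easy|].
    intros w Hw Hwz. specialize (H w Hw Hwz). unfold dC in *.
    assert (A := Hgf w Hw). assert (B := Hgf z Hz). rewrite Cmod_minus_sym in A.
    assert (T1 := Cmod_minus_triangle (f w) (g w) (f z)).
    assert (T2 := Cmod_minus_triangle (g w) (g z) (f z)). lra. }
  split; [exact Hc|]. intros z Hz i w Hw. apply ex_derive_cdiff.
  destruct (Hopen i w Hw) as [R0 [HR0 HR]].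
  assert (Hball : forall u, Cmod (u - w) < R0 -> Om i u).
  { intros u Hu. apply HR. now rewrite dC_sym. }
  apply (uniform_limit_cdiff _ w R0 HR0).
  - intros u Hu e He.
    destruct (Hc (upd z i u)) with (e := e) as [d [Hd H]];
      [now apply in_Omega_in_bar, in_Omega_upd; auto|easy|].
    destruct (Hopen i u (Hball u Hu)) as [d' [Hd' H']].
    exists (Rmin d d'). split; [now apply Rmin_glb_lt|]. intros u' Hu'.
    assert (q1 := Rmin_l d d'). assert (q2 := Rmin_r d d').
    apply H.
    + apply in_Omega_in_bar, in_Omega_upd; [easy|]. apply H'. rewrite dC_sym. unfold dC. lra.
    + intros j. unfold dC. destruct (classic (j = i)) as [->|N]; [rewrite !upd_same; lra|].
      rewrite !upd_other, Cmod_minus_self by easy. lra.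
  - intros e He. destruct (Happ e He) as [g [[_ Hg] Hgf]]. exists (fun u => g (upd z i u)). split.
    + intros u Hu. apply ex_derive_cdiff. apply Hg; auto.
    + intros u Hu. apply Hgf. apply in_Omega_in_bar, in_Omega_upd; auto.
Qed.

Definition open_dense (U : ((I -> C) -> C) -> Prop) : Prop :=
  rel_open Om U /\ forall f, in_A Om f -> forall e, 0 < e ->
    exists g, in_A Om g /\ U g /\ sup_ball Om f g e.

Lemma sup_ball_refl f e : 0 < e -> sup_ball Om f f e.
Proof. intros He. exists 0. split; [easy|]. intros. unfold dC. rewrite Cmod_minus_self. lra. Qed.

Lemma sup_ball_trans f g h a b e : a + b <= e ->
  sup_ball Om f g a -> sup_ball Om g h b -> sup_ball Om f h e.
Proof.
  intros Hab [d [Hd H]] [d' [Hd' H']]. exists (d + d'). split; [lra|]. intros z Hz.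
  specialize (H z Hz). specialize (H' z Hz). unfold dC in *.
  generalize (Cmod_minus_triangle (f z) (g z) (h z)). lra.
Qed.

Lemma open_dense_and U W : open_dense U -> open_dense W -> open_dense (fun f => U f /\ W f).
Proof.
  intros [oU dU] [oW dW]. split.
  - intros f Hf [Uf Wf]. destruct (oU f Hf Uf) as [a [Ha HU]]. destruct (oW f Hf Wf) as [b [Hb HW]].
    exists (Rmin a b). split; [now apply Rmin_glb_lt|]. intros g Hg [d [Hd H]].
    assert (q1 := Rmin_l a b). assert (q2 := Rmin_r a b).
    split; [apply HU|apply HW]; try easy; exists d; (split; [lra|easy]).
  - intros f Hf e He. destruct (dU f Hf (e / 2)) as [g [Hg [Ug Bg]]]; [lra|].
    destruct (oU g Hg Ug) as [a [Ha HU]].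
    destruct (dW g Hg (Rmin a (e / 2))) as [h [Hh [Wh Bh]]]; [apply Rmin_glb_lt; lra|].
    assert (q1 := Rmin_l a (e / 2)). assert (q2 := Rmin_r a (e / 2)).
    exists h. split; [easy|]. split; [split; [|easy]|].
    + apply HU; [easy|]. destruct Bh as [d [Hd H]]. exists d. split; [lra|easy].
    + apply (sup_ball_trans f g h (e / 2) (Rmin a (e / 2))); try easy. lra.
Qed.

Lemma open_dense_list {A : Type} (P : A -> ((I -> C) -> C) -> Prop) (L : list A) :
  (forall a, open_dense (P a)) -> open_dense (fun f => forall a, In a L -> P a f).
Proof.
  intros H. induction L as [|a L IH].
  - split.
    + intros f _ _. exists 1. split; [lra|easy].
    + intros f Hf e He. exists f. split; [easy|]. split; [easy|]. now apply sup_ball_refl.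
  - destruct (open_dense_and _ _ (H a) IH) as [o d]. split.
    + intros f Hf Hall. destruct (o f Hf) as [e [He Ho]].
      * split; [apply Hall; now left|]. intros b Hb. apply Hall. now right.
      * exists e. split; [easy|]. intros g Hg Bg. destruct (Ho g Hg Bg) as [h1 h2].
        intros b [<-|Hb]; auto.
    + intros f Hf e He. destruct (d f Hf e He) as [g [Hg [[h1 h2] Bg]]].
      exists g. split; [easy|]. split; [|easy]. intros b [<-|Hb]; auto.
Qed.

(** Total, because [Lim_seq] is; thus a pointwise limit is defined on all of [I -> C], although
    convergence is controlled on the closure of Omega only. *)
Definition Clim (u : nat -> C) : C :=
  (real (Lim_seq (fun m => fst (u m))), real (Lim_seq (fun m => snd (u m)))).

Lemma real_cauchy_limit (u : nat -> R) (b : nat -> R) :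
  (forall m p, Rabs (u m - u (m + p)%nat) <= b m) ->
  (forall e, 0 < e -> exists m, b m < e) ->
  forall m, Rabs (u m - real (Lim_seq u)) <= b m.
Proof.
  intros Hb Hsmall.
  assert (Hex : ex_finite_lim_seq u).
  { apply ex_lim_seq_cauchy_corr. intros e. destruct (Hsmall (e / 2)) as [N HN].
    - generalize (cond_pos e). lra.
    - exists N. intros n m Hn Hm.
      assert (A := Hb N (n - N)%nat). assert (B := Hb N (m - N)%nat).
      replace (N + (n - N))%nat with n in A by lia. replace (N + (m - N))%nat with m in B by lia.
      replace (u n - u m) with (- (u N - u n) + (u N - u m)) by ring.
      eapply Rle_lt_trans; [apply Rabs_triang|]. rewrite Rabs_Ropp. lra. }
  apply Lim_seq_correct' in Hex.
  intros m. apply le_epsilon. intros e He.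
  apply is_lim_seq_spec in Hex. destruct (Hex (mkposreal e He)) as [N HN]. simpl in HN.
  specialize (HN (m + N)%nat ltac:(lia)). specialize (Hb m N).
  replace (u m - real (Lim_seq u)) with ((u m - u (m + N)%nat) + (u (m + N)%nat - real (Lim_seq u))) by ring.
  eapply Rle_trans; [apply Rabs_triang|]. lra.
Qed.

(** The factor 2 comes from adding the bounds for the real and the imaginary part. *)
Lemma Clim_bound (u : nat -> C) (b : nat -> R) :
  (forall m p, Cmod (u m - u (m + p)%nat) <= b m) ->
  (forall e, 0 < e -> exists m, b m < e) ->
  forall m, Cmod (u m - Clim u) <= 2 * b m.
Proof.
  intros Hb Hsmall m.
  assert (A : forall m p, Rabs (fst (u m) - fst (u (m + p)%nat)) <= b m).
  { intros n p. eapply Rle_trans; [|apply (Hb n p)].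
    eapply Rle_trans; [|apply Rmax_Cmod]. apply Rmax_l. }
  assert (B : forall m p, Rabs (snd (u m) - snd (u (m + p)%nat)) <= b m).
  { intros n p. eapply Rle_trans; [|apply (Hb n p)].
    eapply Rle_trans; [|apply Rmax_Cmod]. apply Rmax_r. }
  assert (A' := real_cauchy_limit (fun m => fst (u m)) b A Hsmall m).
  assert (B' := real_cauchy_limit (fun m => snd (u m)) b B Hsmall m).
  simpl in A', B'. unfold Clim, Cminus, Cplus, Copp. simpl.
  eapply Rle_trans; [apply Cmod_le_abs|]. unfold Rminus in *. lra.
Qed.

(** Balls are chosen with radii divided by at least 4 and centres moving by at most a quarter of the
    radius, the [m]-th choice entering [U m]. The uniform limit of the centres lies in every
    ball. *)
Lemma baire_in_A (U : nat -> ((I -> C) -> C) -> Prop) : (forall m, open_dense (U m)) ->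
  forall f, in_A Om f -> forall e, 0 < e ->
    exists g, in_A Om g /\ (forall m, U m g) /\ sup_ball Om f g e.
Proof.
  intros HU f0 Hf0 e0 He0.
  set (ok := fun fe : ((I -> C) -> C) * R => in_A Om (fst fe) /\ 0 < snd fe).
  set (step := fun m (fe ge : ((I -> C) -> C) * R) => ok ge /\ snd ge <= snd fe / 4 /\
    (forall z, in_Omega_bar Om z -> Cmod (fst fe z - fst ge z) <= snd fe / 4) /\
    forall h, in_A Om h -> sup_ball Om (fst ge) h (snd ge) -> U m h).
  assert (Hstep : forall m fe, ok fe -> exists ge, step m fe ge).
  { intros m [f e] [Hf He]. simpl in Hf, He. destruct (HU m) as [o d].
    destruct (d f Hf (e / 4)) as [g [Hg [Ug [b [Hb Bg]]]]]; [lra|].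
    destruct (o g Hg Ug) as [a [Ha HA]].
    exists (g, Rmin a (e / 4)). assert (q1 := Rmin_l a (e / 4)). assert (q2 := Rmin_r a (e / 4)).
    split; [split; [easy|simpl; apply Rmin_glb_lt; lra]|]. simpl. split; [easy|]. split.
    - intros z Hz. specialize (Bg z Hz). unfold dC in Bg. lra.
    - intros h Hh [b' [Hb' Bh]]. apply HA; [easy|]. exists b'. split; [lra|easy]. }
  set (s := fix s m := match m with O => (f0, e0)
                       | S m => epsilon (inhabits (s m)) (step m (s m)) end).
  assert (Hok : forall m, ok (s m)).
  { induction m as [|m IH]; [split; easy|].
    exact (proj1 (epsilon_spec (inhabits (s m)) _ (Hstep m (s m) IH))). }
  assert (Hs : forall m, step m (s m) (s (S m))).
  { intros m. exact (epsilon_spec (inhabits (s m)) _ (Hstep m (s m) (Hok m))). }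
  set (F := fun m => fst (s m)). set (ee := fun m => snd (s m)).
  assert (Hpos : forall m, 0 < ee m) by (intros m; apply Hok).
  assert (Hdec : forall m, ee (S m) <= ee m / 4) by (intros m; apply (Hs m)).
  assert (Hnear : forall m z, in_Omega_bar Om z -> Cmod (F m z - F (S m) z) <= ee m / 4).
  { intros m. apply (Hs m). }
  (* One third is the sum of the series 1/4 + 1/16 + ...; doubled by [Clim_bound] it is 2/3, so the
     limit stays strictly inside each ball. *)
  assert (Hcau : forall z, in_Omega_bar Om z -> forall p m, Cmod (F m z - F (m + p)%nat z) <= ee m / 3).
  { intros z Hz. induction p as [|p IH]; intros m.
    - rewrite Nat.add_0_r, Cmod_minus_self. specialize (Hpos m). lra.
    - rewrite Nat.add_succ_r, <- Nat.add_succ_l. specialize (IH (S m)).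
      specialize (Hnear m z Hz). specialize (Hdec m).
      eapply Rle_trans; [apply (Cmod_minus_triangle _ (F (S m) z))|]. lra. }
  assert (Hsmall : forall e, 0 < e -> exists m, ee m < e).
  { intros e He. destruct (half_pow_small e0 e He) as [m Hm]. exists m.
    assert (A : forall m, ee m <= e0 * (/ 2) ^ m).
    { induction m0 as [|m0 IH]; [unfold ee; simpl; lra|]. specialize (Hdec m0). simpl.
      specialize (Hpos m0). lra. }
    specialize (A m). lra. }
  set (g := fun z => Clim (fun m => F m z)).
  assert (Hg : forall m z, in_Omega_bar Om z -> Cmod (F m z - g z) <= 2 * (ee m / 3)).
  { intros m z Hz. apply (Clim_bound (fun m => F m z) (fun m => ee m / 3)).
    - intros n p. now apply Hcau.
    - intros e He. destruct (Hsmall e He) as [n Hn]. exists n. specialize (Hpos n). lra. }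
  assert (Ag : in_A Om g).
  { apply in_A_limit. intros e He. destruct (Hsmall e He) as [m Hm]. exists (F m).
    split; [apply Hok|]. intros z Hz. specialize (Hg m z Hz). specialize (Hpos m). lra. }
  assert (Hball : forall m, sup_ball Om (F m) g (ee m)).
  { intros m. exists (2 * (ee m / 3)). split; [specialize (Hpos m); lra|]. intros z Hz. now apply Hg. }
  exists g. split; [easy|]. split; [|exact (Hball O)].
  intros m. apply (Hs m); [easy|]. exact (Hball (S m)).
Qed.

End FunctionSpace.

(** * Openness and density of the conditions on boundary values *)

Section Setting.
Context {I : Type}.
Variables (l : list I) (Hl : forall i, In i l) (i0 : I).
Variables (Om : I -> C -> Prop) (k : I -> nat) (V : I -> nat -> Chat -> Prop)
  (phi : I -> nat -> C -> Chat).
Hypothesis (H : setting Om k V phi).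

Let Hdom : forall i, bounded_domain (Om i) := proj1 H.
Let Hcomp : forall i j, (j < k i)%nat -> is_component dChat (compl_closure (Om i)) (V i j) :=
  proj1 (proj2 (proj2 H)).
Let Hriem : forall i j, (j < k i)%nat -> riemann_map (OmegaHat (V i j)) (phi i j) :=
  proj2 (proj2 (proj2 (proj2 (proj2 H)))).

Let bpt (r : I -> nat) (th : I -> R) : I -> C := fun j => fin (phi j (r j) (eit (th j))).

Lemma boundary_point_in r th : (forall i, (r i < k i)%nat) -> in_Omega_bar Om (bpt r th).
Proof.
  intros Hr i. exact (riemann_boundary_in _ _ _ (Hdom i) (Hcomp i _ (Hr i)) (Hriem i _ (Hr i)) (th i)).
Qed.

Lemma re_comp_angular r f : angular (re_comp phi r f).
Proof.
  intros th th' E. unfold re_comp. f_equal. f_equal. apply functional_extensionality. intros j.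
  now rewrite E.
Qed.

Lemma re_comp_torus_continuous r f : (forall i, (r i < k i)%nat) -> in_A Om f ->
  torus_continuous (re_comp phi r f).
Proof.
  intros Hr [Hc _]. split.
  - intros th j. apply re_comp_angular. intros i. destruct (classic (i = j)) as [->|N].
    + now rewrite upd_same, eit_2PI.
    + now rewrite upd_other.
  - intros th e He. destruct (Hc (bpt r th) (boundary_point_in r th Hr) e He) as [d [Hd Hf]].
    destruct (finite_min l (fun j a => forall s, Rabs (s - th j) < a ->
      dC (fin (phi j (r j) (eit s))) (bpt r th j) < d)) as [a [Ha Haj]].
    + intros j a a' Haa Hj s Hs. apply Hj. lra.
    + intros j. exact (riemann_boundary_rcont _ _ _ (Hdom j) (Hcomp j _ (Hr j)) (Hriem j _ (Hr j)) (th j) d Hd).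
    + exists a. split; [easy|]. intros th' Hth'.
      specialize (Hf (bpt r th') (boundary_point_in r th' Hr)).
      assert (D : dC (f (bpt r th')) (f (bpt r th)) < e).
      { apply Hf. intros j. apply (Haj j (Hl j)). apply Hth'. }
      eapply Rle_lt_trans; [|exact D]. unfold re_comp, dC.
      eapply Rle_trans; [|apply re_le_Cmod]. right. f_equal.
Qed.

(** A perturbation of sup norm below [gap / 2] changes a difference of two values by less than
    [gap]. *)
Lemma in_D_re_comp_open r n kk s : (forall i, (r i < k i)%nat) -> (1 <= n)%nat -> (1 <= s)%nat ->
  rel_open Om (fun f => in_D n kk s (re_comp phi r f)).
Proof.
  intros Hr Hn Hs f Hf HD. rewrite (in_D_steep l Hl i0) in HD. destruct HD as [Hc HD].
  destruct (steep_uniform l Hl n kk s _ Hn Hs (re_comp_angular r f) Hc HD) as [gap [Hgap HG]].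
  exists (gap / 2). split; [lra|]. intros g Hg [d [Hd Hfg]].
  rewrite (in_D_steep l Hl i0). split; [now apply re_comp_torus_continuous|].
  intros th v Hv. destruct (HG th v Hv) as [t [Ht Hu]]. exists t. split; [easy|]. intros j.
  specialize (Hu j).
  assert (E : forall th, Rabs (re_comp phi r f th - re_comp phi r g th) <= d).
  { intros y. eapply Rle_trans; [|exact (Hfg (bpt r y) (boundary_point_in r y Hr))].
    unfold re_comp, dC. eapply Rle_trans; [|apply re_le_Cmod]. right. f_equal. }
  assert (E1 := E th). assert (E2 := E (fun i => th i + t * v i)).
  set (a := re_comp phi r f th) in *. set (b := re_comp phi r f (fun i => th i + t * v i)) in *.
  set (a' := re_comp phi r g th) in *. set (b' := re_comp phi r g (fun i => th i + t * v i)) in *.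
  assert (T : Rabs (a - b) <= Rabs (a' - b') + (Rabs (a - a') + Rabs (b - b'))).
  { replace (a - b) with ((a' - b') + ((a - a') + - (b - b'))) by ring.
    eapply Rle_trans; [apply Rabs_triang|]. apply Rplus_le_compat_l.
    eapply Rle_trans; [apply Rabs_triang|]. rewrite Rabs_Ropp. lra. }
  lra.
Qed.

Lemma in_A_perturb f kk j (e : R) (N : nat) : (j < k kk)%nat -> in_A Om f ->
  in_A Om (fun z => f z + RtoC e * riemann_inv (phi kk j) (z kk) ^ N)%C.
Proof.
  intros Hj [Hc Hd].
  assert (Hp : forall a, ccont (fun u => RtoC e * u ^ N)%C a).
  { intros a. apply ccont_mult; [apply ccont_const|]. apply ccont_pow, ccont_id. }
  split.
  - intros z Hz a Ha. destruct (Hc z Hz (a / 2)) as [d1 [Hd1 H1]]; [lra|].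
    destruct (Hp (riemann_inv (phi kk j) (z kk)) (a / 2)) as [d2 [Hd2 H2]]; [lra|].
    destruct (riemann_inv_continuous _ _ _ (Hdom kk) (Hcomp kk j Hj) (Hriem kk j Hj) (z kk) d2 (Hz kk) Hd2)
      as [d3 [Hd3 H3]].
    exists (Rmin d1 d3). split; [now apply Rmin_glb_lt|]. intros w Hw Hwz.
    assert (q1 := Rmin_l d1 d3). assert (q2 := Rmin_r d1 d3).
    specialize (H1 w Hw ltac:(intros i; specialize (Hwz i); lra)).
    assert (A := H2 _ (H3 (w kk) (Hw kk) ltac:(specialize (Hwz kk); lra))).
    unfold dC in *. cbv beta in A.
    match goal with |- Cmod (?p + ?q - (?p' + ?q')) < _ =>
      replace (p + q - (p' + q'))%C with ((p - p') + (q - q'))%C by ring end.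
    eapply Rle_lt_trans; [apply Cmod_triangle|]. lra.
  - intros z Hz i w Hw. apply ex_derive_cdiff.
    specialize (Hd z Hz i w Hw). apply ex_derive_cdiff in Hd. destruct Hd as [m Hm].
    assert (Q : exists q, cdiff (fun u => RtoC e * riemann_inv (phi kk j) (upd z i u kk) ^ N)%C w q).
    { destruct (classic (kk = i)) as [<-|Ne].
      - destruct (riemann_inv_cdiff _ _ _ (Hdom kk) (Hcomp kk j Hj) (Hriem kk j Hj) w Hw) as [q Hq].
        destruct (cdiff_pow _ N _ _ Hq) as [q' Hq'].
        eexists. apply (cdiff_ext_loc (fun u => RtoC e * riemann_inv (phi kk j) u ^ N)%C).
        + exists 1. split; [lra|]. intros u _. now rewrite upd_same.
        + apply cdiff_mult; [apply cdiff_const|exact Hq'].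
      - exists (RtoC 0).
        apply (cdiff_ext_loc (fun u => RtoC e * riemann_inv (phi kk j) (z kk) ^ N)%C).
        + exists 1. split; [lra|]. intros u _. now rewrite upd_other.
        + apply cdiff_const. }
    destruct Q as [q Hq]. eexists. exact (cdiff_plus _ _ _ _ _ Hm Hq).
Qed.

Lemma in_D_re_comp_dense r n kk s f e : (forall i, (r i < k i)%nat) -> (1 <= n)%nat -> (1 <= s)%nat ->
  in_A Om f -> 0 < e -> exists g, in_A Om g /\ in_D n kk s (re_comp phi r g) /\ sup_ball Om f g e.
Proof.
  intros Hr Hn Hs Hf He.
  destruct (oscillation_steep l Hl n kk s (re_comp phi r f) (e / 2) Hn Hs (re_comp_angular r f)
    (re_comp_torus_continuous r f Hr Hf)) as [N HN]; [lra|].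
  set (psi := riemann_inv (phi kk (r kk))).
  exists (fun z => f z + RtoC (e / 2) * psi (z kk) ^ N)%C.
  assert (Hg := in_A_perturb f kk (r kk) (e / 2) N (Hr kk) Hf). fold psi in Hg.
  split; [easy|]. split.
  - rewrite (in_D_steep l Hl i0). split; [now apply re_comp_torus_continuous|].
    replace (re_comp phi r (fun z => f z + RtoC (e / 2) * psi (z kk) ^ N)%C) with
      (fun th : I -> R => re_comp phi r f th + e / 2 * cos (INR N * th kk)); [exact HN|].
    apply functional_extensionality. intros th. unfold re_comp, psi.
    rewrite (riemann_inv_eit _ _ _ (Hdom kk) (Hcomp kk _ (Hr kk)) (Hriem kk _ (Hr kk)) (th kk)).
    rewrite eit_pow, re_plus, re_scal_l. reflexivity.
  (* [psi] maps the closure of [Om kk] into the closed disc, so the bound holds whatever [N] is. *)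
  - exists (e / 2). split; [lra|]. intros z Hz. unfold dC.
    match goal with |- Cmod ?A <= _ => replace A with (- (RtoC (e / 2) * psi (z kk) ^ N))%C by ring end.
    rewrite Cmod_opp, Cmod_mult, Cmod_pow, Cmod_R, Rabs_pos_eq by lra.
    destruct (riemann_inv_spec _ _ _ (Hdom kk) (Hcomp kk _ (Hr kk)) (Hriem kk _ (Hr kk)) (z kk) (Hz kk)) as [A _].
    unfold closed_disc in A. fold psi in A.
    assert (B : Cmod (psi (z kk)) ^ N <= 1 ^ N) by (apply pow_incr; split; [apply Cmod_ge_0|easy]).
    rewrite pow1 in B. nra.
Qed.

Lemma S_set_dense_Gdelta : dense_Gdelta_in_A Om (S_set Om k phi).
Proof.
  destruct (finite_choices l Hl k) as [L HL].
  (* The list [L] may contain functions outside R; for these the condition is vacuous. Taking [S m]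
     for both indices starts them at 1. *)
  set (P := fun (m : nat) (a : (I -> nat) * I) f => (forall i, (fst a i < k i)%nat) ->
    in_D (S m) (snd a) (S m) (re_comp phi (fst a) f)).
  set (U := fun m f => forall a, In a (list_prod L l) -> P m a f).
  assert (HU : forall m, open_dense Om (U m)).
  { intros m. apply open_dense_list. intros [r kk].
    destruct (classic (forall i, (r i < k i)%nat)) as [Hr|Hr].
    - split.
      + intros f Hf HP. destruct (in_D_re_comp_open r (S m) kk (S m) Hr ltac:(lia) ltac:(lia) f Hf (HP Hr))
          as [e [He Ho]].
        exists e. split; [easy|]. intros g Hg Bg _. now apply Ho.
      + intros f Hf e He. destruct (in_D_re_comp_dense r (S m) kk (S m) f e Hr ltac:(lia) ltac:(lia) Hf He)
          as [g [Hg [Dg Bg]]].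
        exists g. split; [easy|]. split; [|easy]. intros _. exact Dg.
    - split.
      + intros f Hf _. exists 1. split; [lra|]. intros g Hg _ Hr'. easy.
      + intros f Hf e He. exists f. split; [easy|]. split; [easy|]. now apply sup_ball_refl. }
  assert (HS : forall f, in_A Om f -> (S_set Om k phi f <-> forall m, U m f)).
  { intros f Hf. split.
    - intros [_ Hall] m [r kk] _ Hr. apply Hall; [exact Hr|lia|lia].
    - intros Hall. split; [easy|]. intros r Hr kk s n Hs Hn.
      (* The diagonal index [n + s] has [S (n + s)] above both [n] and [s]. *)
      apply (in_D_mono l Hl i0 n (S (n + s)) kk s (S (n + s))); try lia.
      apply (Hall (n + s)%nat (r, kk)); [|exact Hr]. apply in_prod; auto. }
  split; [intros f [Hf _]; exact Hf|]. split.
  - exists U. split; [intros m; apply HU|exact HS].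
  - intros f Hf e He.
    destruct (baire_in_A Om (fun i => proj1 (proj2 (Hdom i))) U HU f Hf e He) as [g [Hg [Ug Bg]]].
    exists g. split; [now apply HS|easy].
Qed.

End Setting.

Theorem theorem5p4 (I : Type)
  (I_finite : exists l : list I, forall i, In i l)
  (I_nonempty : inhabited I)
  (Om : I -> C -> Prop) (k : I -> nat)
  (V : I -> nat -> Chat -> Prop) (phi : I -> nat -> C -> Chat)
  (H : setting Om k V phi) :
  dense_Gdelta_in_A Om (S_set Om k phi).
Proof.
  destruct I_finite as [l Hl]. destruct I_nonempty as [i0].
  exact (S_set_dense_Gdelta l Hl i0 Om k V phi H).
Qed.
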